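(* Let $A$ be a finite-dimensional $\mathbb{Z}$-graded algebra over a field $K$ with a triangular decomposition $(A^-,T,A^+)$. The category $\mathcal{G}(A)$ is a standardly stratified category with respect to the degree function $\deg:\operatorname{Irr}\mathcal{G}(T)\to\mathbb{Z}$, with standard objects $\Delta(\lambda)$ and costandard objects $\nabla(\lambda)$, $\lambda\in\operatorname{Irr}\mathcal{G}(T)$.
   Context: **Triangular decomposition.** A triangular decomposition of $A$ is a triple $(A^-,T,A^+)$ of graded subalgebras such that: (a) multiplication $A^-\otimes_K T\otimes_K A^+\to A$ is an isomorphism of vector spaces; (b) $T$ is concentrated in degree $0$, $A^+$ is supported in degrees $\ge 0$ and $A^-$ in degrees $\le 0$; (c) $A^-_0=K=A^+_0$; (d) $A^+T=TA^+$ and $A^-T=TA^-$; (e) $T$ is split over $K$, i.e. $\operatorname{End}_T(\lambda)=K$ for every simple $T$-module $\lambda$. ($T$ is not assumed semisimple.) **Notation.** $\mathcal{G}(A)$ is the category of finitely generated graded left $A$-modules with degree-preserving morphisms; $\operatorname{Irr}$ is the set of isomorphism classes of simple objects. $B^{\pm}=A^{\pm}T$, a graded subalgebra; $T$-modules become $B^\pm$-modules via the quotient map $B^\pm\to T$ killing nonzero degrees. Each $\lambda\in\operatorname{Irr}\mathcal{G}(T)$ lies in a single degree $\deg\lambda$. $A^{\mathrm{op}}$ is graded by $(A^{\mathrm{op}})_i=A_{-i}$; $M^*=\operatorname{Hom}_K(M,K)$ is a graded left $A^{\mathrm{op}}$-module with $(M^* )_i=(M_i)^*$ (similarly for $T$).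 For $M\in\mathcal{G}(T)$ put $\overline{\Delta}(M)=A\otimes_{B^+}M$ and $\overline{\nabla}(M)=\bigl(A^{\mathrm{op}}\otimes_{(B^-)^{\mathrm{op}}}M^*\bigr)^*$. For $\lambda\in\operatorname{Irr}\mathcal{G}(T)$, $\overline{\Delta}(\lambda)$ has a simple head $L(\lambda)$, and $\lambda\mapsto L(\lambda)$ is a bijection $\operatorname{Irr}\mathcal{G}(T)\to\operatorname{Irr}\mathcal{G}(A)$. With $P_T(\lambda)$, $I_T(\lambda)$ the projective cover and injective hull of $\lambda$ in $\mathcal{G}(T)$, put $\Delta(\lambda)=\overline{\Delta}(P_T(\lambda))$ and $\nabla(\lambda)=\overline{\nabla}(I_T(\lambda))$. **Standardly stratified category.** Let $\mathcal{C}$ be a $K$-linear finite length abelian category with enough projectives, with all simple objects absolutely simple, with simple objects $L(\lambda)$, $\lambda\in\Lambda$, and projective covers $P(\lambda)$. Let $d:\Lambda\to\Xi$ be a map with finite fibres to an interval-finite poset, and order $\Lambda$ by $\lambda<\mu$ iff $d(\lambda)<d(\mu)$. Let $\mathcal{C}_{\le\xi}$ (resp. $\mathcal{C}_{<\xi}$) be the Serre subcategory generated by the $L(\lambda)$ with $d(\lambda)\le\xi$ (resp. $<\xi$), and $\pi_\xi:\mathcal{C}_{\le\xi}\to\mathcal{C}_\xi=\mathcal{C}_{\le\xi}/\mathcal{C}_{<\xi}$ the quotient functor. Suppose each $\pi_\xi$ has an exact left adjoint $\Delta_\xi$. For $d(\lambda)=\xi$ let $L_\xi(\lambda)$ be the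 simple object of $\mathcal{C}_\xi$ corresponding to $\lambda$ and $P_\xi(\lambda)$ its projective cover in $\mathcal{C}_\xi$. The standard object is $\Delta_\xi(P_\xi(\lambda))$ and the proper standard object is $\Delta_\xi(L_\xi(\lambda))$. $\mathcal{C}$ (with this data) is standardly stratified if for each $\lambda$ there is an epimorphism from $P(\lambda)$ to the standard object of $\lambda$ whose kernel has a finite filtration by standard objects of $\mu$ with $\mu>\lambda$. Costandard objects are, dually, the images of the injective hulls of the $L_\xi(\lambda)$ in $\mathcal{C}_\xi$ under an exact right adjoint of $\pi_\xi$. Here $\Lambda=\operatorname{Irr}\mathcal{G}(T)$, $\Xi=\mathbb{Z}$, $d=\deg$. *)

(* Defs.v *)
From HB Require Import structures.
From mathcomp Require Import all_boot all_order all_algebra all_field.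
From mathcomp Require Import boolp classical_sets.

Set Implicit Arguments.
Unset Strict Implicit.
Unset Printing Implicit Defensive.

Import Order.TTheory GRing.Theory Num.Theory.
Local Open Scope ring_scope.

Record cat := Cat {
  ob :> Type;
  hom : ob -> ob -> Type;
  idm : forall X, hom X X;
  comp : forall X Y Z, hom Y Z -> hom X Y -> hom X Z;
  comp1m : forall X Y (f : hom X Y), comp (idm Y) f = f;
  compm1 : forall X Y (f : hom X Y), comp f (idm X) = f;
  compA : forall X Y Z W (h : hom Z W) (g : hom Y Z) (f : hom X Y),
    comp h (comp g f) = comp (comp h g) f }.

Arguments hom {c} X Y.
Arguments idm {c} X.
Arguments comp {c X Y Z} g f.

Declare Scope cat_scope.
Delimit Scope cat_scope with cat.
Notation "g \oc f" := (comp g f) (at level 50, left associativity) : cat_scope.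
Local Open Scope cat_scope.

Record functor (C D : cat) := Functor {
  fob :> C -> D;
  fmap : forall X Y : C, hom X Y -> hom (fob X) (fob Y);
  fmap1 : forall X, fmap (idm X) = idm (fob X);
  fmapM : forall X Y Z (g : hom Y Z) (f : hom X Y),
    fmap (g \oc f) = fmap g \oc fmap f }.

Arguments fmap {C D} _ {X Y} _.

(* F -| G, given by universal arrows X -> G (F X). *)
Definition adjoint (C D : cat) (F : functor D C) (G : functor C D) : Prop :=
  exists eta : forall X : D, hom X (G (F X)),
    (forall (X Y : D) (f : hom X Y),
       eta Y \oc f = fmap G (fmap F f) \oc eta X) /\
    (forall (X : D) (Y : C) (f : hom X (G Y)),
       exists! g : hom (F X) Y, fmap G g \oc eta X = f).

Section CategoricalNotions.
Variable C : cat.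
Implicit Types X Y Z : C.

Definition is_iso X Y (f : hom X Y) : Prop :=
  exists g : hom Y X, g \oc f = idm X /\ f \oc g = idm Y.

Definition isom X Y : Prop := exists f : hom X Y, is_iso f.

Definition is_mono X Y (f : hom X Y) : Prop :=
  forall Z (g h : hom Z X), f \oc g = f \oc h -> g = h.

Definition is_epi X Y (f : hom X Y) : Prop :=
  forall Z (g h : hom Y Z), g \oc f = h \oc f -> g = h.

Definition is_zero Z : Prop :=
  forall X, (exists! f : hom X Z, True) /\ (exists! f : hom Z X, True).

Definition zero_mor X Y (f : hom X Y) : Prop :=
  exists Z (g : hom X Z) (h : hom Z Y), is_zero Z /\ f = h \oc g.

Definition is_ker X Y K (f : hom X Y) (k : hom K X) : Prop :=
  zero_mor (f \oc k) /\
  forall W (g : hom W X), zero_mor (f \oc g) -> exists! h, k \oc h = g.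

Definition is_coker X Y Q (f : hom X Y) (q : hom Y Q) : Prop :=
  zero_mor (q \oc f) /\
  forall W (g : hom Y W), zero_mor (g \oc f) -> exists! h, h \oc q = g.

Definition ses X Y Z (f : hom X Y) (g : hom Y Z) : Prop :=
  is_ker g f /\ is_coker f g.

Definition is_product X Y P (p : hom P X) (q : hom P Y) : Prop :=
  forall Z (f : hom Z X) (g : hom Z Y),
    exists! h, p \oc h = f /\ q \oc h = g.

Definition is_simple X : Prop :=
  ~ is_zero X /\
  forall Y (m : hom Y X), is_mono m -> is_zero Y \/ is_iso m.

Inductive finite_length : C -> Prop :=
| FinLenZero X : is_zero X -> finite_length X
| FinLenExt X Y S (f : hom X Y) (g : hom Y S) :
    finite_length X -> is_simple S -> ses f g -> finite_length Y.

Inductive filtered (F : C -> Prop) : C -> Prop :=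
| FiltZero X : is_zero X -> filtered F X
| FiltExt X Y S (f : hom X Y) (g : hom Y S) :
    filtered F X -> F S -> ses f g -> filtered F Y.

Definition is_projective P : Prop :=
  forall X Y (e : hom X Y) (f : hom P Y), is_epi e -> exists g, e \oc g = f.

Definition is_injective I : Prop :=
  forall X Y (m : hom X Y) (f : hom X I), is_mono m -> exists g, g \oc m = f.

Definition is_proj_cover X P : Prop :=
  is_projective P /\
  exists p : hom P X, is_epi p /\
    forall Y (g : hom Y P), is_epi (p \oc g) -> is_epi g.

Definition is_inj_hull X I : Prop :=
  is_injective I /\
  exists i : hom X I, is_mono i /\
    forall Y (g : hom I Y), is_mono (g \oc i) -> is_mono g.

Definition enough_projectives : Prop :=
  forall X, exists P (p : hom P X), is_projective P /\ is_epi p.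

Definition maximal_sub N X (m : hom N X) : Prop :=
  [/\ is_mono m, ~ is_iso m &
      forall N' (n : hom N' X) (h : hom N N'),
        is_mono n -> n \oc h = m -> is_iso h \/ is_iso n].

(* H is X / rad X, where rad X is the intersection of the maximal subobjects
   of X. *)
Definition is_head X H : Prop :=
  exists q : hom X H, is_epi q /\
    forall W (g : hom W X), zero_mor (q \oc g) <->
      (forall N (m : hom N X), maximal_sub m -> exists h, m \oc h = g).

(* A Serre subcategory, as a class of objects. *)
Definition is_serre (S : C -> Prop) : Prop :=
  (forall X, is_zero X -> S X) /\
  forall X Y Z (f : hom X Y) (g : hom Y Z), ses f g -> (S Y <-> S X /\ S Z).

Definition serre_gen (G : C -> Prop) : C -> Prop :=
  fun X => forall S, is_serre S -> (forall Y, G Y -> S Y) -> S X.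

Definition Irr : Type :=
  {c : C -> Prop | exists X, is_simple X /\ c = isom X}.

Definition irr_rep (c : Irr) : C := sval (cid (svalP c)).

(* Some object satisfying F, or X if there is none. *)
Definition pick_ob (F : C -> Prop) X : C :=
  if pselect (exists Y, F Y) is left h then sval (cid h) else X.

Definition proj_cover X : C := pick_ob (is_proj_cover X) X.
Definition inj_hull X : C := pick_ob (is_inj_hull X) X.
Definition head_ob X : C := pick_ob (is_head X) X.

End CategoricalNotions.

Definition exact (C D : cat) (F : functor C D) : Prop :=
  forall (X Y Z : C) (f : hom X Y) (g : hom Y Z),
    ses f g -> ses (fmap F f) (fmap F g).

Section FullSubcategory.
Variables (C : cat) (S : C -> Prop).

Definition full_sub : cat :=
  @Cat {X : C | S X} (fun X Y => hom (sval X) (sval Y))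
    (fun X => idm (sval X)) (fun X Y Z g f => g \oc f)
    (fun X Y => @comp1m C _ _) (fun X Y => @compm1 C _ _)
    (fun X Y Z W => @compA C _ _ _ _).

End FullSubcategory.

(** The localization C[W^-1]: morphisms are words in morphisms of C and formal
    inverses of members of W, modulo the generated congruence. *)
Section Localization.
Variables (C : cat) (W : forall X Y : C, hom X Y -> Prop).

Inductive lterm : C -> C -> Type :=
| Lmor X Y : hom X Y -> lterm X Y
| Linv X Y (s : hom X Y) : W s -> lterm Y X
| Lcomp X Y Z : lterm Y Z -> lterm X Y -> lterm X Z.

Inductive leqv : forall X Y : C, lterm X Y -> lterm X Y -> Prop :=
| Leqv_refl X Y (t : lterm X Y) : leqv t t
| Leqv_sym X Y (t u : lterm X Y) : leqv t u -> leqv u t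
| Leqv_trans X Y (t u v : lterm X Y) : leqv t u -> leqv u v -> leqv t v
| Leqv_congr X Y Z (t t' : lterm Y Z) (u u' : lterm X Y) :
    leqv t t' -> leqv u u' -> leqv (Lcomp t u) (Lcomp t' u')
| Leqv_1m X Y (t : lterm X Y) : leqv (Lcomp (Lmor (idm Y)) t) t
| Leqv_m1 X Y (t : lterm X Y) : leqv (Lcomp t (Lmor (idm X))) t
| Leqv_A X Y Z V (t : lterm Z V) (u : lterm Y Z) (v : lterm X Y) :
    leqv (Lcomp t (Lcomp u v)) (Lcomp (Lcomp t u) v)
| Leqv_mor X Y Z (g : hom Y Z) (f : hom X Y) :
    leqv (Lmor (g \oc f)) (Lcomp (Lmor g) (Lmor f))
| Leqv_Vm X Y (s : hom X Y) (w : W s) :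
    leqv (Lcomp (Linv w) (Lmor s)) (Lmor (idm X))
| Leqv_mV X Y (s : hom X Y) (w : W s) :
    leqv (Lcomp (Lmor s) (Linv w)) (Lmor (idm Y)).

Definition lhom (X Y : C) : Type :=
  {c : lterm X Y -> Prop | exists t, c = leqv t}.

Definition lclass X Y (t : lterm X Y) : lhom X Y :=
  exist _ (leqv t) (ex_intro _ t erefl).

Definition lrep X Y (c : lhom X Y) : lterm X Y := sval (cid (svalP c)).

Definition lcomp X Y Z (g : lhom Y Z) (f : lhom X Y) : lhom X Z :=
  lclass (Lcomp (lrep g) (lrep f)).

Lemma lclassP X Y (t u : lterm X Y) : lclass t = lclass u <-> leqv t u.
Proof.
split=> [/(congr1 sval) /= E | E].
  by have: leqv u u := Leqv_refl u; rewrite -{1}E.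
apply: eq_exist => /=; apply/funext => v; apply/propext; split=> H.
  exact: Leqv_trans (Leqv_sym E) H.
exact: Leqv_trans E H.
Qed.

Lemma lrepK X Y (c : lhom X Y) : lclass (lrep c) = c.
Proof.
case: c => c h; rewrite /lrep /=; case: (cid _) => t /= E.
exact: eq_exist.
Qed.

Lemma lcompE X Y Z (t : lterm Y Z) (u : lterm X Y) :
  lcomp (lclass t) (lclass u) = lclass (Lcomp t u).
Proof.
by apply/lclassP; apply: Leqv_congr; apply/lclassP; rewrite lrepK.
Qed.

Lemma lcomp1m X Y (f : lhom X Y) : lcomp (lclass (Lmor (idm Y))) f = f.
Proof. by rewrite -[f]lrepK lcompE; apply/lclassP/Leqv_1m. Qed.

Lemma lcompm1 X Y (f : lhom X Y) : lcomp f (lclass (Lmor (idm X))) = f.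
Proof. by rewrite -[f]lrepK lcompE; apply/lclassP/Leqv_m1. Qed.

Lemma lcompA X Y Z V (h : lhom Z V) (g : lhom Y Z) (f : lhom X Y) :
  lcomp h (lcomp g f) = lcomp (lcomp h g) f.
Proof.
by rewrite -[f]lrepK -[g]lrepK -[h]lrepK !lcompE; apply/lclassP/Leqv_A.
Qed.

Definition localization : cat := Cat lcomp1m lcompm1 lcompA.

Lemma lmor1 (X : C) : lclass (Lmor (idm X)) = idm (X : localization).
Proof. by []. Qed.

Lemma lmorM X Y Z (g : hom Y Z) (f : hom X Y) :
  lclass (Lmor (g \oc f)) =
  @comp localization _ _ _ (lclass (Lmor g)) (lclass (Lmor f)).
Proof. by rewrite /= lcompE; apply/lclassP/Leqv_mor. Qed.

Definition loc_functor : functor C localization :=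
  @Functor C localization (fun X => X) (fun X Y f => lclass (Lmor f))
    lmor1 lmorM.

End Localization.

(** The Serre quotient C / S inverts the morphisms whose kernel and cokernel
    belong to S. *)
Section SerreQuotient.
Variables (C : cat) (S : C -> Prop).

Definition serre_weq (X Y : C) (f : hom X Y) : Prop :=
  (exists K (k : hom K X), is_ker f k /\ S K) /\
  (exists Q (q : hom Y Q), is_coker f q /\ S Q).

Definition serre_quot : cat := localization serre_weq.
Definition serre_proj : functor C serre_quot := loc_functor serre_weq.

End SerreQuotient.

Record lincat (K : fieldType) := LinCat {
  lob :> Type;
  lhoms : lob -> lob -> lmodType K;
  lid : forall X, lhoms X X;
  lcmp : forall X Y Z, lhoms Y Z -> lhoms X Y -> lhoms X Z;
  lcmp1m : forall X Y (f : lhoms X Y), lcmp (lid Y) f = f;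
  lcmpm1 : forall X Y (f : lhoms X Y), lcmp f (lid X) = f;
  lcmpA : forall X Y Z W (h : lhoms Z W) (g : lhoms Y Z) (f : lhoms X Y),
    lcmp h (lcmp g f) = lcmp (lcmp h g) f;
  lcmp_linr : forall X Y Z (g : lhoms Y Z), linear (@lcmp X Y Z g);
  lcmp_linl : forall X Y Z (f : lhoms X Y), linear ((@lcmp X Y Z)^~ f) }.

Definition cat_of_lincat (K : fieldType) (C : lincat K) : cat :=
  Cat (@lcmp1m K C) (@lcmpm1 K C) (@lcmpA K C).

Coercion cat_of_lincat : lincat >-> cat.
Canonical cat_of_lincat.

Definition abelian (K : fieldType) (C : lincat K) : Prop :=
  [/\ exists Z : C, is_zero Z,
      forall X Y : C, exists (P : C) (p : hom P X) (q : hom P Y),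
        is_product p q,
      forall (X Y : C) (f : hom X Y),
        (exists (N : C) (k : hom N X), is_ker f k) /\
        (exists (Q : C) (q : hom Y Q), is_coker f q),
      forall (X Y : C) (m : hom X Y), is_mono m ->
        exists (Z : C) (f : hom Y Z), is_ker f m &
      forall (X Y : C) (e : hom X Y), is_epi e ->
        exists (Z : C) (f : hom Z X), is_coker f e].

Definition simples_absolutely_simple (K : fieldType) (C : lincat K) : Prop :=
  forall X : C, is_simple X ->
    forall f : lhoms X X, exists c : K, f = c *: lid X.

Section StandardlyStratified.
Variables (K : fieldType) (C : lincat K).
Variables (disp : Order.disp_t) (Xi : porderType disp).
Variables (Lam : Type) (L : Lam -> C) (d : Lam -> Xi).

Definition strat_le (xi : Xi) : C -> Prop :=
  serre_gen (fun X => exists2 l, (d l <= xi)%O & X = L l).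

Definition strat_lt (xi : Xi) : C -> Prop :=
  serre_gen (fun X => exists2 l, (d l < xi)%O & X = L l).

Definition cat_le (xi : Xi) : cat := full_sub (strat_le xi).

Definition cat_lt_in (xi : Xi) : cat_le xi -> Prop :=
  fun X => strat_lt xi (sval X).

Definition cat_at (xi : Xi) : cat := serre_quot (@cat_lt_in xi).

Definition pi_at (xi : Xi) : functor (cat_le xi) (cat_at xi) :=
  serre_proj (@cat_lt_in xi).

Lemma strat_le_L (l : Lam) : strat_le (d l) (L l).
Proof. by move=> S Sserre SL; apply: SL; exists l. Qed.

Definition L_le (l : Lam) : cat_le (d l) := exist _ (L l) (@strat_le_L l).
Definition L_at (l : Lam) : cat_at (d l) := pi_at (d l) (L_le l).

(* The standard object of l, for a family D of left adjoints of the pi_at. *)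
Definition is_standard (D : forall xi, functor (cat_at xi) (cat_le xi))
    (l : Lam) (X : C) : Prop :=
  exists P : cat_at (d l), is_proj_cover (L_at l) P /\
    isom X (sval (D (d l) P)).

Definition is_costandard (N : forall xi, functor (cat_at xi) (cat_le xi))
    (l : Lam) (X : C) : Prop :=
  exists I : cat_at (d l), is_inj_hull (L_at l) I /\
    isom X (sval (N (d l) I)).

Definition standardly_stratified (std : Lam -> C) : Prop :=
  [/\ abelian C, forall X : C, finite_length X, enough_projectives C
    & simples_absolutely_simple C] /\
  [/\ forall l, is_simple (L l), forall l m, isom (L l) (L m) -> l = m
    & forall X : C, is_simple X -> exists l, isom X (L l)] /\
  [/\ forall x y : Xi, exists s : seq Xi,
        forall z, (x <= z <= y)%O -> z \in s
    & forall xi, exists (n : nat) (f : 'I_n -> Lam),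
        forall l, d l = xi -> exists i, l = f i] /\
  (exists D : forall xi, functor (cat_at xi) (cat_le xi),
     (forall xi, exact (D xi) /\ adjoint (D xi) (pi_at xi)) /\
     (forall l, is_standard D l (std l))) /\
  (forall l, exists (P Q : C) (p : hom P (std l)) (k : hom Q P),
     [/\ is_proj_cover (L l) P, is_epi p, is_ker p k
       & filtered (fun X => exists2 m, (d l < d m)%O & isom X (std m)) Q]).

Definition costandard_objects (costd : Lam -> C) : Prop :=
  exists N : forall xi, functor (cat_at xi) (cat_le xi),
    (forall xi, exact (N xi) /\ adjoint (pi_at xi) (N xi)) /\
    (forall l, is_costandard N l (costd l)).

End StandardlyStratified.

Section Grading.
Variables (K : fieldType) (V : vectType K) (G : int -> {vspace V}).

Definition is_grading : Prop :=
  (forall s : seq int, uniq s -> directv (\sum_(i <- s) G i)%VS) /\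
  (exists2 s : seq int, uniq s & (\sum_(i <- s) G i)%VS = fullv).

Lemma directv_seqP (s : seq int) : uniq s ->
  reflect (forall u : int -> V, (forall i, u i \in G i) ->
             \sum_(i <- s) u i = 0 -> forall i, i \in s -> u i = 0)
          (directv (\sum_(i <- s) G i)%VS).
Proof.
move=> us.
have -> : directv (\sum_(i <- s) G i)%VS =
          directv (\sum_(k < size s) G s`_k)%VS.
  rewrite !directvE /=; congr (\dim _ == _).
    by rewrite (big_nth 0) big_mkord.
  by rewrite (big_nth 0) big_mkord.
apply: (iffP directv_sum_independent) => [H u Gu u0 i si | H u Gu u0 k _].
  have := H (fun k : 'I_(size s) => u s`_k) (fun k _ => Gu _).
  rewrite -(big_mkord xpredT (fun k => u s`_k)) -(big_nth 0 xpredT) => /(_ u0).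
  have ks : (index i s < size s)%N by rewrite index_mem.
  by move=> /(_ (Ordinal ks) isT) /=; rewrite nth_index.
pose v i := if insub (index i s) is Some k then u k else 0.
have vE (k' : 'I_(size s)) : v s`_k' = u k'.
  rewrite /v index_uniq ?ltn_ord //; case: insubP => [k2 _ e|].
    by congr u; apply: val_inj.
  by rewrite ltn_ord.
have vG i : v i \in G i.
  rewrite /v; case: insubP => [k' ks e|_]; last exact: mem0v.
  by have := Gu k' isT; rewrite e nth_index // -index_mem.
rewrite -vE; apply: (H v vG); last exact/mem_nth.
rewrite (big_nth 0) big_mkord -[RHS]u0; apply: eq_bigr => j _; exact: vE.
Qed.

End Grading.

Section GradingProjection.
Variables (K : fieldType) (V : vectType K) (G : int -> {vspace V}).
Hypothesis hG : is_grading G.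

Lemma gr_component (s : seq int) (w : int -> V) (i j : int) (v : V) :
  uniq s -> i \in s -> (forall k, w k \in G k) -> v \in G j ->
  \sum_(k <- s) w k = v -> w i = if i == j then v else 0.
Proof.
move=> us si wG vG sw.
pose r := if j \in s then s else j :: s.
have ur : uniq r by rewrite /r; case: ifPn => //= ->.
have rj : j \in r by rewrite /r; case: ifPn => // _; rewrite mem_head.
have sr k : k \in s -> k \in r.
  by rewrite /r; case: ifPn => // _ sk; rewrite inE sk orbT.
pose u k := (if k \in s then w k else 0) - (if k == j then v else 0).
have uG k : u k \in G k.
  apply: memvB; first by case: ifP => // _; exact: mem0v.
  by case: eqP => [->|_] //; exact: mem0v.
have u0 : \sum_(k <- r) u k = 0.
  rewrite sumrB; apply/eqP; rewrite subr_eq0; apply/eqP.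
  have -> : \sum_(k <- r) (if k == j then v else 0) = v.
    rewrite (bigD1_seq j) //= eqxx big1 ?addr0 // => k /negPf kj.
    by rewrite kj.
  rewrite -big_mkcond /= -big_filter -sw; congr (\sum_(k <- _) _).
  have fs : filter [in s] s = s by apply/all_filterP/allP.
  by rewrite /r; case: ifPn => //= /negPf->.
have /directv_seqP := hG.1 _ ur => /(_ ur u uG u0 i (sr _ si)) /eqP.
by rewrite /u si subr_eq0 => /eqP.
Qed.

Lemma gr_proj_subproof (i : int) : exists f : 'End(V),
  (forall v, v \in G i -> f v = v) /\
  (forall j v, j != i -> v \in G j -> f v = 0).
Proof.
have [s0 us0 ds0] := hG.2.
have [s [us si ds]] : exists s, [/\ uniq s, i \in s &
    fullv = (\sum_(k <- s | true) G k)%VS].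
  have [s0i | s0i] := boolP (i \in s0); first by exists s0; split.
  exists (i :: s0); split; rewrite /= ?s0i ?mem_head // big_cons ds0.
  by apply/esym/eqP; rewrite eqEsubv subvf addvSr.
have H j v : v \in G j -> sumv_pi_for ds i v = if i == j then v else 0.
  move=> vG; apply: (@gr_component s (fun k => sumv_pi_for ds k v)) => //.
    by move=> k; exact: memv_sum_pi.
  by apply: sumv_pi_uniq_sum; rewrite ?filter_predT ?memvf.
exists (sumv_pi_for ds i); split=> [v /H | j v ji /H]; first by rewrite eqxx.
by rewrite eq_sym (negPf ji).
Qed.

Definition gr_proj (i : int) : 'End(V) := sval (cid (gr_proj_subproof i)).

Lemma gr_proj_id i v : v \in G i -> gr_proj i v = v.
Proof. by rewrite /gr_proj; case: (cid _) => f /= [H _]; exact: H. Qed.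

Lemma gr_proj_0 i j v : j != i -> v \in G j -> gr_proj i v = 0.
Proof. by rewrite /gr_proj; case: (cid _) => f /= [_ H]; exact: H. Qed.

Lemma gr_projE : exists2 s : seq int, uniq s &
  forall v, v = \sum_(i <- s) gr_proj i v.
Proof.
have [s us ds0] := hG.2; exists s => // v.
have ds : fullv = (\sum_(k <- s | true) G k)%VS by rewrite ds0.
have vE : \sum_(k <- s) sumv_pi_for ds k v = v.
  by apply: sumv_pi_uniq_sum; rewrite ?filter_predT ?memvf.
rewrite -{1}vE; apply: eq_big_seq => i si; rewrite -[in RHS]vE linear_sum /=.
rewrite (bigD1_seq i) //= gr_proj_id ?memv_sum_pi // big1 ?addr0 // => k ki.
exact: gr_proj_0 ki (memv_sum_pi _ _ _).
Qed.

Lemma memv_gr_proj i v : gr_proj i v \in G i.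
Proof.
have [s us ds0] := hG.2.
have ds : fullv = (\sum_(k <- s | true) G k)%VS by rewrite ds0.
have <- : \sum_(k <- s) sumv_pi_for ds k v = v.
  by apply: sumv_pi_uniq_sum; rewrite ?filter_predT ?memvf.
rewrite linear_sum /=; apply: memv_suml => k _.
have [<-|ki] := eqVneq k i; first by rewrite gr_proj_id ?memv_sum_pi.
by rewrite (gr_proj_0 ki) ?mem0v ?memv_sum_pi.
Qed.

End GradingProjection.

Lemma is_grading_proj (K : fieldType) (V : vectType K)
    (G : int -> {vspace V}) (p : int -> 'End(V)) (s : seq int) :
  uniq s ->
  (forall i v, p i v \in G i) -> (forall i v, v \in G i -> p i v = v) ->
  (forall i j v, j != i -> v \in G j -> p i v = 0) ->
  (forall v, v = \sum_(i <- s) p i v) -> is_grading G.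
Proof.
move=> us pG pid p0 ps; split=> [r ur|].
  apply/directv_seqP => // u uG /(congr1 (p _)) u0 i ri.
  have := u0 i; rewrite linear_sum linear0 (bigD1_seq i) //= pid //.
  by rewrite big1 ?addr0 // => k ki; exact: p0 ki (uG k).
exists s => //; apply/eqP; rewrite eqEsubv subvf; apply/subvP => v _.
rewrite {1}(ps v); elim: (s) => [|i r IHr]; first by rewrite !big_nil mem0v.
by rewrite !big_cons memv_add.
Qed.

Record grAlg (K : fieldType) := GrAlg {
  ga_sort :> falgType K;
  ga_gr : int -> {vspace ga_sort};
  ga_grP : is_grading ga_gr;
  ga_gr1 : 1 \in ga_gr 0;
  ga_grM : forall i j x y,
    x \in ga_gr i -> y \in ga_gr j -> x * y \in ga_gr (i + j) }.

HB.instance Definition _ (K : fieldType) (A : falgType K) := Vector.copy A^c A.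
HB.instance Definition _ (K : fieldType) (A : falgType K) :=
  GRing.Lmodule_isLalgebra.Build K A^c (fun k x y => @scalerAr K A k y x).
HB.instance Definition _ (K : fieldType) (A : falgType K) :=
  GRing.Lalgebra_isAlgebra.Build K A^c (fun k x y => @scalerAl K A k y x).
HB.instance Definition _ (K : fieldType) (A : falgType K) :=
  Algebra_isFalgebra.Build K A^c.

Definition bilin (K : fieldType) (U V W : vectType K) (f : U -> V -> W) : Prop :=
  (forall u, linear (f u)) /\ (forall v, linear (f^~ v)).

Definition is_action (K : fieldType) (A : falgType K) (V : vectType K)
    (act : A -> V -> V) : Prop :=
  [/\ bilin act, forall v, act 1 v = v
    & forall a b v, act (a * b) v = act a (act b v)].

Definition irreducible_action (K : fieldType) (A : falgType K) (V : vectType K)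
    (act : A -> V -> V) : Prop :=
  (fullv != 0 :> {vspace V})%VS /\
  forall U : {vspace V}, (forall a u, u \in U -> act a u \in U) ->
    U = 0%VS \/ U = fullv.

(* End_A(V) = K for every simple A-module V; as A is finite-dimensional, such a
   V is finite-dimensional. *)
Definition split_over (K : fieldType) (A : falgType K) : Prop :=
  forall (V : vectType K) (act : A -> V -> V),
    is_action act -> irreducible_action act ->
    forall f : 'End(V), (forall a v, f (act a v) = act a (f v)) ->
      exists c : K, f = c *: \1%VF.

(* Over the finite-dimensional algebra A, the finitely
   generated modules are the finite-dimensional ones. *)
Record grMod (K : fieldType) (A : grAlg K) := GrMod {
  gm_sort :> vectType K;
  gm_act : A -> gm_sort -> gm_sort;
  gm_actP : is_action gm_act;
  gm_gr : int -> {vspace gm_sort};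
  gm_grP : is_grading gm_gr;
  gm_grM : forall i j a m,
    a \in ga_gr A i -> m \in gm_gr j -> gm_act a m \in gm_gr (i + j) }.

Section GradedHom.
Variables (K : fieldType) (A : grAlg K) (M N : grMod A).

Definition grhom_pred : {pred 'Hom(M, N)} := fun f =>
  `[< (forall a m, f (gm_act a m) = gm_act a (f m)) /\
      (forall i m, m \in gm_gr M i -> f m \in gm_gr N i) >].

Lemma grhom_submod : submod_closed grhom_pred.
Proof.
have [[lN _] _ _] := gm_actP N.
split=> [|k f g /asboolP [fA fG] /asboolP [gA gG]]; apply/asboolP; split.
- move=> a m; rewrite !lfunE /=.
  by have := lN a (-1) 0 0; rewrite scaler0 addr0 scaleN1r addNr.
- by move=> i m _; rewrite lfunE mem0v.
- by move=> a m; rewrite !lfunE /= !lfunE /= fA gA lN.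
- by move=> i m mi; rewrite lfunE /= lfunE /= memvD ?memvZ ?fG ?gG.
Qed.

HB.instance Definition _ :=
  GRing.isSubmodClosed.Build K 'Hom(M, N) grhom_pred grhom_submod.

Record grhom := GrHom { grhom_val : 'Hom(M, N); _ : grhom_val \in grhom_pred }.

HB.instance Definition _ := [isSub for grhom_val].
HB.instance Definition _ := [Choice of grhom by <:].
HB.instance Definition _ := [SubChoice_isSubLmodule of grhom by <:].

Lemma grhomP (f : grhom) :
  (forall a m, grhom_val f (gm_act a m) = gm_act a (grhom_val f m)) /\
  (forall i m, m \in gm_gr M i -> grhom_val f m \in gm_gr N i).
Proof. by case: f => f /= /asboolP. Qed.

End GradedHom.

Section GradedModuleCategory.
Variables (K : fieldType) (A : grAlg K).
Implicit Types M N P Q : grMod A.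

Lemma grhom_id_subproof M : (\1%VF : 'End(M)) \in @grhom_pred K A M M.
Proof. by apply/asboolP; split=> [a m|i m]; rewrite !id_lfunE. Qed.

Lemma grhom_comp_subproof M N P (g : grhom N P) (f : grhom M N) :
  (grhom_val g \o grhom_val f)%VF \in @grhom_pred K A M P.
Proof.
apply/asboolP; have [fA fG] := grhomP f; have [gA gG] := grhomP g.
by split=> [a m|i m mi]; rewrite !comp_lfunE ?fA ?gA //; apply/gG/fG.
Qed.

Definition grhom_id M : grhom M M := GrHom (grhom_id_subproof M).
Definition grhom_comp M N P (g : grhom N P) (f : grhom M N) : grhom M P :=
  GrHom (grhom_comp_subproof g f).

Lemma grhom_comp1m M N (f : grhom M N) : grhom_comp (grhom_id N) f = f.
Proof. exact/val_inj/comp_lfun1l. Qed.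

Lemma grhom_compm1 M N (f : grhom M N) : grhom_comp f (grhom_id M) = f.
Proof. exact/val_inj/comp_lfun1r. Qed.

Lemma grhom_compA M N P Q (h : grhom P Q) (g : grhom N P) (f : grhom M N) :
  grhom_comp h (grhom_comp g f) = grhom_comp (grhom_comp h g) f.
Proof. exact/val_inj/comp_lfunA. Qed.

Lemma grhom_comp_linr M N P (g : grhom N P) : linear (@grhom_comp M N P g).
Proof.
by move=> k f f'; apply: val_inj; rewrite /= comp_lfunDr comp_lfunZr.
Qed.

Lemma grhom_comp_linl M N P (f : grhom M N) :
  linear ((@grhom_comp M N P)^~ f).
Proof.
by move=> k g g'; apply: val_inj; rewrite /= comp_lfunDl comp_lfunZl.
Qed.

Definition GMod : lincat K :=
  @LinCat K (grMod A) (fun M N => grhom M N : lmodType K) grhom_id grhom_comp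
    grhom_comp1m grhom_compm1 grhom_compA grhom_comp_linr grhom_comp_linl.

End GradedModuleCategory.

Section Opposite.
Variables (K : fieldType) (A : grAlg K).

Lemma op_grP : is_grading (fun i => ga_gr A (- i) : {vspace A^c}).
Proof.
have [s us ps] := gr_projE (ga_grP A).
apply: (@is_grading_proj K A (fun i => ga_gr A (- i))
          (fun i => gr_proj (ga_grP A) (- i)) (map -%R s)).
- by rewrite map_inj_uniq //; exact: oppr_inj.
- by move=> i v; exact: memv_gr_proj.
- by move=> i v; exact: gr_proj_id.
- by move=> i j v ji; apply: gr_proj_0; rewrite eqr_opp.
- move=> v; rewrite big_map [LHS]ps; apply: eq_bigr => i _.
  by rewrite opprK.
Qed.

Lemma op_gr1 : (1 : A^c) \in ga_gr A (- 0).
Proof. by rewrite oppr0; exact: ga_gr1. Qed.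

Lemma op_grM (i j : int) (x y : A^c) :
  x \in ga_gr A (- i) -> y \in ga_gr A (- j) -> x * y \in ga_gr A (- (i + j)).
Proof. by move=> xi yj; rewrite opprD addrC; exact: (ga_grM yj xi). Qed.

(* (A^op)_i = A_(-i) *)
Definition opAlg : grAlg K := GrAlg op_grP op_gr1 op_grM.

End Opposite.

Definition gr_subalg (K : fieldType) (A : grAlg K) (U : {aspace A}) : Prop :=
  1 \in U /\ forall i u, u \in U -> gr_proj (ga_grP A) i u \in U.

Section Subalgebra.
Variables (K : fieldType) (A : grAlg K) (U : {aspace A}).
Hypothesis hU : gr_subalg U.

Definition sub_gr (i : int) : {vspace subvs_of U} :=
  (linfun (vsval : subvs_of U -> A) @^-1: ga_gr A i)%VS.

Lemma mem_sub_gr i (u : subvs_of U) : (u \in sub_gr i) = (vsval u \in ga_gr A i).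
Proof. by rewrite /sub_gr -memv_preim lfunE. Qed.

Lemma sub_grP : is_grading sub_gr.
Proof.
have [s us ps] := gr_projE (ga_grP A).
pose p i : 'End(subvs_of U) :=
  (linfun (vsproj U) \o gr_proj (ga_grP A) i \o
   linfun (vsval : subvs_of U -> A))%VF.
have pE i u : vsval (p i u) = gr_proj (ga_grP A) i (vsval u).
  by rewrite /p !comp_lfunE !lfunE /= vsprojK // hU.2 // subvsP.
apply: (is_grading_proj (p := p) us).
- by move=> i v; rewrite mem_sub_gr pE memv_gr_proj.
- move=> i v; rewrite mem_sub_gr => vi; apply: val_inj.
  by rewrite /= pE gr_proj_id.
- move=> i j v ji; rewrite mem_sub_gr => vj; apply: val_inj.
  by rewrite /= pE (gr_proj_0 _ ji vj).
- move=> v; apply: val_inj; rewrite /= [LHS]ps linear_sum /=.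
  by apply: eq_bigr => i _; rewrite pE.
Qed.

Lemma sub_gr1 : 1 \in sub_gr 0.
Proof.
have U1 : algid U = 1 by apply/eqP; rewrite algid_eq1 hU.1.
by rewrite mem_sub_gr /= U1; exact: ga_gr1.
Qed.

Lemma sub_grM i j (x y : subvs_of U) :
  x \in sub_gr i -> y \in sub_gr j -> x * y \in sub_gr (i + j).
Proof. by rewrite !mem_sub_gr; exact: ga_grM. Qed.

Definition subAlg : grAlg K := GrAlg sub_grP sub_gr1 sub_grM.

End Subalgebra.

HB.instance Definition _ (K : fieldType) (A : grAlg K) (M : grMod A) (a : A) :=
  GRing.isLinear.Build K M M *:%R (gm_act (g := M) a)
    (let: And3 lM _ _ := gm_actP M in lM.1 a).

(* The K-dual of a graded A-module, as a module over A' along an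
   antihomomorphism phi : A' -> A that negates degrees. *)
Section Dual.
Variables (K : fieldType) (A A' : grAlg K) (phi : A' -> A).
Hypothesis phi_lin : linear phi.
Hypothesis phi1 : phi 1 = 1.
Hypothesis phiM : forall x y, phi (x * y) = phi y * phi x.
Hypothesis phiG : forall i x, x \in ga_gr A' i -> phi x \in ga_gr A (- i).
Variable M : grMod A.

Notation Mdual := 'Hom(M, K^o).

Definition dual_act (a : A') (f : Mdual) : Mdual :=
  (f \o linfun (gm_act (g := M) (phi a)))%VF.

Lemma dual_actE a f m : dual_act a f m = f (gm_act (phi a) m).
Proof. by rewrite comp_lfunE lfunE. Qed.

Lemma dual_actP : is_action dual_act.
Proof.
have [[lMr lMl] M1 MM] := gm_actP M.
split; first split.
- move=> a k f g; apply/lfunP => m.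
  by rewrite !(dual_actE, add_lfunE, scale_lfunE).
- move=> f k a b; apply/lfunP => m.
  by rewrite !(dual_actE, add_lfunE, scale_lfunE) phi_lin lMl linearP.
- by move=> f; apply/lfunP => m; rewrite dual_actE phi1 M1.
- by move=> a b f; apply/lfunP => m; rewrite !dual_actE phiM MM.
Qed.

Definition dual_proj_fun (i : int) (f : Mdual) : Mdual :=
  (f \o gr_proj (gm_grP M) i)%VF.

Lemma dual_proj_linear i : linear (dual_proj_fun i).
Proof.
by move=> k f g; rewrite /dual_proj_fun comp_lfunDl comp_lfunZl.
Qed.

HB.instance Definition _ i :=
  GRing.isLinear.Build K Mdual Mdual *:%R (dual_proj_fun i) (dual_proj_linear i).

(* The functionals on the component of degree i, extended by zero. *)
Definition dual_gr (i : int) : {vspace Mdual} := limg (linfun (dual_proj_fun i)).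

Lemma mem_dual_gr i f : f \in dual_gr i <->
  (forall j m, j != i -> m \in gm_gr M j -> f m = 0).
Proof.
split=> [/memv_imgP [g _ ->] j m ji mj | H].
  by rewrite lfunE /= comp_lfunE (gr_proj_0 _ ji mj) linear0.
have -> : f = linfun (dual_proj_fun i) f; last by rewrite memv_img ?memvf.
apply/lfunP => m; rewrite lfunE /= comp_lfunE.
have [s us ps] := gr_projE (gm_grP M).
rewrite [in LHS](ps m) [in RHS](ps m) !linear_sum /=; apply: eq_bigr => j _.
have pj := memv_gr_proj (gm_grP M) j m.
have [<-|ji] := eqVneq j i; first by rewrite (gr_proj_id _ pj).
by rewrite (H _ _ ji pj) (gr_proj_0 _ ji pj) linear0.
Qed.

Lemma dual_grP : is_grading dual_gr.
Proof.
have [s us ps] := gr_projE (gm_grP M).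
apply: (is_grading_proj (p := fun i => linfun (dual_proj_fun i)) us).
- by move=> i f; rewrite memv_img ?memvf.
- move=> i f /mem_dual_gr H; apply/lfunP => m; rewrite lfunE /= comp_lfunE.
  rewrite [in RHS](ps m) [in LHS](ps m) !linear_sum /=; apply: eq_bigr => j _.
  have pj := memv_gr_proj (gm_grP M) j m.
  have [<-|ji] := eqVneq j i; first by rewrite (gr_proj_id _ pj).
  by rewrite (H _ _ ji pj) (gr_proj_0 _ ji pj) linear0.
- move=> i j f ji /mem_dual_gr H; apply/lfunP => m.
  rewrite lfunE /= comp_lfunE zero_lfunE.
  by apply: (H i) (memv_gr_proj _ _ _); rewrite eq_sym.
- move=> f; apply/lfunP => m; rewrite [in LHS](ps m) linear_sum sum_lfunE /=.
  by apply: eq_bigr => i _; rewrite lfunE /= comp_lfunE.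
Qed.

Lemma dual_grM i j a f :
  a \in ga_gr A' i -> f \in dual_gr j -> dual_act a f \in dual_gr (i + j).
Proof.
move=> /phiG ai /mem_dual_gr H; apply/mem_dual_gr => k m kij mk.
rewrite dual_actE; apply: (H (- i + k)); last exact: gm_grM.
by apply: contraNneq kij => <-; rewrite addrA subrr add0r.
Qed.

Definition dualMod : grMod A' := GrMod dual_actP dual_grP dual_grM.

End Dual.

Section DualInstances.
Variables (K : fieldType) (A : grAlg K).

Lemma op_id_grading i (x : A) : x \in ga_gr A i -> x \in ga_gr (opAlg A) (- i).
Proof. by rewrite /= opprK. Qed.

(* The dual of a left A-module is a left A^op-module, and conversely. *)
Definition dual_to_op : grMod A -> grMod (opAlg A) :=
  @dualMod K A (opAlg A) (fun x => x)
    (fun k x y => erefl) erefl (fun x y => erefl) (fun i x h => h).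

Definition dual_from_op : grMod (opAlg A) -> grMod A :=
  @dualMod K (opAlg A) A (fun x => x)
    (fun k x y => erefl) erefl (fun x y => erefl) op_id_grading.

End DualInstances.

Section Tensor.
Variables (K : fieldType) (U V : vectType K).
Import VectorInternalTheory.

(* U (x) V, in coordinates *)
Definition tens : vectType K := 'M[K]_(dim U, dim V).
Definition pure (u : U) (v : V) : tens := (v2r u)^T *m v2r v.

End Tensor.

Record tri_decomp (K : fieldType) (A : grAlg K) := TriDecomp {
  tdN : {aspace A};
  tdT : {aspace A};
  tdP : {aspace A};
  tdN_gr : gr_subalg tdN;
  tdT_gr : gr_subalg tdT;
  tdP_gr : gr_subalg tdP;
  td_mult : exists mu : 'Hom(tens (tens (subvs_of tdN) (subvs_of tdT))
                                  (subvs_of tdP), A),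
    (forall x t y, mu (pure (pure x t) y) = vsval x * vsval t * vsval y) /\
    bijective mu;
  tdT_deg : (tdT <= ga_gr A 0)%VS;
  tdP_deg : forall i, i < 0 -> (tdP :&: ga_gr A i = 0)%VS;
  tdN_deg : forall i, 0 < i -> (tdN :&: ga_gr A i = 0)%VS;
  tdN_0 : (tdN :&: ga_gr A 0 = 1)%VS;
  tdP_0 : (tdP :&: ga_gr A 0 = 1)%VS;
  tdPT : (tdP * tdT = tdT * tdP)%VS;
  tdNT : (tdN * tdT = tdT * tdN)%VS;
  tdT_split : split_over (subvs_of tdT) }.

Section Induction.
Variables (K : fieldType) (A T : grAlg K) (B : {vspace A}) (q : A -> T).
Variable M : grMod T.

(* M is regarded as a module over the subalgebra B of A through q. *)
Definition balanced (V : vectType K) (t : A -> M -> V) : Prop :=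
  bilin t /\ forall a b m, b \in B -> t (a * b) m = t a (gm_act (q b) m).

(* X is A (x)_B M, with a (x) m = t a m *)
Definition is_induced (X : grMod A) : Prop :=
  exists t : A -> M -> X,
    [/\ balanced t,
        forall (V : vectType K) (f : A -> M -> V), balanced f ->
          exists! g : 'Hom(X, V), forall a m, g (t a m) = f a m,
        forall a a' m, gm_act a (t a' m) = t (a * a') m
      & forall i j a m, a \in ga_gr A i -> m \in gm_gr M j ->
          t a m \in gm_gr X (i + j)].

End Induction.

Section RegularModule.
Variables (K : fieldType) (A : grAlg K).

Lemma regular_actP : is_action (fun a b : A => a * b).
Proof.
split; first split.
- by move=> a k x y; rewrite mulrDr scalerAr.
- by move=> a k x y; rewrite mulrDl scalerAl.
- exact: mul1r.
- by move=> a b v; rewrite mulrA.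
Qed.

Definition regMod : grMod A := GrMod regular_actP (ga_grP A) (@ga_grM K A).

End RegularModule.

Definition induced (K : fieldType) (A T : grAlg K) (B : {vspace A}) (q : A -> T)
    (M : grMod T) : grMod A :=
  @pick_ob (GMod A) (is_induced B q M) (regMod A).

Section StandardModules.
Variables (K : fieldType) (A : grAlg K) (td : tri_decomp A).

Definition algT : grAlg K := subAlg (tdT_gr td).
Definition BP : {vspace A} := (tdP td * tdT td)%VS.
Definition BN : {vspace A} := (tdN td * tdT td)%VS.

(* On B^+ and B^-, this is the quotient map to T killing nonzero degrees. *)
Definition toT (b : A) : algT := vsproj (tdT td) (gr_proj (ga_grP A) 0 b).

Definition Delta_bar (M : GMod algT) : GMod A := induced BP toT M.

Definition nabla_bar (M : GMod algT) : GMod A :=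
  dual_from_op
    (@induced K (opAlg A) (opAlg algT) BN toT (dual_to_op M)).

Definition IrrT : Type := Irr (GMod algT).

(* A simple graded T-module lives in a single degree. *)
Definition degT (l : IrrT) : int :=
  xget 0 [set i | gm_gr (irr_rep l : GMod algT) i != 0%VS]%classic.

Definition simple_L (l : IrrT) : GMod A :=
  @head_ob (GMod A) (Delta_bar (irr_rep l)).

Definition Delta (l : IrrT) : GMod A :=
  Delta_bar (@proj_cover (GMod algT) (irr_rep l)).

Definition nabla (l : IrrT) : GMod A :=
  nabla_bar (@inj_hull (GMod algT) (irr_rep l)).

End StandardModules.

Arguments algT {K A} td.
Arguments Delta_bar {K A} td M.
Arguments nabla_bar {K A} td M.
Arguments IrrT {K A} td.
Arguments degT {K A} td l.
Arguments simple_L {K A} td l.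
Arguments Delta {K A} td l.
Arguments nabla {K A} td l.

(* Main.v *)
From HB Require Import structures.
From mathcomp Require Import all_boot all_order all_algebra all_field.
From mathcomp Require Import boolp classical_sets.
Require Import Defs.

(** Write N, T, P for the three parts of the triangular decomposition,
    B^+ = PT = TP and B^- = NT. Multiplication makes A a free right B^+ -module
    on a homogeneous basis of N, and A^op a free right (B^-)^op-module on a
    homogeneous basis of P. Everything rests on the coordinates that this gives
    ([ind_prop], [coind_prop]): an element of Delta-bar(M) is a unique sum of
    n_i (1 (x) m_i), and an element y of nabla-bar(M) is an arbitrary family
    (eps(n_i y))_i in M, where eps : nabla-bar(M) -> M is the counit. Hence both
    functors are exact, and their universal properties ([ip_lift], [cp_lift])
    are computed on generators.

    Since N sits in degrees at most 0 with N_0 = K, the module Delta-bar(M) of a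
    T-module M in degree d has M as its component of highest degree d and is
    generated by it. So a proper submodule of Delta-bar(l), for l simple, misses
    degree d, there is a largest one, and L(l) is the simple module with highest
    component l ([hw_maximal], [simple_classify]). Consequently the Serre
    subcategory of level d consists of the modules of degrees at most d
    ([strat_leP]), and X |-> X_d identifies the subquotient of level d with the
    T-modules in degree d. For the localization this is seen on words: the
    counit Delta-bar(X_d) -> X becomes invertible, and naturality shows that a
    word is determined by its degree d component, which is arbitrary
    ([lclass_counit], [topF_replete]). Under this identification the adjoints of
    the quotient functor are Delta-bar and nabla-bar, and the projective covers
    and injective hulls of the simple objects are those over T.

    For the filtration of P(l), call X of degrees at most d relatively
    projective if it lifts along epimorphisms between such modules. Then X_d is
    projective over T, because X |-> X_d has the exact right adjoint nabla-bar
    ([proj_le_top]). Moreover Delta-bar(X_d) -> X is injective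
    ([proj_le_counit]): X is a summand of a module induced from a B^+ -module of
    degrees at most d, on whose component of degree d the basis of N acts
    freely. The cokernel is relatively projective in degrees at most d - 1.
    Starting from P(l) and descending to the degree of l, one removes
    extensions of standard modules of larger degree ([descend]); what remains is
    a relatively projective module over L(l), and comparing it with Delta(l) in
    both directions shows that the two agree ([cover_filtration]). *)

Set Implicit Arguments.
Unset Strict Implicit.
Unset Printing Implicit Defensive.
Import Order.TTheory GRing.Theory Num.Theory.
Local Open Scope ring_scope.
Local Open Scope cat_scope.

Notation "a ** m" := (gm_act a m) (at level 40, left associativity) : ring_scope.
Notation pr M i := (gr_proj (gm_grP M) i).
Coercion grhom_hom (K : fieldType) (A : grAlg K) (M N : grMod A)
  (f : grhom M N) : 'Hom(M, N) := grhom_val f.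

(** * Linear maps *)

Section LinearMaps.
Variable K : fieldType.
Implicit Types U V W S : vectType K.

Definition inj U V (f : 'Hom(U, V)) : Prop := forall x, f x = 0 -> x = 0.
Definition surj U V (f : 'Hom(U, V)) : Prop := forall y, exists x, y = f x.

Lemma injP U V (f : 'Hom(U, V)) : inj f -> injective f.
Proof.
by move=> fi x y e; apply/subr0_eq/fi; rewrite linearB /= e subrr.
Qed.

Lemma inj_lker U V (f : 'Hom(U, V)) : inj f <-> lker f == 0%VS.
Proof.
split=> [/injP /lker0P // | /lker0P fi x e].
by apply: fi; rewrite e linear0.
Qed.

Lemma surj_limg U V (f : 'Hom(U, V)) : surj f <-> limg f = fullv.
Proof.
split=> [fs | e y].
  apply/vspaceP => y; rewrite memvf; have [x ->] := fs y.
  by rewrite memv_img ?memvf.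
have: y \in limg f by rewrite e memvf.
by case/memv_imgP => x _ ->; exists x.
Qed.

Lemma linfun_ex U V (phi : U -> V) : linear phi ->
  exists f : 'Hom(U, V), forall x, f x = phi x.
Proof.
move=> l; pose lp := GRing.isLinear.Build K U V *:%R phi l.
pose g : {linear U -> V} := HB.pack phi lp.
by exists (linfun g) => x; rewrite lfunE.
Qed.

Lemma lift_inj S V W (i : 'Hom(S, V)) (f : 'Hom(W, V)) : inj i ->
  (forall w, exists s, f w = i s) ->
  exists h : 'Hom(W, S), forall w, i (h w) = f w.
Proof.
move=> /inj_lker ii fi; exists (i^-1 \o f)%VF => w.
by have [s e] := fi w; rewrite comp_lfunE e lker0_lfunK.
Qed.

Lemma fact_surj U V W (p : 'Hom(U, V)) (f : 'Hom(U, W)) : surj p ->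
  (forall x, p x = 0 -> f x = 0) ->
  exists h : 'Hom(V, W), forall x, h (p x) = f x.
Proof.
move=> /surj_limg pE pf; exists (f \o p^-1)%VF => x; rewrite comp_lfunE.
apply/subr0_eq; rewrite -linearB; apply: pf.
by rewrite linearB /= limg_lfunVK ?subrr // pE memvf.
Qed.

Lemma inj_dim U V (f : 'Hom(U, V)) : inj f -> (\dim {:U} <= \dim {:V})%N.
Proof.
move=> /inj_lker /eqP e; rewrite -(@limg_dim_eq _ _ _ f fullv) ?e ?capv0 //.
exact/dimvS/subvf.
Qed.

Lemma inj_surj U V (f : 'Hom(U, V)) :
  inj f -> (\dim {:V} <= \dim {:U})%N -> surj f.
Proof.
move=> /inj_lker /eqP e d; apply/surj_limg/eqP; rewrite eqEdim subvf.
by rewrite (@limg_dim_eq _ _ _ f fullv) ?e ?capv0.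
Qed.

Lemma surj_dim U V (f : 'Hom(U, V)) : surj f -> (\dim {:V} <= \dim {:U})%N.
Proof. by move=> /surj_limg <-; rewrite -(limg_ker_dim f fullv) leq_addl. Qed.

Lemma surj_inj U V (f : 'Hom(U, V)) :
  surj f -> (\dim {:U} <= \dim {:V})%N -> inj f.
Proof.
move=> /surj_limg e; rewrite -e -(limg_ker_dim f fullv) capfv.
rewrite -{2}[\dim (limg f)]add0n leq_add2r leqn0 dimv_eq0 => k.
exact/inj_lker.
Qed.

Lemma sub_space V (U : {vspace V}) : exists (S : vectType K) (i : 'Hom(S, V)),
  inj i /\ forall x, x \in U <-> exists s, x = i s.
Proof.
exists (subvs_of U), (linfun vsval); split=> [x | x].
  by rewrite lfunE => /= e; apply: val_inj.
split=> [xU | [s ->]]; last by rewrite lfunE subvsP.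
by exists (vsproj U x); rewrite lfunE /= vsprojK.
Qed.

Lemma quot_space V (U : {vspace V}) : exists (Q : vectType K) (p : 'Hom(V, Q)),
  surj p /\ forall x, p x = 0 <-> x \in U.
Proof.
pose f := (linfun (vsproj (U^C)) \o (\1 - projv U))%VF.
have fE x : vsval (f x) = x - projv U x.
  rewrite comp_lfunE lfunE /= add_lfunE opp_lfunE id_lfunE vsprojK //.
  exact: memv_projC.
exists (subvs_of (U^C)), f; split=> [y | x].
  exists (vsval y); apply: val_inj; rewrite /= fE.
  have -> : projv U (vsval y) = 0; last by rewrite subr0.
  by apply/eqP; rewrite -memv_ker lker_proj subvsP.
split=> [/(congr1 val) /= | xU].
  by rewrite fE => /subr0_eq ->; exact: memv_proj.
by apply: val_inj; rewrite /= fE projv_id ?subrr.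
Qed.

End LinearMaps.

(** * Gradings *)

Section Gradings.
Variables (K : fieldType) (V : vectType K) (G : int -> {vspace V}).
Hypothesis hG : is_grading G.

Lemma gr_memP i v : v \in G i <-> gr_proj hG i v = v.
Proof.
by split=> [|<-]; [exact: gr_proj_id | exact: memv_gr_proj].
Qed.

Lemma gr_eq0 v : (forall i, gr_proj hG i v = 0) -> v = 0.
Proof.
have [s _ e] := gr_projE hG => v0; rewrite (e v).
by apply: big1 => i _.
Qed.

Lemma gr_mem_only i v : (forall j, j != i -> gr_proj hG j v = 0) -> v \in G i.
Proof.
move=> v0; have [s us e] := gr_projE hG; rewrite (e v).
apply: memv_suml => j _; have [->|/v0 ->] := eqVneq j i; last exact: mem0v.
exact: memv_gr_proj.
Qed.

Lemma gr_supp : exists s : seq int, forall i, i \notin s -> G i = 0%VS.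
Proof.
have [s _ e] := gr_projE hG; exists s => i si; apply/eqP.
rewrite -subv0; apply/subvP => v vi; rewrite memv0 (e v) big_seq big1 // => j sj.
by apply: (gr_proj_0 hG _ vi); apply: contraNneq si => ->.
Qed.

Lemma gr_bound : exists n : int, forall i, n < i -> G i = 0%VS.
Proof.
have [s h] := gr_supp; exists (\sum_(j <- s) `|j|) => i ni.
apply: h; apply: contraTN ni => si; rewrite -leNgt.
rewrite (big_rem i si) /= (le_trans (ler_norm i)) // lerDl.
by apply: sumr_ge0 => j _; exact: normr_ge0.
Qed.

Lemma gr_span (P : V -> Prop) : P 0 -> (forall u v, P u -> P v -> P (u + v)) ->
  (forall i v, v \in G i -> P v) -> forall v, P v.
Proof.
move=> P0 PD PG v; have [s _ e] := gr_projE hG; rewrite (e v).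
elim/big_ind: _ => // i _; exact: PG (memv_gr_proj hG i v).
Qed.

Lemma gr_proj_proj i j v :
  gr_proj hG i (gr_proj hG j v) = if i == j then gr_proj hG i v else 0.
Proof.
case: eqVneq => [-> | ij]; first exact: gr_proj_id (memv_gr_proj _ _ _).
by apply: (gr_proj_0 hG _ (memv_gr_proj hG j v)); rewrite eq_sym.
Qed.

Lemma gr_sum (s : seq int) v : uniq s ->
  (forall i, i \notin s -> gr_proj hG i v = 0) -> v = \sum_(i <- s) gr_proj hG i v.
Proof.
move=> us vs; apply/subr0_eq/gr_eq0 => j; rewrite linearB linear_sum /=.
under eq_bigr do rewrite gr_proj_proj.
have [js|js] := boolP (j \in s).
  rewrite (bigD1_seq j) //= eqxx big1 ?addr0 ?subrr // => i /negPf ij.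
  by rewrite eq_sym ij.
rewrite vs // big_seq big1 ?subr0 // => i is_.
by case: eqP => // e; rewrite e is_ in js.
Qed.

Lemma gr_proj_notin i v : G i = 0%VS -> gr_proj hG i v = 0.
Proof. by move=> e; apply/eqP; rewrite -memv0 -e memv_gr_proj. Qed.

(** A graded subspace has a homogeneous basis: concatenate bases of its
    components. *)
Lemma homog_basis (N : {vspace V}) :
  (forall i u, u \in N -> gr_proj hG i u \in N) ->
  exists (r : nat) (b : 'I_r -> V) (e : 'I_r -> int),
  [/\ forall i, b i \in N, forall i, b i \in G (e i), r = \dim N
    & forall v, v \in N -> exists c : 'I_r -> K, v = \sum_i c i *: b i].
Proof.
move=> Ng; have [s us es] := gr_projE hG.
pose H i := (N :&: G i)%VS.
have sN : (\sum_(i <- s) H i)%VS = N.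
  apply/eqP; rewrite eqEsubv; apply/andP; split; apply/subvP => v.
    elim: (s) v => [|i t IHt] v; first by rewrite big_nil memv0 => /eqP ->; exact: mem0v.
    rewrite big_cons => /memv_addP [x /memv_capP [xN _] [y /IHt yN ->]].
    exact: memvD.
  move=> vN; rewrite (es v); elim: (s) => [|i t IHt]; first by rewrite !big_nil mem0v.
  by rewrite !big_cons memv_add // memv_cap Ng ?memv_gr_proj.
have dH : directv (\sum_(i <- s) H i)%VS.
  apply/(directv_seqP _ us) => u uH; apply: (directv_seqP G us _ u _).
    exact: hG.1 us.
  by move=> i; have /memv_capP [] := uH i.
pose X : seq V := flatten [seq (vbasis (H i) : seq V) | i <- s].
have XV : (<<X>> = N)%VS.
  rewrite -sN /X; elim: (s) => [|i t IHt] /=; first by rewrite span_nil big_nil.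
  by rewrite span_cat IHt big_cons (span_basis (vbasisP _)).
have szX : size X = \dim N.
  move: dH; rewrite -sN directvE /= => /eqP ->.
  rewrite /X size_flatten /shape -map_comp sumnE big_map.
  by apply: eq_bigr => i _ /=; rewrite size_tuple.
have hX x : x \in X -> exists i, x \in H i.
  case/flattenP => l /mapP [i _ ->] /vbasis_mem xi; by exists i.
have /choice [e he] : forall i : 'I_(size X), exists j, X`_i \in H j.
  by move=> i; exact/hX/mem_nth.
exists (size X), (fun i : 'I_(size X) => X`_i), e; split=> //.
- by move=> i; have /memv_capP [] := he i.
- by move=> i; have /memv_capP [] := he i.
- move=> v vN; exists (fun i => coord (in_tuple X) i v).
  by apply: (@coord_span _ _ _ (in_tuple X)); rewrite XV.
Qed.

End Gradings.

Lemma gr_shift (K : fieldType) (V W : vectType K) G H (hG : @is_grading K V G)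
    (hH : @is_grading K W H) (f : 'Hom(V, W)) e :
  (forall i v, v \in G i -> f v \in H (e + i)) ->
  forall i v, gr_proj hH (e + i) (f v) = f (gr_proj hG i v).
Proof.
move=> fG i v; have [s us es] := gr_projE hG.
rewrite [in LHS](es v) [in RHS](es v) !linear_sum /=; apply: eq_bigr => j _.
have pj := memv_gr_proj hG j v; have [<-|ji] := eqVneq j i.
  by rewrite (gr_proj_id _ pj) (gr_proj_id _ (fG _ _ pj)).
rewrite (gr_proj_0 hG ji pj) linear0 (gr_proj_0 hH _ (fG _ _ pj)) //.
by apply: contra_neq ji => /addrI.
Qed.

(** * Graded modules *)

Section GradedModules.
Variables (K : fieldType) (A : grAlg K).
Implicit Types M N P Q W S : grMod A.

Lemma act_lin M (a : A) : linear (gm_act (g := M) a).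
Proof. by have [[l _] _ _] := gm_actP M. Qed.

Lemma act_linl M (m : M) : linear ((gm_act (g := M))^~ m).
Proof. by have [[_ l] _ _] := gm_actP M. Qed.

Lemma act1 M (m : M) : 1 ** m = m.
Proof. by have [_ h _] := gm_actP M. Qed.

Lemma actM M (a b : A) (m : M) : (a * b) ** m = a ** (b ** m).
Proof. by have [_ _ h] := gm_actP M. Qed.

Lemma actr0 M (a : A) : a ** (0 : M) = 0.
Proof. exact: linear0. Qed.

Lemma actrZ M (a : A) c (m : M) : a ** (c *: m) = c *: (a ** m).
Proof. exact: linearZ. Qed.

Lemma actl_ex M (m : M) : exists f : 'Hom(A, M), forall a, f a = a ** m.
Proof. exact/linfun_ex/act_linl. Qed.

Lemma actr_ex M (a : A) : exists f : 'Hom(M, M), forall m, f m = a ** m.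
Proof. exact/linfun_ex/act_lin. Qed.

Lemma act0l M (m : M) : 0 ** m = 0.
Proof. by have [f <-] := actl_ex m; rewrite linear0. Qed.

Lemma actDl M (a b : A) (m : M) : (a + b) ** m = a ** m + b ** m.
Proof. by have [f h] := actl_ex m; rewrite -!h linearD. Qed.

Lemma actZl M c (a : A) (m : M) : (c *: a) ** m = c *: (a ** m).
Proof. by have [f h] := actl_ex m; rewrite -!h linearZ. Qed.

Lemma actl_sum M I (r : seq I) (F : I -> A) (m : M) :
  (\sum_(i <- r) F i) ** m = \sum_(i <- r) F i ** m.
Proof.
have [f h] := actl_ex m; rewrite -h linear_sum; apply: eq_bigr => i _.
exact: h.
Qed.

Lemma pr_act M i j a (m : M) : a \in ga_gr A i ->
  pr M (i + j) (a ** m) = a ** pr M j m.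
Proof.
move=> ai; have [f h] := actr_ex M a; rewrite -!h.
by apply: gr_shift => k v vk; rewrite h; exact: gm_grM.
Qed.

Lemma hom_act M N (f : grhom M N) a m : f (a ** m) = a ** f m.
Proof. exact: (grhomP f).1. Qed.

Lemma hom_gr M N (f : grhom M N) i m : m \in gm_gr M i -> f m \in gm_gr N i.
Proof. exact: (grhomP f).2. Qed.

Lemma pr_hom M N (f : grhom M N) i m : pr N i (f m) = f (pr M i m).
Proof.
rewrite -{1}[i]add0r; apply: gr_shift => k v; rewrite add0r; exact: hom_gr.
Qed.

Lemma hom_ext M N (f g : grhom M N) : (forall x, f x = g x) -> f = g.
Proof. by move=> e; apply/val_inj/lfunP. Qed.

Lemma homE M N P (g : grhom N P) (f : grhom M N) x :
  (grhom_comp g f) x = g (f x).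
Proof. exact: comp_lfunE. Qed.

Lemma hom1E M x : (grhom_id M) x = x.
Proof. exact: id_lfunE. Qed.

Lemma hom0E M N x : (0 : grhom M N) x = 0.
Proof. exact: zero_lfunE. Qed.

Lemma mk_hom M N (f : 'Hom(M, N)) :
  (forall a m, f (a ** m) = a ** f m) ->
  (forall i m, m \in gm_gr M i -> f m \in gm_gr N i) ->
  exists g : grhom M N, forall x, g x = f x.
Proof.
move=> fa fg; have fP : f \in @grhom_pred K A M N by apply/asboolP.
by exists (GrHom fP).
Qed.

(** Commuting with every projection is the elementwise form of preserving
    degrees that passes through injections and surjections. *)
Lemma mk_hom_pr M N (f : 'Hom(M, N)) :
  (forall a m, f (a ** m) = a ** f m) ->
  (forall i m, pr N i (f m) = f (pr M i m)) ->
  exists g : grhom M N, forall x, g x = f x.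
Proof.
move=> fa fg; apply: mk_hom => // i m /(gr_memP (gm_grP M)) e.
by apply/(gr_memP (gm_grP N)); rewrite fg e.
Qed.

Lemma glift_inj S M W (i : grhom S M) (f : grhom W M) : inj i ->
  (forall w, exists s, f w = i s) ->
  exists h : grhom W S, forall w, i (h w) = f w.
Proof.
move=> ii fi; have [h hE] := lift_inj ii fi.
have [||g gE] := mk_hom_pr (f := h); last by exists g => w; rewrite gE.
  by move=> a m; apply: (injP ii); rewrite hom_act !hE hom_act.
by move=> k m; apply: (injP ii); rewrite -pr_hom !hE pr_hom.
Qed.

Lemma gfact_surj M Q W (p : grhom M Q) (f : grhom M W) : surj p ->
  (forall x, p x = 0 -> f x = 0) ->
  exists h : grhom Q W, forall x, h (p x) = f x.
Proof.
move=> sp pf; have [h hE] := fact_surj sp pf.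
have [||g gE] := mk_hom_pr (f := h); last by exists g => w; rewrite gE.
  by move=> a y; have [m ->] := sp y; rewrite -hom_act !hE hom_act.
by move=> k y; have [m ->] := sp y; rewrite pr_hom !hE pr_hom.
Qed.

Lemma ginv M N (f : grhom M N) : inj f -> surj f ->
  exists g : grhom N M,
    grhom_comp g f = grhom_id M /\ grhom_comp f g = grhom_id N.
Proof.
move=> fi fs; have [|g gE] := @glift_inj M N N f (grhom_id N) fi.
  by move=> w; rewrite hom1E.
exists g; split; apply: hom_ext => x; rewrite homE hom1E.
  by apply: (injP fi); rewrite gE hom1E.
by rewrite gE hom1E.
Qed.

Definition gsub M (U : {vspace M}) : Prop :=
  (forall a u, u \in U -> a ** u \in U) /\
  (forall i u, u \in U -> pr M i u \in U).

Lemma sub_mod M (U : {vspace M}) : gsub U ->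
  exists (S : grMod A) (i : grhom S M),
    inj i /\ forall x, x \in U <-> exists s, x = i s.
Proof.
move=> [Ua Ug]; have [S [i [ii iU]]] := sub_space U.
have iP s : i s \in U by apply/iU; exists s.
have /choice [act actE] : forall p : A * S, exists t, p.1 ** i p.2 = i t.
  by move=> [a s]; apply/iU; exact: Ua.
have eq := injP ii.
have actP : is_action (fun a s => act (a, s)).
  split; first split.
  - by move=> a k s t /=; apply: eq; rewrite linearP /= -!actE /= linearP /= linearP.
  - by move=> s k a b /=; apply: eq; rewrite linearP /= -!actE /= act_linl.
  - by move=> s /=; apply: eq; rewrite -actE act1.
  - by move=> a b s /=; apply: eq; rewrite -!actE actM.
have /choice [p pE] : forall k, exists p : 'Hom(S, S),
    forall s, i (p s) = pr M k (i s).
  move=> k; have [|p pE] := @lift_inj _ _ _ _ i (pr M k \o i)%VF ii.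
    by move=> s; rewrite comp_lfunE; apply/iU/Ug.
  by exists p => s; rewrite pE comp_lfunE.
pose G k := limg (p k).
have memG k s : s \in G k <-> i s \in gm_gr M k.
  split=> [/memv_imgP [t _ ->] | /(gr_memP (gm_grP M)) e].
    by rewrite pE memv_gr_proj.
  by apply/memv_imgP; exists s; rewrite ?memvf //; apply: eq; rewrite pE e.
have [s us es] := gr_projE (gm_grP M).
have GP : is_grading G.
  apply: (is_grading_proj (p := p) us).
  - by move=> k v; rewrite memv_img ?memvf.
  - by move=> k v /memG vk; apply: eq; rewrite pE gr_proj_id.
  - move=> k j v jk /memG vj; apply: eq.
    by rewrite pE linear0; apply: (gr_proj_0 _ jk vj).
  - move=> v; apply: eq; rewrite linear_sum /= {1}(es (i v)).
    by apply: eq_bigr => k _; rewrite pE.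
have GM k j a m : a \in ga_gr A k -> m \in G j -> act (a, m) \in G (k + j).
  by move=> ak /memG mj; apply/memG; rewrite -actE; exact: gm_grM.
have [||f fE] := @mk_hom (GrMod actP GP GM) M i.
- by move=> a m; rewrite -actE.
- by move=> k m /memG.
exists (GrMod actP GP GM), f; split.
  by move=> x; rewrite fE; exact: ii.
by move=> x; split=> [/iU [t ->] | [t ->]]; [exists t; rewrite fE | rewrite fE].
Qed.

Lemma quot_mod M (U : {vspace M}) : gsub U ->
  exists (Q : grMod A) (p : grhom M Q),
    surj p /\ forall x, p x = 0 <-> x \in U.
Proof.
move=> [Ua Ug]; have [Q [p [ps pU]]] := quot_space U.
have /choice [act actE] : forall a, exists f : 'Hom(Q, Q),
    forall x, f (p x) = p (a ** x).
  move=> a; have [f0 f0E] := actr_ex M a.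
  have [|f fE] := @fact_surj _ _ _ _ p (p \o f0)%VF ps.
    by move=> x /pU xU; rewrite comp_lfunE f0E; apply/pU/Ua.
  by exists f => x; rewrite fE comp_lfunE f0E.
have actP : is_action (fun a s => act a s).
  split; first split.
  - by move=> a k s t; rewrite linearP.
  - by move=> s k a b; have [x ->] := ps s; rewrite !actE act_linl linearP.
  - by move=> s; have [x ->] := ps s; rewrite actE act1.
  - by move=> a b s; have [x ->] := ps s; rewrite !actE actM.
have /choice [q qE] : forall k, exists q : 'Hom(Q, Q),
    forall s, q (p s) = p (pr M k s).
  move=> k; have [|q qE] := @fact_surj _ _ _ _ p (p \o pr M k)%VF ps.
    by move=> x /pU xU; rewrite comp_lfunE; apply/pU/Ug.
  by exists q => s; rewrite qE comp_lfunE.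
pose G k := (p @: gm_gr M k)%VS.
have memG k s : s \in gm_gr M k -> p s \in G k by exact: memv_img.
have [s us es] := gr_projE (gm_grP M).
have GP : is_grading G.
  apply: (is_grading_proj (p := q) us).
  - by move=> k v; have [x ->] := ps v; rewrite qE memG ?memv_gr_proj.
  - by move=> k v /memv_imgP [x xk ->]; rewrite qE gr_proj_id.
  - move=> k j v jk /memv_imgP [x xj ->]; rewrite qE.
    by rewrite (gr_proj_0 _ jk xj) linear0.
  - move=> v; have [x ->] := ps v; rewrite {1}(es x) linear_sum /=.
    by apply: eq_bigr => k _; rewrite qE.
have GM k j a m : a \in ga_gr A k -> m \in G j -> act a m \in G (k + j).
  move=> ak /memv_imgP [x xj ->]; rewrite actE; apply: memG; exact: gm_grM.
have [||f fE] := @mk_hom M (GrMod actP GP GM) p.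
- by move=> a m; rewrite -actE.
- by move=> k m /memG.
exists (GrMod actP GP GM), f; split=> [y | x]; last by rewrite fE.
by have [x ->] := ps y; exists x; rewrite fE.
Qed.

Lemma gsub_ker M N (f : grhom M N) : gsub (lker f).
Proof.
by split=> [a u | i u]; rewrite !memv_ker => /eqP e;
  rewrite ?hom_act -?pr_hom e ?actr0 ?linear0.
Qed.

Lemma gsub_img M N (f : grhom M N) : gsub (limg f).
Proof.
split=> [a u | i u] /memv_imgP [x _ ->]; rewrite -?hom_act ?pr_hom memv_img ?memvf //.
Qed.

Lemma ker_mod M N (f : grhom M N) : exists (S : grMod A) (i : grhom S M),
  inj i /\ forall x, f x = 0 <-> exists s, x = i s.
Proof.
have [S [i [ii iU]]] := sub_mod (gsub_ker f); exists S, i; split=> // x.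
by rewrite -iU memv_ker; split=> [-> | /eqP].
Qed.

Lemma coker_mod M N (f : grhom M N) : exists (Q : grMod A) (p : grhom N Q),
  surj p /\ forall y, p y = 0 <-> exists x, y = f x.
Proof.
have [Q [p [ps pU]]] := quot_mod (gsub_img f); exists Q, p; split=> // y.
by rewrite pU; split=> [/memv_imgP [x _ ->] | [x ->]]; [exists x | rewrite memv_img ?memvf].
Qed.

Lemma img_mod M N (f : grhom M N) :
  exists (S : grMod A) (i : grhom S N) (p : grhom M S),
    [/\ inj i, surj p & forall x, f x = i (p x)].
Proof.
have [S [i [ii iU]]] := sub_mod (gsub_img f).
have [w|p pE] := @glift_inj S N M i f ii; first by apply/iU; rewrite memv_img ?memvf.
exists S, i, p; split=> // y.
have /memv_imgP [x _ e] : i y \in limg f by apply/iU; exists y.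
by exists x; apply: (injP ii); rewrite pE.
Qed.

Lemma prod_mod M N : exists (P : grMod A) (p : grhom P M) (q : grhom P N),
  (forall x y, exists z, p z = x /\ q z = y) /\
  (forall z, p z = 0 -> q z = 0 -> z = 0).
Proof.
pose V : vectType K := (M * N)%type.
pose act (a : A) (z : V) : V := (a ** z.1, a ** z.2).
have eqV (u v : V) : u.1 = v.1 -> u.2 = v.2 -> u = v.
  by case: u v => [a b] [c d] /= -> ->.
have actP : is_action act.
  split; first split.
  - by move=> a k s t; apply: eqV; rewrite /= linearP.
  - by move=> s k a b; apply: eqV; rewrite /= act_linl.
  - by move=> s; apply: eqV; rewrite /= act1.
  - by move=> a b s; apply: eqV; rewrite /= actM.
have pl k : linear (fun z : V => (pr M k z.1, pr N k z.2) : V).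
  by move=> c u v; apply: eqV; rewrite /= linearP.
have /choice [p pE] k := linfun_ex (pl k).
pose G k := limg (p k).
have memG k z : z \in G k <-> z.1 \in gm_gr M k /\ z.2 \in gm_gr N k.
  split=> [/memv_imgP [t _ ->] | [h1 h2]]; first by rewrite pE /= !memv_gr_proj.
  apply/memv_imgP; exists z; rewrite ?memvf // pE.
  by apply: eqV; rewrite /= gr_proj_id.
have [s hs] := gr_supp (gm_grP M); have [s' hs'] := gr_supp (gm_grP N).
have GP : is_grading G.
  apply: (@is_grading_proj _ _ G p (undup (s ++ s'))); first exact: undup_uniq.
  - by move=> k v; rewrite memv_img ?memvf.
  - by move=> k v /memG [h1 h2]; rewrite pE; apply: eqV; rewrite /= gr_proj_id.
  - move=> k j v jk /memG [h1 h2]; rewrite pE.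
    by apply: eqV; rewrite /= ?(gr_proj_0 _ jk h1) ?(gr_proj_0 _ jk h2).
  - move=> v; apply: eqV; rewrite (raddf_sum (@fst M N), raddf_sum (@snd M N)) /=.
      under eq_bigr do rewrite pE /=.
      apply: gr_sum (undup_uniq _) _ => i; rewrite mem_undup mem_cat negb_or.
      by case/andP => /hs e _; exact: gr_proj_notin.
    under eq_bigr do rewrite pE /=.
    apply: gr_sum (undup_uniq _) _ => i; rewrite mem_undup mem_cat negb_or.
    by case/andP => _ /hs' e; exact: gr_proj_notin.
have GM k j a m : a \in ga_gr A k -> m \in G j -> act a m \in G (k + j).
  by move=> ak /memG [h1 h2]; apply/memG; split; exact: gm_grM.
pose P := GrMod actP GP GM.
have [f1 f1E] := @linfun_ex K V M fst (fun c u v => erefl).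
have [f2 f2E] := @linfun_ex K V N snd (fun c u v => erefl).
have [||g1 g1E] := @mk_hom P M f1.
- by move=> a m; rewrite !f1E.
- by move=> k m /memG [h _]; rewrite f1E.
have [||g2 g2E] := @mk_hom P N f2.
- by move=> a m; rewrite !f2E.
- by move=> k m /memG [_ h]; rewrite f2E.
exists P, g1, g2; split=> [x y | z].
  by exists ((x, y) : V); rewrite g1E g2E f1E f2E.
by rewrite g1E g2E f1E f2E => h1 h2; exact: eqV.
Qed.

End GradedModules.

(** * Abelian notions read off on elements *)

Definition gexact (K : fieldType) (A : grAlg K) (M N P : grMod A)
    (f : grhom M N) (g : grhom N P) : Prop :=
  [/\ inj f, surj g & forall y, g y = 0 <-> exists x, y = f x].

Section Replete.
Variables (K : fieldType) (A : grAlg K) (C : cat) (U : functor C (GMod A)).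
Implicit Types X Y Z W : C.

Definition fu X Y (f : hom X Y) : grhom (U X) (U Y) := fmap U f.

(** U identifies C with a full subcategory of graded modules closed under
    submodules and quotients. All categories of the proof have this form: the
    graded modules, the Serre subcategories of the strata, and the Serre
    quotients. Kernels, cokernels and exactness in C can then
    be read off on elements. *)
Record replete : Prop := Replete {
  rep_full : forall X Y (g : grhom (U X) (U Y)), exists f, fu f = g;
  rep_faith : forall X Y (f g : hom X Y), fu f = fu g -> f = g;
  rep_sub : forall X (S : grMod A) (i : grhom S (U X)), inj i ->
    exists Y (j : grhom (U Y) S), inj j /\ surj j;
  rep_quo : forall X (Q : grMod A) (p : grhom (U X) Q), surj p ->
    exists Y (j : grhom Q (U Y)), inj j /\ surj j }.

Lemma fuM X Y Z (g : hom Y Z) (f : hom X Y) x : fu (g \oc f) x = fu g (fu f x).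
Proof. by rewrite /fu fmapM [LHS]homE. Qed.

Lemma fu1 X x : fu (idm X) x = x.
Proof. by rewrite /fu fmap1 [LHS]hom1E. Qed.

Hypothesis hU : replete.

Lemma fu_ext X Y (f g : hom X Y) : (forall x, fu f x = fu g x) -> f = g.
Proof. by move=> e; apply: (rep_faith hU); apply: hom_ext. Qed.

Lemma fu_zero X Y : exists f : hom X Y, forall x, fu f x = 0.
Proof.
by have [f fE] := rep_full hU (0 : grhom (U X) (U Y)); exists f => x; rewrite fE hom0E.
Qed.

Lemma fu_sub X (S : grMod A) (i : grhom S (U X)) : inj i ->
  exists Y (m : hom Y X), inj (fu m) /\
    forall x, (exists s, x = i s) <-> exists y, x = fu m y.
Proof.
move=> ii; have [Y [j [ji js]]] := rep_sub hU ii.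
have [m mE] := rep_full hU (grhom_comp i j); exists Y, m; split=> x.
  by rewrite mE homE => /ii /ji.
split=> [[s ->]|[y ->]]; last by exists (j y); rewrite mE homE.
by have [y ->] := js s; exists y; rewrite mE homE.
Qed.

Lemma fu_quo X (Q : grMod A) (p : grhom (U X) Q) : surj p ->
  exists Y (q : hom X Y), surj (fu q) /\ forall x, p x = 0 <-> fu q x = 0.
Proof.
move=> ps; have [Y [j [ji js]]] := rep_quo hU ps.
have [q qE] := rep_full hU (grhom_comp j p); exists Y, q; split=> x.
  have [y ->] := js x; have [z ->] := ps y; by exists z; rewrite qE homE.
by rewrite qE homE; split=> [-> | /ji]; rewrite ?linear0.
Qed.

Lemma fu_ker X Y (f : hom X Y) : exists N (k : hom N X),
  inj (fu k) /\ forall x, fu f x = 0 <-> exists w, x = fu k w.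
Proof.
have [S [i [ii iP]]] := ker_mod (fu f); have [N [m [mi mP]]] := fu_sub ii.
by exists N, m; split=> // x; rewrite iP mP.
Qed.

Lemma fu_coker X Y (f : hom X Y) : exists Q (q : hom Y Q),
  surj (fu q) /\ forall y, fu q y = 0 <-> exists x, y = fu f x.
Proof.
have [Q [p [ps pP]]] := coker_mod (fu f); have [N [q [qs qP]]] := fu_quo ps.
by exists N, q; split=> // x; rewrite -pP qP.
Qed.

Lemma is_zeroP Z : is_zero Z <-> forall z : U Z, z = 0.
Proof.
split=> [zZ z | Z0 X].
  have [o oE] := fu_zero Z Z; have [[f [_ fu]] _] := zZ Z.
  by rewrite -[LHS]fu1 -(fu (idm Z)) // (fu o).
have [o oE] := fu_zero X Z; have [o' o'E] := fu_zero Z X.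
split; [exists o | exists o']; split=> // f _; apply: fu_ext => x.
  by rewrite oE [RHS]Z0.
by rewrite o'E [x]Z0 linear0.
Qed.

Lemma zero_morP X Y (f : hom X Y) : zero_mor f <-> forall x, fu f x = 0.
Proof.
split=> [[Z [g [h [/is_zeroP Z0 ->]]]] x | f0].
  by rewrite fuM [fu g x]Z0 linear0.
have [Q [q [qs qP]]] := fu_coker (idm X).
have Q0 (z : U Q) : z = 0 by have [y ->] := qs z; apply/qP; exists y; rewrite fu1.
have [o oE] := fu_zero Q Y; exists Q, q, o; split; first exact/is_zeroP.
by apply: fu_ext => x; rewrite f0 fuM oE.
Qed.

(** A monomorphism kills no element because the inclusion of its kernel and the
    zero map are equalized by it. *)
Lemma is_monoP X Y (f : hom X Y) : is_mono f <-> inj (fu f).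
Proof.
split=> [fm x fx0 | fi Z g h e].
  have [N [k [_ kP]]] := fu_ker f; have [o oE] := fu_zero N X.
  have /fm ko : f \oc k = f \oc o.
    apply: fu_ext => w; rewrite !fuM oE linear0; apply/kP; by exists w.
  by have /kP [w ->] := fx0; rewrite ko oE.
by apply: fu_ext => x; apply: (injP fi); rewrite -!fuM e.
Qed.

Lemma is_epiP X Y (f : hom X Y) : is_epi f <-> surj (fu f).
Proof.
split=> [fe y | fs Z g h e].
  have [N [k [_ kP]]] := fu_coker f; have [o oE] := fu_zero Y N.
  have /fe ko : k \oc f = o \oc f.
    apply: fu_ext => w; rewrite !fuM oE; apply/kP; by exists w.
  by apply/kP; rewrite ko oE.
by apply: fu_ext => y; have [x ->] := fs y; rewrite -!fuM e.
Qed.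

Lemma fu_lift S X W (i : hom S X) (f : hom W X) : inj (fu i) ->
  (forall w, exists s, fu f w = fu i s) -> exists h, i \oc h = f.
Proof.
move=> ii fi; have [h hE] := glift_inj ii fi; have [g gE] := rep_full hU h.
by exists g; apply: fu_ext => w; rewrite fuM gE hE.
Qed.

Lemma fu_fact X Q W (p : hom X Q) (f : hom X W) : surj (fu p) ->
  (forall x, fu p x = 0 -> fu f x = 0) -> exists h, h \oc p = f.
Proof.
move=> ii fi; have [h hE] := gfact_surj ii fi; have [g gE] := rep_full hU h.
by exists g; apply: fu_ext => w; rewrite fuM gE hE.
Qed.

Lemma is_kerP X Y N (f : hom X Y) (k : hom N X) : is_ker f k <->
  inj (fu k) /\ forall x, fu f x = 0 <-> exists w, x = fu k w.
Proof.
split=> [[/zero_morP fk ku] | [ki kP]].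
  have km : is_mono k.
    move=> Z g h e; have [|h0 [_ hu]] := ku Z (k \oc g).
      by apply/zero_morP => x; rewrite !fuM -fuM fk.
    by rewrite -(hu g erefl) (hu h) // -e.
  split; first exact/is_monoP.
  move=> x; split=> [fx | [w ->]]; last by rewrite -fuM fk.
  have [S [m [mi mP]]] := fu_ker f; have [|h [e _]] := ku S m.
    by apply/zero_morP => z; rewrite fuM; apply/mP; exists z.
  by have /mP [z ->] := fx; exists (fu h z); rewrite -fuM e.
split; first by apply/zero_morP => w; rewrite fuM; apply/kP; exists w.
move=> W g /zero_morP fg; have [|h hE] := @fu_lift _ _ _ k g ki.
  by move=> w; apply/kP; rewrite -fuM fg.
exists h; split=> // h' e; apply/((is_monoP k).2 ki); by rewrite e.
Qed.

Lemma is_cokerP X Y Q (f : hom X Y) (q : hom Y Q) : is_coker f q <->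
  surj (fu q) /\ forall y, fu q y = 0 <-> exists x, y = fu f x.
Proof.
split=> [[/zero_morP qf qu] | [qs qP]].
  have qe : is_epi q.
    move=> Z g h e; have [|h0 [_ hu]] := qu Z (g \oc q).
      by apply/zero_morP => x; rewrite -compA fuM qf linear0.
    by rewrite -(hu g erefl) (hu h) // -e.
  split; first exact/is_epiP.
  move=> y; split=> [qy | [w ->]]; last by rewrite -fuM qf.
  have [S [m [ms mP]]] := fu_coker f; have [|h [e _]] := qu S m.
    by apply/zero_morP => z; rewrite fuM; apply/mP; exists z.
  by apply/mP; rewrite -e fuM qy linear0.
split; first by apply/zero_morP => w; rewrite fuM; apply/qP; exists w.
move=> W g /zero_morP gf; have [|h hE] := @fu_fact _ _ _ q g qs.
  by move=> x /qP [w ->]; rewrite -fuM gf.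
exists h; split=> // h' e; apply/((is_epiP q).2 qs); by rewrite e.
Qed.

Lemma sesP X Y Z (f : hom X Y) (g : hom Y Z) : ses f g <-> gexact (fu f) (fu g).
Proof.
split=> [[/is_kerP [fi fP] /is_cokerP [gs _]] // | [fi gs fP]].
by split; [apply/is_kerP | apply/is_cokerP].
Qed.

Lemma is_isoP X Y (f : hom X Y) : is_iso f <-> inj (fu f) /\ surj (fu f).
Proof.
split=> [[g [gf fg]] | [fi fs]].
  split=> [x fx | y]; last by exists (fu g y); rewrite -fuM fg fu1.
  by rewrite -[x]fu1 -gf fuM fx linear0.
have [h [hf fh]] := ginv fi fs; have [g gE] := rep_full hU h; exists g.
split; apply: fu_ext => x; rewrite fuM gE fu1 -homE ?hf ?fh hom1E //.
Qed.

Lemma isomP X Y : isom X Y <-> exists f : grhom (U X) (U Y), inj f /\ surj f.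
Proof.
split=> [[f /is_isoP h] | [f h]]; first by exists (fu f).
by have [g gE] := rep_full hU f; exists g; apply/is_isoP; rewrite gE.
Qed.

End Replete.

Definition id_functor (C : cat) : functor C C :=
  @Functor C C id (fun _ _ f => f) (fun _ => erefl) (fun _ _ _ _ _ => erefl).

Definition incl_functor (C : cat) (S : C -> Prop) : functor (full_sub S) C :=
  @Functor (full_sub S) C sval (fun _ _ f => f) (fun _ => erefl)
    (fun _ _ _ _ _ => erefl).

Section RepleteInstances.
Variables (K : fieldType) (A : grAlg K).

Lemma id_inj (M : grMod A) : inj (grhom_id M).
Proof. by move=> x; rewrite hom1E. Qed.

Lemma id_surj (M : grMod A) : surj (grhom_id M).
Proof. by move=> x; exists x; rewrite hom1E. Qed.

Lemma id_replete : replete (id_functor (GMod A)).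
Proof.
split=> [X Y g | X Y f g | X S i ii | X Q p ps]; first by exists g.
- exact.
- by exists S, (grhom_id S); split; [exact: id_inj | exact: id_surj].
- by exists Q, (grhom_id Q); split; [exact: id_inj | exact: id_surj].
Qed.

Variable S : GMod A -> Prop.
Hypothesis Ssub : forall (M N : grMod A) (i : grhom M N), inj i -> S N -> S M.
Hypothesis Squo : forall (M N : grMod A) (p : grhom M N), surj p -> S M -> S N.

Lemma incl_replete : replete (incl_functor S).
Proof.
split=> [X Y g | X Y f g | X N i ii | X Q p ps]; first by exists g.
- exact.
- exists (exist _ N (Ssub ii (svalP X))), (grhom_id N).
  by split; [exact: id_inj | exact: id_surj].
- exists (exist _ Q (Squo ps (svalP X))), (grhom_id Q).
  by split; [exact: id_inj | exact: id_surj].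
Qed.

Lemma gmonoP (M N : GMod A) (f : hom M N) : is_mono f <-> inj (f : grhom M N).
Proof. exact: (is_monoP id_replete). Qed.
Lemma gepiP (M N : GMod A) (f : hom M N) : is_epi f <-> surj (f : grhom M N).
Proof. exact: (is_epiP id_replete). Qed.
Lemma gzeroP (M : GMod A) : is_zero M <-> forall x : (M : grMod A), x = 0.
Proof. exact: (is_zeroP id_replete). Qed.
Lemma gzero_morP (M N : GMod A) (f : hom M N) :
  zero_mor f <-> forall x, (f : grhom M N) x = 0.
Proof. exact: (zero_morP id_replete). Qed.
Lemma gsesP (M N P : GMod A) (f : hom M N) (g : hom N P) :
  ses f g <-> gexact (f : grhom M N) (g : grhom N P).
Proof. exact: (sesP id_replete). Qed.
Lemma gisoP (M N : GMod A) (f : hom M N) :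
  is_iso f <-> inj (f : grhom M N) /\ surj (f : grhom M N).
Proof. exact: (is_isoP id_replete). Qed.
Lemma gisomP (M N : GMod A) :
  isom M N <-> exists f : grhom M N, inj f /\ surj f.
Proof. exact: (isomP id_replete). Qed.
Lemma gkerP (M N P : GMod A) (f : hom M N) (k : hom P M) : is_ker f k <->
  inj (k : grhom P M) /\
  forall x, (f : grhom M N) x = 0 <-> exists w, x = (k : grhom P M) w.
Proof. exact: (is_kerP id_replete). Qed.

Lemma gcompE (M N P : GMod A) (g : hom N P) (f : hom M N) (h : hom M P) :
  g \oc f = h -> forall x, (g : grhom N P) ((f : grhom M N) x) = (h : grhom M P) x.
Proof. by move=> <- x; rewrite -homE. Qed.

Lemma gmod_abelian : abelian (GMod A).
Proof.
have [Z Z0] : exists Z : grMod A, forall z : Z, z = 0.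
  have [|Z [i [ii iP]]] := @sub_mod K A (regMod A) 0%VS.
    by split=> [a u | i u]; rewrite !memv0 => /eqP ->; rewrite linear0.
  exists Z => z; apply: ii; apply/eqP; rewrite -memv0; apply/iP; by exists z.
split.
- by exists Z; apply/gzeroP.
- move=> M N; have [P [p [q [pq pq0]]]] := prod_mod M N.
  exists P, p, q => W f g.
  have /choice [h hE] w := pq ((f : grhom W M) w) ((g : grhom W N) w).
  have ext (u v : P) : p u = p v -> q u = q v -> u = v.
    by move=> e1 e2; apply/subr0_eq/pq0; rewrite linearB /= ?e1 ?e2 subrr.
  have hl : linear h.
    move=> c u v; apply: ext.
      by rewrite linearP /= !(hE _).1 linearP.
    by rewrite linearP /= !(hE _).2 linearP.
  have [h1 h1E] := linfun_ex hl.
  have [||h2 h2E] := @mk_hom_pr K A W P h1.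
  + move=> a m; rewrite !h1E; apply: ext; rewrite [RHS]hom_act.
      by rewrite !(hE _).1 hom_act.
    by rewrite !(hE _).2 hom_act.
  + move=> i m; rewrite !h1E; apply: ext; rewrite -pr_hom.
      by rewrite !(hE _).1 pr_hom.
    by rewrite !(hE _).2 pr_hom.
  exists h2; split.
    by split; apply: hom_ext => w; rewrite homE h2E h1E ?(hE _).1 ?(hE _).2.
  move=> h' [e1 e2]; apply: hom_ext => w; rewrite h2E h1E; apply: ext.
    by rewrite (hE _).1 -e1 homE.
  by rewrite (hE _).2 -e2 homE.
- move=> M N f; split.
    have [S' [i [ii iP]]] := ker_mod (f : grhom M N); exists S', i.
    exact/gkerP.
  have [Q [p [ps pP]]] := coker_mod (f : grhom M N); exists Q, p.
  exact/(is_cokerP id_replete).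
- move=> M N m /gmonoP mi; have [Q [p [ps pP]]] := coker_mod (m : grhom M N).
  by exists Q, p; apply/gkerP.
- move=> M N e /gepiP es; have [S' [i [ii iP]]] := ker_mod (e : grhom M N).
  by exists S', i; apply/(is_cokerP id_replete).
Qed.

End RepleteInstances.

(** * Induction along a free extension *)

(** A is a free right B-module on the homogeneous elements [fr_n i], with
    coordinate functions [fr_b i], and q is a graded algebra map on B. The last
    field says that 1 lies in the span of the [fr_n i] over K; it makes the unit
    of induction injective. *)
Record free_ext (K : fieldType) (A T : grAlg K) (B : {vspace A}) (q : A -> T) :=
  FreeExt {
  fr_r : nat;
  fr_n : 'I_fr_r -> A;
  fr_e : 'I_fr_r -> int;
  fr_b : 'I_fr_r -> 'End(A);
  fr_bB : forall j a, fr_b j a \in B;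
  fr_sum : forall a, a = \sum_j fr_n j * fr_b j a;
  fr_bn : forall i j x, x \in B -> fr_b j (fr_n i * x) = if i == j then x else 0;
  fr_ndeg : forall i, fr_n i \in ga_gr A (fr_e i);
  fr_bdeg : forall i j a, a \in ga_gr A (fr_e j + i) -> fr_b j a \in ga_gr A i;
  fr_1B : 1 \in B;
  fr_BM : forall x y, x \in B -> y \in B -> x * y \in B;
  fr_qlin : linear q;
  fr_q1 : q 1 = 1;
  fr_qM : forall x y, x \in B -> y \in B -> q (x * y) = q x * q y;
  fr_qG : forall i x, x \in B -> x \in ga_gr A i -> q x \in ga_gr T i;
  fr_1 : exists c : 'I_fr_r -> K, 1 = \sum_j c j *: fr_n j }.

Section FreeExtension.
Variables (K : fieldType) (A T : grAlg K) (B : {vspace A}) (q : A -> T).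
Variable D : free_ext B q.
Notation I := 'I_(fr_r D).
Notation n := (@fr_n K A T B q D).
Notation e := (@fr_e K A T B q D).
Notation b := (@fr_b K A T B q D).

Lemma fr_q_ex : exists f : 'Hom(A, T), forall x, f x = q x.
Proof. exact/linfun_ex/(fr_qlin D). Qed.

Lemma fr_q0 : q 0 = 0.
Proof. by have [f <-] := fr_q_ex; rewrite linear0. Qed.

Lemma fr_bnn i j : b j (n i) = if i == j then 1 else 0.
Proof. by rewrite -[n i]mulr1 fr_bn // (fr_1B D). Qed.

Lemma fr_bM j a x : x \in B -> b j (a * x) = b j a * x.
Proof.
move=> xB; rewrite {1}(fr_sum D a) mulr_suml linear_sum /= (bigD1 j) //=.
rewrite -mulrA fr_bn ?(fr_BM D) ?fr_bB // eqxx big1 ?addr0 // => i /negPf ij.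
by rewrite -mulrA fr_bn ?(fr_BM D) ?fr_bB // ij.
Qed.

Section Model.
Variable M : grMod T.

Let X : vectType K := {ffun I -> M}.

(** The induced module is modelled on families indexed by the basis: a (x) m is
    the family of the q(b_j(a)) m, where a is the sum of the n_j b_j(a). *)
Definition itens (a : A) (m : M) : X := [ffun j => q (b j a) ** m].

Lemma itensE a m j : itens a m j = q (b j a) ** m.
Proof. by rewrite ffunE. Qed.

Lemma itens_lin a : linear (itens a).
Proof.
by move=> k u v; apply/ffunP => j; rewrite !(itensE, ffunE) linearP.
Qed.

Lemma itens_linl m : linear (itens^~ m).
Proof.
move=> k u v; apply/ffunP => j; rewrite !(itensE, ffunE).
by rewrite linearP (fr_qlin D) act_linl.
Qed.

Lemma itens_B a x m : x \in B -> itens (a * x) m = itens a (q x ** m).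
Proof.
move=> xB; apply/ffunP => j; rewrite !itensE fr_bM // -actM.
by rewrite (fr_qM D) ?fr_bB.
Qed.

Lemma itens_n i m : itens (n i) m = [ffun j => if i == j then m else 0].
Proof.
apply/ffunP => j; rewrite itensE ffunE fr_bnn.
by case: eqP => _; rewrite ?(fr_q1 D) ?fr_q0 ?act1 ?act0l.
Qed.

Lemma itens_gen (x : X) : x = \sum_i itens (n i) (x i).
Proof.
apply/ffunP => j; rewrite sum_ffunE (bigD1 j) //= itens_n ffunE eqxx big1 ?addr0 //.
by move=> i /negPf ij; rewrite itens_n ffunE ij.
Qed.

Definition iact (a : A) (x : X) : X := \sum_i itens (a * n i) (x i).

Lemma iact_lin a : linear (iact a).
Proof.
move=> k u v; rewrite /iact scaler_sumr -big_split; apply: eq_bigr => i _.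
by rewrite !ffunE itens_lin.
Qed.

Lemma iact_tens a a' m : iact a (itens a' m) = itens (a * a') m.
Proof.
rewrite {2}(fr_sum D a') mulr_sumr.
have [f fE] := linfun_ex (itens_linl m); rewrite -[RHS]fE linear_sum.
apply: eq_bigr => i _ /=; rewrite fE mulrA [RHS]itens_B ?fr_bB //.
by rewrite itensE.
Qed.

Lemma iactP : is_action iact.
Proof.
split; first split.
- exact: iact_lin.
- move=> x k a a'; rewrite /iact scaler_sumr -big_split; apply: eq_bigr => i _ /=.
  by rewrite mulrDl -scalerAl itens_linl.
- by move=> x; rewrite [RHS]itens_gen; apply: eq_bigr => i _; rewrite mul1r.
- move=> a a' x; have [f fE] := linfun_ex (iact_lin a).
  rewrite [iact a' x]/iact -fE linear_sum; apply: eq_bigr => i _ /=.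
  by rewrite fE iact_tens mulrA.
Qed.

Definition ipr_fun d (x : X) : X := [ffun j => pr M (d - e j) (x j)].

Lemma ipr_lin d : linear (ipr_fun d).
Proof. by move=> k u v; apply/ffunP => j; rewrite !ffunE linearP. Qed.

Lemma ipr_ex : exists p : int -> 'End(X), forall d x j,
  p d x j = pr M (d - e j) (x j).
Proof.
have /choice [p pE] d := linfun_ex (ipr_lin d).
by exists p => d x j; rewrite pE ffunE.
Qed.

Definition ipr : int -> 'End(X) := sval (cid ipr_ex).

Lemma iprE d x j : ipr d x j = pr M (d - e j) (x j).
Proof. exact: (svalP (cid ipr_ex)). Qed.

Definition igr d : {vspace X} := limg (ipr d).

Lemma mem_igr d x : x \in igr d <-> forall j, x j \in gm_gr M (d - e j).
Proof.
split=> [/memv_imgP [y _ ->] j | h]; first by rewrite iprE memv_gr_proj.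
apply/memv_imgP; exists x; rewrite ?memvf //; apply/ffunP => j.
by rewrite iprE gr_proj_id.
Qed.

Lemma igrP : is_grading igr.
Proof.
have [s hs] := gr_supp (gm_grP M).
pose t := undup [seq i + e j | i <- s, j <- enum I].
apply: (is_grading_proj (p := ipr) (undup_uniq _ : uniq t)).
- by move=> i v; rewrite memv_img ?memvf.
- by move=> i v /mem_igr h; apply/ffunP => j; rewrite iprE gr_proj_id.
- move=> i k v ki /mem_igr h; apply/ffunP => j; rewrite iprE ffunE.
  by apply: (gr_proj_0 _ _ (h j)); rewrite (inj_eq (addIr _)).
- move=> v; apply/ffunP => j; rewrite sum_ffunE.
  under eq_bigr do rewrite iprE.
  rewrite -(big_map (fun d => d - e j) xpredT (fun i => pr M i (v j))).
  apply: gr_sum => [|i it]; first by rewrite map_inj_uniq ?undup_uniq //; exact: addIr.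
  apply/gr_proj_notin/hs; apply: contra it => is_.
  apply/mapP; exists (i + e j); last by rewrite addrK.
  by rewrite mem_undup; apply/allpairsP; exists (i, j); rewrite mem_enum.
Qed.

Lemma itens_gr i j a m : a \in ga_gr A i -> m \in gm_gr M j ->
  itens a m \in igr (i + j).
Proof.
move=> ai mj; apply/mem_igr => k; rewrite itensE.
have -> : i + j - e k = (i - e k) + j by rewrite addrAC.
apply: gm_grM => //; apply: (fr_qG D); first exact: fr_bB.
by apply: fr_bdeg; rewrite addrC subrK.
Qed.

Lemma iact_gr i j a x : a \in ga_gr A i -> x \in igr j -> iact a x \in igr (i + j).
Proof.
move=> ai /mem_igr h; apply: memv_suml => k _.
have -> : i + j = (i + e k) + (j - e k) by rewrite addrACA subrr addr0.
by apply: itens_gr; rewrite ?ga_grM ?fr_ndeg.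
Qed.

(** A balanced map is determined by its values on the n_j (x) m, and these may be
    prescribed. *)
Lemma induced_exists : exists Y : GMod A, is_induced B q M Y.
Proof.
exists (GrMod iactP igrP iact_gr), itens; split=> //; last 1 first.
- exact: itens_gr.
- split; last by move=> a x m; exact: itens_B.
  by split=> [a|m]; [exact: itens_lin | exact: itens_linl].
- move=> V f [[fl fr] fB].
  have gl : linear (fun x : X => \sum_i f (n i) (x i)).
    move=> k u v; rewrite scaler_sumr -big_split; apply: eq_bigr => i _.
    by rewrite !ffunE fl.
  have [g gE] := linfun_ex gl; exists g; split=> [a m | h hE].
    rewrite gE /= {2}(fr_sum D a).
    have [f' f'E] := linfun_ex (fr m); rewrite -f'E linear_sum.
    by apply: eq_bigr => i _ /=; rewrite f'E fB ?fr_bB // itensE.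
  apply/lfunP => x; rewrite gE [in RHS](itens_gen x) linear_sum; apply: eq_bigr => i _ /=.
  by rewrite hE.
- by move=> a a' m; rewrite /= iact_tens.
Qed.

End Model.

(** The form in which induced modules are used below: instead of the universal
    property among balanced maps, unique coordinates along the [fr_n i]. *)
Record ind_prop (M : grMod T) (X : grMod A) (u : 'Hom(M, X)) : Prop := IndProp {
  ip_B : forall x m, x \in B -> x ** u m = u (q x ** m);
  ip_gr : forall i m, m \in gm_gr M i -> u m \in gm_gr X i;
  ip_gen : forall x : X, exists c : I -> M, x = \sum_i n i ** u (c i);
  ip_free : forall c : I -> M, \sum_i n i ** u (c i) = 0 -> forall i, c i = 0 }.

Lemma pick_obP (C : cat) (F : C -> Prop) X : (exists Y, F Y) -> F (pick_ob F X).
Proof. by move=> h; rewrite /pick_ob; case: pselect => // h'; case: (cid h'). Qed.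

(** The coordinates come from comparing any induced module with the model by
    the universal properties of both. *)
Lemma ind_unit_exists (M : grMod T) :
  exists u : 'Hom(M, (induced B q M : grMod A)), ind_prop u.
Proof.
have: is_induced B q M (induced B q M : grMod A).
  exact: (@pick_obP (GMod A)) (induced_exists M).
set X : grMod A := induced B q M; case=> t [[[tl tr] tB] tu tact tgr].
have [u uE] := linfun_ex (tl 1).
have tuE a m : t a m = a ** u m by rewrite uE tact mulr1.
have [g [gE _]] : exists! g : 'Hom(X, {ffun I -> M}), forall a m, g (t a m) = itens a m.
  apply: tu; split; last by move=> a x m; exact: itens_B.
  by split=> [a|m]; [exact: itens_lin | exact: itens_linl].
have sl : linear (fun x : {ffun I -> M} => \sum_i t (n i) (x i)).
  move=> k y z; rewrite scaler_sumr -big_split; apply: eq_bigr => i _.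
  by rewrite !ffunE tl.
have [s sE] := linfun_ex sl.
have sgK x : s (g x) = x.
  have [h [_ hu]] := tu X t (conj (conj tl tr) tB).
  have e1 : h = (s \o g)%VF.
    apply: hu => a m; rewrite comp_lfunE gE sE.
    have [t' t'E] := linfun_ex (tr m).
    rewrite -t'E {2}(fr_sum D a) linear_sum; apply: eq_bigr => i _ /=.
    by rewrite t'E tB ?fr_bB // itensE.
  have e2 : h = \1%VF by apply: hu => a m; rewrite id_lfunE.
  by rewrite -comp_lfunE -e1 e2 id_lfunE.
have gsK x : g (s x) = x.
  rewrite sE linear_sum [RHS]itens_gen; apply: eq_bigr => i _; exact: gE.
exists u; split.
- by move=> x m xB; rewrite -tuE uE -tB // mul1r.
- by move=> i m mi; rewrite uE -[i]add0r; apply: tgr => //; exact: ga_gr1.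
- move=> x; exists (g x); rewrite -{1}(sgK x) sE; apply: eq_bigr => i _.
  exact: tuE.
- move=> c c0 i; have: s [ffun i => c i] = 0.
    by rewrite sE -[RHS]c0; apply: eq_bigr => j _; rewrite ffunE tuE.
  by move=> /(congr1 g); rewrite gsK linear0 => /ffunP /(_ i); rewrite !ffunE.
Qed.

Definition ind_unit (M : grMod T) : 'Hom(M, (induced B q M : grMod A)) :=
  sval (cid (ind_unit_exists M)).

Lemma ind_unitP M : ind_prop (ind_unit M).
Proof. exact: (svalP (cid (ind_unit_exists M))). Qed.

Section Universal.
Variables (M : grMod T) (X : grMod A) (u : 'Hom(M, X)).
Hypothesis hu : ind_prop u.

Lemma ip_coord (c c' : I -> M) :
  \sum_i n i ** u (c i) = \sum_i n i ** u (c' i) -> forall i, c i = c' i.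
Proof.
move=> h i; apply/subr0_eq; apply: (ip_free hu (c := fun i => c i - c' i)).
under eq_bigr do rewrite linearB linearB.
by rewrite sumrB h subrr.
Qed.

Lemma ip_inj : inj u.
Proof.
move=> m um; have [c c1] := fr_1 D.
have h : \sum_i n i ** u (c i *: m) = 0.
  transitivity ((1 : A) ** u m); last by rewrite um actr0.
  rewrite c1 actl_sum; apply: eq_bigr => i _.
  by rewrite linearZ /= actrZ actZl.
have c0 := ip_free hu h.
have [i ci] : exists i, c i != 0.
  apply/not_existsP => c0'; have /eqP := c1; rewrite big1 ?oner_eq0 //.
  by move=> i _; have /negP := c0' i; rewrite negbK => /eqP ->; rewrite scale0r.
by have /eqP := c0 i; rewrite scaler_eq0 (negPf ci) => /eqP.
Qed.

Lemma ip_pr i m : pr X i (u m) = u (pr M i m).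
Proof.
rewrite -{1}[i]add0r; apply: gr_shift => k v; rewrite add0r; exact: (ip_gr hu).
Qed.

(** Projecting to degree d gives a second set of coordinates, equal to the
    first. *)
Lemma ip_homog d (c : I -> M) : \sum_i n i ** u (c i) \in gm_gr X d ->
  forall i, c i \in gm_gr M (d - e i).
Proof.
move=> /(gr_memP (gm_grP X)) h i; apply/(gr_memP (gm_grP M)).
apply: (ip_coord (c := fun i => pr M (d - e i) (c i))).
rewrite -[RHS]h linear_sum; apply: eq_bigr => j _ /=.
rewrite -{2}(subrK (e j) d) [d - e j + e j]addrC.
by rewrite (pr_act _ _ (fr_ndeg j)) ip_pr.
Qed.

Lemma ip_ext (N : grMod A) (g h : grhom X N) :
  (forall m, g (u m) = h (u m)) -> g = h.
Proof.
move=> gh; apply: hom_ext => x; have [c ->] := ip_gen hu x.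
by rewrite !linear_sum; apply: eq_bigr => i _; rewrite /= !hom_act gh.
Qed.

(** The map must send the sum of the n_i u(c_i) to that of the n_i f(c_i); it
    commutes with a because a n_i is again expanded along the basis. *)
Lemma ip_lift (N : grMod A) (f : 'Hom(M, N)) :
  (forall x m, x \in B -> x ** f m = f (q x ** m)) ->
  (forall i m, m \in gm_gr M i -> f m \in gm_gr N i) ->
  exists g : grhom X N, forall m, g (u m) = f m.
Proof.
move=> fB fG; have /choice [c cE] x := ip_gen hu x.
pose g0 x := \sum_i n i ** f (c x i).
have g0E (d : I -> M) : g0 (\sum_i n i ** u (d i)) = \sum_i n i ** f (d i).
  by apply: eq_bigr => i _; rewrite (ip_coord (esym (cE _)) i).
have g0l : linear g0.
  move=> k x y; transitivity (g0 (\sum_i n i ** u (k *: c x i + c y i))).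
    congr g0; rewrite {1}(cE x) {1}(cE y) scaler_sumr -big_split /=.
    by apply: eq_bigr => i _; rewrite linearP act_lin.
  rewrite g0E /g0 scaler_sumr -big_split; apply: eq_bigr => i _ /=.
  by rewrite linearP act_lin.
have g0t a m : g0 (a ** u m) = a ** f m.
  transitivity (g0 (\sum_i n i ** u (q (b i a) ** m))).
    congr g0; rewrite {1}(fr_sum D a) actl_sum; apply: eq_bigr => i _.
    by rewrite actM (ip_B hu) ?fr_bB.
  rewrite g0E {2}(fr_sum D a) actl_sum; apply: eq_bigr => i _.
  by rewrite actM -fB ?fr_bB.
have [g gE] := linfun_ex g0l.
have [a x|d x xd|h hE] := @mk_hom K A X N g; last first.
- by exists h => m; rewrite hE gE -[u m]act1 g0t act1.
- rewrite (cE x) in xd *; rewrite gE g0E; apply: memv_suml => i _.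
  rewrite -(subrK (e i) d) [d - e i + e i]addrC.
  by apply: gm_grM (fr_ndeg i) (fG _ _ (ip_homog xd i)).
- rewrite (cE x) linear_sum /= gE.
  have -> : g0 (\sum_i a ** (n i ** u (c x i))) = \sum_i g0 ((a * n i) ** u (c x i)).
    rewrite -gE linear_sum; apply: eq_bigr => i _ /=; by rewrite gE actM.
  rewrite gE g0E linear_sum; apply: eq_bigr => i _ /=.
  by rewrite g0t actM.
Qed.

End Universal.

(** ** Functoriality and exactness *)

Section Map.
Variables (M N : grMod T) (X Y : grMod A) (u : 'Hom(M, X)) (v : 'Hom(N, Y)).
Hypotheses (hu : ind_prop u) (hv : ind_prop v).

Lemma ip_map (f : grhom M N) : exists g : grhom X Y, forall m, g (u m) = v (f m).
Proof.
have [x m xB|i m mi|g gE] := @ip_lift M X u hu Y (v \o f)%VF.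
- by rewrite !comp_lfunE (ip_B hv) // hom_act.
- by rewrite comp_lfunE; apply: (ip_gr hv); exact: hom_gr.
by exists g => m; rewrite gE comp_lfunE.
Qed.

Lemma ip_map_sum (f : grhom M N) (g : grhom X Y) (c : I -> M) :
  (forall m, g (u m) = v (f m)) ->
  g (\sum_i n i ** u (c i)) = \sum_i n i ** v (f (c i)).
Proof.
by move=> gE; rewrite linear_sum; apply: eq_bigr => i _; rewrite /= hom_act gE.
Qed.

Lemma ip_map_inj (f : grhom M N) (g : grhom X Y) :
  (forall m, g (u m) = v (f m)) -> inj f -> inj g.
Proof.
move=> gE fi x; have [c ->] := ip_gen hu x; rewrite (ip_map_sum _ gE) => h.
by apply: big1 => i _; rewrite (fi _ (ip_free hv h i)) linear0 actr0.
Qed.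

Lemma ip_map_surj (f : grhom M N) (g : grhom X Y) :
  (forall m, g (u m) = v (f m)) -> surj f -> surj g.
Proof.
move=> gE fs y; have [c ->] := ip_gen hv y.
have /choice [d dE] i := fs (c i).
exists (\sum_i n i ** u (d i)); rewrite (ip_map_sum _ gE).
by apply: eq_bigr => i _; rewrite dE.
Qed.

End Map.

Lemma ip_map_exact (M N P : grMod T) (X Y Z : grMod A) (u : 'Hom(M, X))
    (v : 'Hom(N, Y)) (w : 'Hom(P, Z)) (f : grhom M N) (g : grhom N P)
    (F : grhom X Y) (G : grhom Y Z) :
  ind_prop u -> ind_prop v -> ind_prop w ->
  (forall m, F (u m) = v (f m)) -> (forall m, G (v m) = w (g m)) ->
  gexact f g -> gexact F G.
Proof.
move=> hu hv hw FE GE [fi gs fg]; split.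
- exact: ip_map_inj hu hv _ _ FE fi.
- exact: ip_map_surj hw _ _ GE gs.
- move=> y; split=> [|[x ->]].
    have [c ->] := ip_gen hv y; rewrite (ip_map_sum _ GE) => h.
    have /choice [d dE] : forall i, exists m, c i = f m.
      by move=> i; apply/fg/(ip_free hw h).
    exists (\sum_i n i ** u (d i)); rewrite (ip_map_sum _ FE).
    by apply: eq_bigr => i _; rewrite dE.
  have [c ->] := ip_gen hu x; rewrite (ip_map_sum _ FE) (ip_map_sum _ GE).
  by apply: big1 => i _; have -> : g (f (c i)) = 0;
    rewrite ?linear0 ?actr0 //; apply/fg; exists (c i).
Qed.

End FreeExtension.

(** * Coinduction *)

Section Functionals.
Variables (K : fieldType) (V : vectType K).
Notation dual := 'Hom(V, K^o).
Notation bV := (vbasis (@fullv K V)).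

Lemma coord_functional i : exists f : dual, forall v, f v = coord bV i v.
Proof. by apply: linfun_ex => c u v; rewrite linearP. Qed.

Lemma functional_sep v : (forall f : dual, f v = 0) -> v = 0.
Proof.
move=> v0; rewrite (coord_vbasis (memvf v)); apply: big1 => i _.
by have [f fE] := coord_functional i; rewrite -fE v0 scale0r.
Qed.

(** Finite-dimensional spaces are reflexive; F is evaluation at the vector whose
    coordinates are its values on the dual basis. *)
Lemma functional_refl (F : dual -> K) :
  (forall k f g, F (k *: f + g) = k * F f + F g) ->
  exists v, forall f : dual, F f = f v.
Proof.
move=> Fl; have [G GE] := @linfun_ex K dual K^o F Fl.
have /choice [c cE] := coord_functional.
exists (\sum_(i < \dim (@fullv K V)) F (c i) *: bV`_i) => f.
have fE : f = \sum_(i < \dim (@fullv K V)) f bV`_i *: c i.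
  apply/lfunP => v; rewrite sum_lfunE {1}(coord_vbasis (memvf v)) linear_sum.
  by apply: eq_bigr => i _ /=; rewrite scale_lfunE cE linearZ /= [LHS]mulrC.
rewrite {1}fE -GE !linear_sum; apply: eq_bigr => i _.
by rewrite !linearZ /= GE [LHS]mulrC.
Qed.

End Functionals.

Section Coinduction.
Variables (K : fieldType) (A T : grAlg K) (B : {vspace (opAlg A)}).
Variable q : opAlg A -> opAlg T.
Variable D : free_ext B q.
Notation I := 'I_(fr_r D).
Notation n := (@fr_n K (opAlg A) (opAlg T) B q D).
Notation e := (@fr_e K (opAlg A) (opAlg T) B q D).
Notation b := (@fr_b K (opAlg A) (opAlg T) B q D).

(** An element of A^op acting on an A-module: its products are those of A^op,
    so that the free extension of A^op can be used for A-modules. *)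
Definition coact (M : grMod A) (a : opAlg A) (m : M) : M := @gm_act K A M a m.

Lemma coactM (M : grMod A) (x y : opAlg A) (m : M) :
  coact (x * y) m = coact y (coact x m).
Proof. exact: actM. Qed.

Lemma coact_sum (M : grMod A) J (r : seq J) (F : J -> opAlg A) (m : M) :
  coact (\sum_(i <- r) F i) m = \sum_(i <- r) coact (F i) m.
Proof. exact: actl_sum. Qed.

(** Dually to induction: an element y of the coinduced module amounts to the
    family of the eps(n_i y), and this family is arbitrary. *)
Record coind_prop (M : grMod T) (Y : grMod A) (eps : 'Hom(Y, M)) : Prop :=
  CoindProp {
  cp_B : forall x y, x \in B -> eps (coact x y) = @gm_act K T M (q x) (eps y);
  cp_gr : forall i y, y \in gm_gr Y i -> eps y \in gm_gr M i;
  cp_sep : forall y, (forall i, eps (coact (n i) y) = 0) -> y = 0;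
  cp_full : forall c : I -> M, exists y, forall i, eps (coact (n i) y) = c i }.

Definition coinduced (M : grMod T) : grMod A :=
  dual_from_op (@induced K (opAlg A) (opAlg T) B q (dual_to_op M)).

(** With Z induced from M^*, the coinduced module is Z^*. The counit sends a
    functional y on Z to the m in M such that mu |-> y(1 (x) mu) is evaluation
    at m, and a functional on Z is given freely on each n_i (x) M^*. *)
Lemma coind_counit_exists (M : grMod T) :
  exists eps : 'Hom(coinduced M, M), coind_prop eps.
Proof.
pose Z : grMod (opAlg A) := @induced K (opAlg A) (opAlg T) B q (dual_to_op M).
pose Y : grMod A := dual_from_op Z.
have [u hu] := ind_unit_exists D (dual_to_op M).
have /choice [f fE] : forall y : Y, exists m : M,
    forall mu : dual_to_op M, (y : 'Hom(Z, K^o)) (u mu) = (mu : 'Hom(M, K^o)) m.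
  move=> y; apply: (@functional_refl K M (fun mu => (y : 'Hom(Z, K^o)) (u mu))).
  move=> k mu nu; rewrite !linearP //.
have fl : linear f.
  move=> k y z; apply/subr0_eq/functional_sep => mu.
  rewrite linearB linearP /= -!fE.
  by rewrite add_lfunE scale_lfunE subrr.
have [eps eE] := linfun_ex fl.
have epsE y (mu : 'Hom(M, K^o)) : mu (eps y) = (y : 'Hom(Z, K^o)) (u mu).
  by rewrite eE fE.
have actE (a : opAlg A) (y : Y) (z : Z) :
    (coact a y : 'Hom(Z, K^o)) z = (y : 'Hom(Z, K^o)) (a ** z).
  exact: dual_actE.
exists eps; split.
- move=> x y xB; apply/subr0_eq/functional_sep => mu.
  rewrite linearB /= epsE actE (ip_B hu) //.
  have := epsE y (gm_act (g := dual_to_op M) (q x) mu) => <-.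
  by rewrite [X in X - _]dual_actE subrr.
- move=> i y /mem_dual_gr h; apply: (gr_mem_only (hG := gm_grP M)) => j ji.
  apply: functional_sep => mu.
  pose nu : 'Hom(M, K^o) := (mu \o pr M j)%VF.
  have nuj : nu \in gm_gr (dual_to_op M) j.
    apply/mem_dual_gr => k m kj mk; rewrite comp_lfunE.
    by rewrite (gr_proj_0 _ kj mk) linear0.
  transitivity (nu (eps y)); first by rewrite comp_lfunE.
  by rewrite epsE (h j) //; exact: (ip_gr hu).
- move=> y y0; apply/lfunP => z; rewrite zero_lfunE.
  have [c ->] := ip_gen hu z; rewrite linear_sum big1 // => i _ /=.
  by rewrite -actE -epsE y0 linear0.
- move=> c.
  have /choice [d dE] (z : Z) := ip_gen hu z.
  pose y0 (z : Z) : K^o := \sum_i (d z i : 'Hom(M, K^o)) (c i).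
  have y0E (g : I -> 'Hom(M, K^o)) : y0 (\sum_i n i ** u (g i)) = \sum_i g i (c i).
    apply: eq_bigr => i _.
    by have -> := ip_coord hu (esym (dE (\sum_i n i ** u (g i)))) i.
  have yl : linear y0.
    move=> k z w; transitivity (y0 (\sum_i n i ** u (k *: d z i + d w i))).
      congr y0; rewrite {1}(dE z) {1}(dE w) scaler_sumr -big_split /=.
      by apply: eq_bigr => i _; rewrite linearP act_lin.
    rewrite y0E scaler_sumr -big_split; apply: eq_bigr => i _ /=.
    by rewrite add_lfunE scale_lfunE.
  have [y yE] := @linfun_ex K Z K^o y0 yl.
  exists (y : Y) => i; apply/subr0_eq/functional_sep => mu.
  rewrite linearB /= epsE actE yE.
  have -> : n i ** u mu = \sum_j n j ** u (if j == i then mu else 0).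
    rewrite (bigD1 i) //= eqxx big1 ?addr0 // => j /negPf ->.
    by rewrite linear0 actr0.
  rewrite y0E (bigD1 i) //= eqxx big1 ?addr0 ?subrr // => j /negPf ->.
  by rewrite zero_lfunE.
Qed.

Definition coind_counit (M : grMod T) : 'Hom(coinduced M, M) :=
  sval (cid (coind_counit_exists M)).

Lemma coind_counitP M : coind_prop (coind_counit M).
Proof. exact: (svalP (cid (coind_counit_exists M))). Qed.

Section Universal.
Variables (M : grMod T) (Y : grMod A) (eps : 'Hom(Y, M)).
Hypothesis he : coind_prop eps.

Lemma cp_pr i y : pr M i (eps y) = eps (pr Y i y).
Proof.
rewrite -{1}[i]add0r; apply: gr_shift => k v; rewrite add0r; exact: (cp_gr he).
Qed.

Lemma cp_eq y z : (forall i, eps (coact (n i) y) = eps (coact (n i) z)) -> y = z.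
Proof.
move=> h; apply/subr0_eq/(cp_sep he) => i.
by rewrite /coact linearB linearB /= -/(coact _ _) h subrr.
Qed.

Lemma cp_ext (X : grMod A) (g h : grhom X Y) :
  (forall x, eps (g x) = eps (h x)) -> g = h.
Proof.
by move=> gh; apply: hom_ext => x; apply: cp_eq => i; rewrite /coact -!hom_act gh.
Qed.

Lemma cp_lift (X : grMod A) (f : 'Hom(X, M)) :
  (forall x m, x \in B -> f (coact x m) = @gm_act K T M (q x) (f m)) ->
  (forall i m, m \in gm_gr X i -> f m \in gm_gr M i) ->
  exists g : grhom X Y, forall x, eps (g x) = f x.
Proof.
move=> fB fG.
have /choice [g0 g0E] : forall x, exists y, forall i,
    eps (coact (n i) y) = f (coact (n i) x).
  by move=> x; exact: (cp_full he).
have g0a a x : eps (coact a (g0 x)) = f (coact a x).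
  rewrite (fr_sum D a) !coact_sum !linear_sum; apply: eq_bigr => i _ /=.
  rewrite !coactM (cp_B he) ?fr_bB // g0E.
  by rewrite (fB (b i a)) ?fr_bB.
have g0l : linear g0.
  move=> k x y; apply: cp_eq => i.
  by rewrite g0a /coact !linearP /= -!/(coact _ _) !g0a.
have [g gE] := linfun_ex g0l.
have [a x|d x xd|h hE] := @mk_hom K A X Y g; last first.
- exists h => x; rewrite hE gE.
  have := g0a 1 x; rewrite /coact.
  by rewrite [X in eps X]act1 [X in f X]act1.
- rewrite gE; apply/(gr_memP (gm_grP Y)); apply: cp_eq => i.
  have nd : n i \in ga_gr A (- e i) by exact: fr_ndeg.
  have := pr_act d (g0 x) nd; rewrite /coact => <-. rewrite -cp_pr -!/(coact _ _) g0a.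
  by apply: gr_proj_id; apply: fG; apply: gm_grM.
- rewrite !gE; apply: cp_eq => i.
  by rewrite g0a /coact -!actM -!/(coact _ _) g0a.
Qed.

End Universal.

Section Map.
Variables (M N : grMod T) (X Y : grMod A) (u : 'Hom(X, M)) (v : 'Hom(Y, N)).
Hypotheses (hu : coind_prop u) (hv : coind_prop v).

Lemma cp_map (f : grhom M N) : exists g : grhom X Y, forall x, v (g x) = f (u x).
Proof.
have [x m xB|i m mi|g gE] := @cp_lift N Y v hv X (f \o u)%VF.
- by rewrite !comp_lfunE (cp_B hu) // hom_act.
- by rewrite comp_lfunE; apply: hom_gr; exact: (cp_gr hu).
by exists g => m; rewrite gE comp_lfunE.
Qed.

Lemma cp_map_inj (f : grhom M N) (g : grhom X Y) :
  (forall x, v (g x) = f (u x)) -> inj f -> inj g.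
Proof.
move=> gE fi x gx; apply: (cp_sep hu) => i; apply: fi.
by rewrite -gE /coact hom_act gx actr0 linear0.
Qed.

Lemma cp_map_surj (f : grhom M N) (g : grhom X Y) :
  (forall x, v (g x) = f (u x)) -> surj f -> surj g.
Proof.
move=> gE fs y; have /choice [d dE] i := fs (v (coact (n i) y)).
have [x xE] := cp_full hu d; exists x; apply: (cp_eq hv) => i.
by rewrite dE -xE -gE /coact hom_act.
Qed.

End Map.

Lemma cp_map_exact (M N P : grMod T) (X Y Z : grMod A) (u : 'Hom(X, M))
    (v : 'Hom(Y, N)) (w : 'Hom(Z, P)) (f : grhom M N) (g : grhom N P)
    (F : grhom X Y) (G : grhom Y Z) :
  coind_prop u -> coind_prop v -> coind_prop w ->
  (forall x, v (F x) = f (u x)) -> (forall y, w (G y) = g (v y)) ->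
  gexact f g -> gexact F G.
Proof.
move=> hu hv hw FE GE [fi gs fg]; split.
- exact (cp_map_inj hu FE fi).
- exact (cp_map_surj hv hw GE gs).
- move=> y; split=> [Gy|[x ->]].
    have /choice [d dE] : forall i, exists m, v (coact (n i) y) = f m.
      by move=> i; apply/fg; rewrite -GE /coact hom_act Gy actr0 linear0.
    have [x xE] := cp_full hu d; exists x; apply: (cp_eq hv) => i.
    by rewrite dE -xE -FE /coact hom_act.
  apply: (cp_sep hw) => i; rewrite /coact -!hom_act GE FE.
  by apply/fg; exists (u (coact (n i) x)).
Qed.

End Coinduction.

Notation ga_pr A i := (gr_proj (ga_grP A) i).

Section FreeExtCriterion.
Variables (K : fieldType) (A : grAlg K).

Lemma ga_pr_mull i j (a b : A) : a \in ga_gr A i ->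
  ga_pr A (i + j) (a * b) = a * ga_pr A j b.
Proof. by move=> ai; exact: (@pr_act K A (regMod A) i j a b ai). Qed.

(** If N and B span A multiplicatively and dim N dim B is at most dim A, the map
    N (x) B -> A is onto, hence bijective; its inverse gives the coordinates. *)
Lemma free_ext_dim (T : grAlg K) (N B : {vspace A}) (q : A -> T) :
  (forall i u, u \in N -> ga_pr A i u \in N) ->
  (forall i u, u \in B -> ga_pr A i u \in B) ->
  1 \in N -> 1 \in B -> (forall x y, x \in B -> y \in B -> x * y \in B) ->
  (N * B = fullv)%VS -> (\dim N * \dim B <= \dim {:A})%N ->
  linear q -> q 1 = 1 ->
  (forall x y, x \in B -> y \in B -> q (x * y) = q x * q y) ->
  (forall i x, x \in B -> x \in ga_gr A i -> q x \in ga_gr T i) ->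
  exists D : free_ext B q, forall i : 'I_(fr_r D), fr_n i \in N.
Proof.
move=> Ng Bg N1 B1 BM NB dNB ql q1 qM qG.
have [r [n [e [nN ne rN nspan]]]] := homog_basis Ng.
pose V : vectType K := {ffun 'I_r -> subvs_of B}.
have phil : linear (fun f : V => \sum_i n i * vsval (f i)).
  move=> k f g; rewrite scaler_sumr -big_split; apply: eq_bigr => i _ /=.
  by rewrite !ffunE linearP mulrDr scalerAr.
have [phi phiE] := linfun_ex phil.
have phis : surj phi.
  move=> y; have [x ->] : exists x, y = phi x; last by exists x.
  have /memv_imgP [x _ ->] : y \in limg phi; last by exists x.
  suff /subvP : (fullv <= limg phi)%VS by apply; exact: memvf.
  rewrite -NB; apply/prodvP => u v uN vB; have [c ->] := nspan u uN.
  apply/memv_imgP; exists [ffun i => c i *: vsproj B v]; rewrite ?memvf // phiE.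
  rewrite mulr_suml; apply: eq_bigr => i _.
  by rewrite ffunE linearZ /= vsprojK // -scalerAl scalerAr.
have phii : inj phi.
  apply: (surj_inj phis); have -> : \dim {:V} = (#|'I_r| * \dim B)%N by rewrite dimvf.
  by rewrite card_ord rN.
have [h hE] := @lift_inj _ _ _ _ phi \1%VF phii (fun w => phis (\1%VF w)).
have /choice [b bE] : forall j, exists f : 'End(A), forall a, f a = vsval (h a j).
  by move=> j; apply: linfun_ex => k u v; rewrite linearP /= !ffunE.
have bB j a : b j a \in B by rewrite bE subvsP.
have bsum a : a = \sum_j n j * b j a.
  rewrite -[LHS](id_lfunE a) -hE phiE; apply: eq_bigr => i _; by rewrite bE.
have buniq (c d : 'I_r -> A) : (forall i, c i \in B) -> (forall i, d i \in B) ->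
    \sum_i n i * c i = \sum_i n i * d i -> forall i, c i = d i.
  move=> cB dB cd i.
  have /(injP phii) /ffunP /(_ i) : phi [ffun i => vsproj B (c i)] = phi [ffun i => vsproj B (d i)].
    rewrite !phiE; under eq_bigr do rewrite ffunE vsprojK //.
    by rewrite cd; apply: eq_bigr => j _; rewrite ffunE vsprojK.
  by rewrite !ffunE => /(congr1 vsval); rewrite !vsprojK.
have bn i j x : x \in B -> b j (n i * x) = if i == j then x else 0.
  move=> xB; have := buniq (fun j => b j (n i * x)) (fun j => if i == j then x else 0).
  move=> -> //; first by move=> k; case: eqP => // _; exact: mem0v.
  rewrite -bsum (bigD1 i) //= eqxx big1 ?addr0 // => k /negPf ki.
  by rewrite eq_sym ki mulr0.
have bdeg i j a : a \in ga_gr A (e j + i) -> b j a \in ga_gr A i.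
  move=> aij; apply/(gr_memP (ga_grP A)).
  have := buniq (fun k => ga_pr A (e j + i - e k) (b k a)) (fun k => b k a).
  move=> /(_ _ _ _ j); rewrite -addrA [i - e j]addrC addNKr; apply=> //.
    by move=> k; apply: Bg.
  rewrite -bsum -[RHS](gr_proj_id (ga_grP A) aij) [in RHS](bsum a) linear_sum /=.
  apply: eq_bigr => k _; rewrite -(ga_pr_mull _ _ (ne k)).
  by rewrite [e k + _]addrC subrK.
have c1 := nspan 1 N1.
by exists (FreeExt bB bsum bn ne bdeg B1 BM ql q1 qM qG c1).
Qed.

(** Over the scalars every graded algebra is free, and induction and coinduction
    along K give the free and cofree modules on a graded vector space. *)
Lemma free_ext_scalars : exists D : @free_ext K A A 1%VS id, True.
Proof.
have [|||||||||||D _] := @free_ext_dim A fullv 1%VS id; last by exists D.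
- by move=> i u _; exact: memvf.
- move=> i u /vlineP [k ->]; rewrite linearZ /=.
  have [->|i0] := eqVneq i 0; first by rewrite gr_proj_id ?ga_gr1 ?memvZ ?memv_line.
  by rewrite (gr_proj_0 _ _ (ga_gr1 A)) ?scaler0 ?mem0v // eq_sym.
- exact: memvf.
- exact: memv_line.
- move=> x y /vlineP [k ->] /vlineP [l ->].
  by rewrite -scalerAl mul1r scalerA memvZ ?memv_line.
- exact: prodv1.
- by rewrite dimv1 muln1.
- by [].
- by [].
- by [].
- by [].
Qed.

End FreeExtCriterion.

(** * Enough projectives and injectives *)

Section Enough.
Variables (K : fieldType) (A : grAlg K).
Implicit Types M N X Y P : grMod A.

(** Any linear section becomes homogeneous after keeping its degree preserving
    part. *)
Lemma graded_section X Y (f : grhom X Y) : surj f ->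
  exists s : 'Hom(Y, X), (forall y, f (s y) = y) /\
    forall i y, y \in gm_gr Y i -> s y \in gm_gr X i.
Proof.
move=> fs; have [s0 s0E] : exists s0 : 'Hom(Y, X), forall y, f (s0 y) = y.
  exists ((f : 'Hom(X, Y))^-1)%VF => y; apply: limg_lfunVK.
  by have /surj_limg -> := fs; exact: memvf.
have [t ut et] := gr_projE (gm_grP Y).
have sl : linear (fun y => \sum_(i <- t) pr X i (s0 (pr Y i y))).
  move=> k u v; rewrite scaler_sumr -big_split; apply: eq_bigr => i _ /=.
  by rewrite !linearP.
have [s sE] := linfun_ex sl; exists s; split=> [y | i y yi].
  rewrite sE [RHS]et linear_sum; apply: eq_bigr => i _ /=.
  by rewrite -pr_hom s0E gr_proj_proj eqxx.
rewrite sE; apply: memv_suml => j _.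
have [<-|ji] := eqVneq j i; first exact: memv_gr_proj.
by rewrite (gr_proj_0 _ _ yi) ?linear0 ?mem0v // eq_sym.
Qed.

Lemma graded_retraction X Y (f : grhom X Y) : inj f ->
  exists s : 'Hom(Y, X), (forall x, s (f x) = x) /\
    forall i y, y \in gm_gr Y i -> s y \in gm_gr X i.
Proof.
move=> fi; have [s0 s0E] : exists s0 : 'Hom(Y, X), forall x, s0 (f x) = x.
  exists ((f : 'Hom(X, Y))^-1)%VF => y; apply: lker0_lfunK; exact/inj_lker.
have [t ut et] := gr_projE (gm_grP X).
have [t' ut' et'] := gr_projE (gm_grP Y).
have sl : linear (fun y => \sum_(i <- t') pr X i (s0 (pr Y i y))).
  move=> k u v; rewrite scaler_sumr -big_split; apply: eq_bigr => i _ /=.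
  by rewrite !linearP.
have [s sE] := linfun_ex sl; exists s; split=> [x | i y yi].
  apply: (injP fi); rewrite sE [RHS]et' linear_sum; apply: eq_bigr => i _ /=.
  by rewrite (pr_hom f i x) s0E gr_proj_proj eqxx.
rewrite sE; apply: memv_suml => j _.
have [<-|ji] := eqVneq j i; first exact: memv_gr_proj.
by rewrite (gr_proj_0 _ _ yi) ?linear0 ?mem0v // eq_sym.
Qed.

Lemma scalar_act x M (m : M) : x \in (1%VS : {vspace A}) ->
  exists k : K, x = k *: 1 /\ x ** m = k *: m.
Proof. by case/vlineP => k ->; exists k; rewrite actZl act1. Qed.

(** The free module on the underlying graded space of M: its maps to X are the
    graded linear maps M -> X, which lift because surjections split linearly. *)
Lemma enough_proj M : exists (P : GMod A) (p : grhom P M),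
  @is_projective (GMod A) P /\ surj p.
Proof.
have [D _] := free_ext_scalars A.
pose P : grMod A := @induced K A A 1%VS id M; pose u : 'Hom(M, P) := ind_unit D M.
have hu : ind_prop D u := ind_unitP D M.
have [x m x1|i m mi|p pE] := @ip_lift _ _ _ _ _ D M P u hu M \1%VF.
- by rewrite !id_lfunE.
- by rewrite id_lfunE.
exists P, p; split; last by move=> y; exists (u y); rewrite pE id_lfunE.
move=> X Y e f /gepiP es; have [s [sE sG]] := graded_section es.
have [x m x1|i m mi|g gE] :=
  @ip_lift _ _ _ _ _ D M P u hu (X : grMod A) (s \o (f : grhom P Y) \o u)%VF.
- rewrite !comp_lfunE; have [k [-> _]] := scalar_act m x1.
  by rewrite !actZl !act1 !linearZ.
- by rewrite !comp_lfunE; apply/sG/hom_gr/(ip_gr hu).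
exists g; apply: (ip_ext hu) => m.
by rewrite homE gE !comp_lfunE sE.
Qed.

End Enough.

Section EnoughInjectives.
Variables (K : fieldType) (A : grAlg K).

(** Dually, the cofree module on the underlying graded space of M. *)
Lemma enough_inj (M : grMod A) : exists (J : GMod A) (j : grhom M J),
  @is_injective (GMod A) J /\ inj j.
Proof.
have [D _] := free_ext_scalars (opAlg A).
pose J : grMod A := @coinduced K A A 1%VS id M.
pose u : 'Hom(J, M) := coind_counit D M.
have hu : coind_prop D u := coind_counitP D M.
have sc x : x \in (1%VS : {vspace opAlg A}) ->
    exists k : K, forall (X : grMod A) (m : X), coact x m = k *: m.
  case/vlineP => k ->; exists k => X m.
  by rewrite /coact; apply: etrans (actZl _ _ _) _; congr (_ *: _); exact: act1.
have [x m x1|i m mi|p pE] := @cp_lift _ _ _ _ _ D M J u hu M \1%VF.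
- by rewrite !id_lfunE.
- by rewrite id_lfunE.
exists J, p; split; last by move=> y py; rewrite -[y]id_lfunE -pE py linear0.
move=> X Y e f /gmonoP es; have [s [sE sG]] := graded_retraction es.
have [x m x1|i m mi|g gE] :=
  @cp_lift _ _ _ _ _ D M J u hu (Y : grMod A) (u \o (f : grhom X J) \o s)%VF.
- rewrite !comp_lfunE; have [k kE] := sc x x1.
  by rewrite kE !linearZ /= -kE.
- by rewrite !comp_lfunE; apply/(cp_gr hu)/hom_gr/sG.
exists g; apply: (cp_ext hu) => m.
by rewrite homE gE !comp_lfunE sE.
Qed.

End EnoughInjectives.

(** * Projective covers and injective hulls *)

Section CategoryLemmas.
Variable C : cat.
Implicit Types X Y Z P : C.

Lemma isom_refl X : isom X X.
Proof. by exists (idm X), (idm X); rewrite comp1m. Qed.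

Lemma isom_sym X Y : isom X Y -> isom Y X.
Proof. by move=> [f [g [gf fg]]]; exists g, f. Qed.

Lemma isom_trans X Y Z : isom X Y -> isom Y Z -> isom X Z.
Proof.
move=> [f [g [gf fg]]] [f' [g' [gf' fg']]]; exists (f' \oc f), (g \oc g').
by rewrite !compA -(compA g) gf' compm1 gf -(compA f') fg compm1 fg'.
Qed.

Lemma epi_comp X Y Z (g : hom Y Z) (f : hom X Y) :
  is_epi f -> is_epi g -> is_epi (g \oc f).
Proof. by move=> fe ge W h k; rewrite !compA => /fe /ge. Qed.

Lemma epi_right X Y Z (g : hom Y Z) (f : hom X Y) :
  is_epi (g \oc f) -> is_epi g.
Proof. by move=> e W h k hk; apply: e; rewrite !compA hk. Qed.

Lemma iso_epi X Y (f : hom X Y) : is_iso f -> is_epi f.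
Proof.
move=> [g [gf fg]] W h k e.
by rewrite -[h]compm1 -[k]compm1 -fg !compA e.
Qed.

Lemma retract_proj P Q (i : hom Q P) (r : hom P Q) :
  r \oc i = idm Q -> is_projective P -> is_projective Q.
Proof.
move=> ri Pp X Y e f /(Pp X Y e (f \oc r)) [g ge].
by exists (g \oc i); rewrite compA ge -compA ri compm1.
Qed.

Lemma proj_cover_isom X X' P P' :
  isom X X' -> isom P P' -> is_proj_cover X P -> is_proj_cover X' P'.
Proof.
move=> [a [a' [a'a aa']]] [b [b' [b'b bb']]] [Pp [p [pe pu]]].
have ai : is_iso a by exists a'.
have bi : is_iso b by exists b'.
have b'i : is_iso b' by exists b.
split; first exact: retract_proj bb' Pp.
exists (a \oc p \oc b'); split.
  apply: epi_comp (iso_epi b'i) _; exact: epi_comp pe (iso_epi ai).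
move=> Y g ge; have : is_epi (b' \oc g).
  apply: pu => W h k e.
  have : (h \oc a' ) \oc (a \oc p \oc b' \oc g) = (k \oc a') \oc (a \oc p \oc b' \oc g).
    have E (x : hom X W) : x \oc a' \oc (a \oc p \oc b' \oc g) = x \oc (p \oc (b' \oc g)).
      by rewrite -!compA; congr (x \oc _); rewrite !compA a'a comp1m.
    by rewrite !E.
  by move/ge => hk; rewrite -[h]compm1 -[k]compm1 -a'a !compA hk.
move=> be; have -> : g = b \oc (b' \oc g) by rewrite compA bb' comp1m.
exact: epi_comp be (iso_epi bi).
Qed.

End CategoryLemmas.

(** Injective hulls are projective covers in the opposite category, so that
    existence is proved only once. *)
Definition op_cat (C : cat) : cat :=
  @Cat C (fun X Y => hom Y X) (fun X => idm X) (fun X Y Z g f => f \oc g)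
    (fun X Y f => compm1 f) (fun X Y f => comp1m f)
    (fun X Y Z W h g f => esym (compA f g h)).

Lemma op_isom (C : cat) (X Y : C) : isom X Y -> @isom (op_cat C) X Y.
Proof. by move=> [f [g [gf fg]]]; exists g, f. Qed.

Lemma op_proj_cover (C : cat) (X I : C) :
  @is_proj_cover (op_cat C) X I <-> is_inj_hull X I.
Proof.
split=> [[Ip [p [pe pu]]]|[Ii [i [im iu]]]].
  by split; [move=> Y Z m f; exact: (Ip Z Y m f) | exists p].
by split; [move=> Y Z m f; exact: (Ii Z Y m f) | exists i].
Qed.

Lemma inj_hull_isom (C : cat) (X X' I I' : C) :
  isom X X' -> isom I I' -> is_inj_hull X I -> is_inj_hull X' I'.
Proof.
move=> /op_isom hX /op_isom hI /op_proj_cover h; apply/op_proj_cover.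
exact: proj_cover_isom hX hI h.
Qed.

(** A self-dual form of Fitting's lemma: in a set Q of endomorphisms closed
    under composition, either all members are invertible or some member splits
    off a smaller direct summand. *)
Definition fitting (C : cat) (dim : C -> nat) : Prop :=
  forall (P : C) (Q : hom P P -> Prop),
  (forall e f, Q e -> Q f -> Q (e \oc f)) -> (exists e, Q e) ->
  (forall e, Q e -> is_iso e) \/
  exists e (I : C) (i s' : hom I P) (r s : hom P I),
    [/\ Q e, (dim I < dim P)%N, r \oc i = idm I, e = i \oc s & e = s' \oc r].

Lemma fitting_op (C : cat) (dim : C -> nat) :
  @fitting C dim -> @fitting (op_cat C) dim.
Proof.
move=> F P Q Qc Qe; have [|h|] := F P Q _ Qe.
- by move=> e f Qe1 Qf; exact: Qc.
- by left=> e /h [g [h1 h2]]; exists g.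
- move=> [e [I [i [s' [r [s [h1 h2 h3 h4 h5]]]]]]]; right.
  by exists e, I, r, s, i, s'.
Qed.

(** A projective object of least dimension mapping onto X is a cover: if p o g is
    epi, lift p to h with p o g o h = p; either g o h is invertible, or some
    endomorphism e with p o e = p splits off a smaller projective object that
    still maps onto X. *)
Lemma proj_cover_exists (C : cat) (dim : C -> nat) : fitting dim ->
  forall X : C, (exists P (p : hom P X), is_projective P /\ is_epi p) ->
  exists P, is_proj_cover X P.
Proof.
move=> F X h.
pose R (n : nat) := `[< exists P (p : hom P X),
  [/\ is_projective P, is_epi p & dim P = n] >].
have exR : exists n, R n.
  by case: h => P [p [Pp pe]]; exists (dim P); apply/asboolP; exists P, p.
case: (ex_minnP exR) => m /asboolP [P [p [Pp pe Pm]]] mmin.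
exists P; split=> //; exists p; split=> // Y g ge.
have [h' h'E] := Pp _ _ (p \oc g) p ge.
have [|| iso |] := F P (fun e => p \oc e = p).
- by move=> e f pe' pf; rewrite compA pe'.
- by exists (g \oc h'); rewrite compA.
- have /iso_epi : is_iso (g \oc h') by apply: iso; rewrite compA.
  exact: epi_right.
move=> [e [I [i [s' [r [s [h1 h2 h3 h4 _]]]]]]].
have: (m <= dim I)%N.
  apply: mmin; apply/asboolP; exists I, (p \oc i); split=> //.
    exact: retract_proj h3 Pp.
  apply: (@epi_right _ _ _ _ (p \oc i) s).
  by rewrite -compA -h4 h1.
by rewrite leqNgt -Pm h2.
Qed.

Section GradedCovers.
Variables (K : fieldType) (A : grAlg K).
Implicit Types M N X P : grMod A.

Definition gdim (M : GMod A) : nat := \dim {: (M : grMod A)}.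

(** Let e in Q have least rank. Then e o e has the same rank, so e is bijective
    on its image, which is thereby a direct summand. *)
Lemma gmod_fitting : fitting gdim.
Proof.
move=> P Q Qc [e0 Qe0].
pose R (n : nat) := `[< exists e : grhom P P, Q e /\ \dim (limg e) = n >].
have exR : exists n, R n.
  by exists (\dim (limg (e0 : grhom P P))); apply/asboolP; exists e0.
case: (ex_minnP exR) => m /asboolP [e [Qe em]] mmin.
have [me|me] := leqP (\dim {: (P : grMod A)}) m.
  left=> f Qf; apply/gisoP.
  have fs : surj (f : grhom P P).
    apply/surj_limg/eqP; rewrite eqEdim subvf; apply: leq_trans me _.
    by apply: mmin; apply/asboolP; exists f.
  by split=> //; exact: (surj_inj fs).
right.
have [I [i [s [ii ss is_]]]] := img_mod e.
have limI : limg i = limg e.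
  apply/vspaceP => x; apply/memv_imgP/memv_imgP => -[y _ ->].
    by have [z ->] := ss y; exists z; rewrite ?memvf.
  by exists (s y); rewrite ?memvf.
have dimI : \dim {:I} = m.
  rewrite -em -limI limg_dim_eq //; apply/eqP; rewrite capfv.
  exact/inj_lker.
have sis : surj (grhom_comp s i).
  apply: inj_surj => // x; rewrite homE => six.
  have e2 : \dim (limg (grhom_comp e e)) = m.
    apply/eqP; rewrite eqn_leq mmin ?andbT; last first.
      by apply/asboolP; exists (grhom_comp e e); split=> //; exact: Qc.
    by rewrite -em limg_comp dimvS // limgS ?subvf.
  have := limg_ker_dim e (limg e).
  have -> : (e @: limg e)%VS = limg (grhom_comp e e) by rewrite limg_comp.
  rewrite e2 em -{2}[m]add0n => /addIn/eqP; rewrite dimv_eq0 => /eqP k0.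
  apply: ii; apply/eqP; rewrite -memv0 -k0 memv_cap -{1}limI memv_img ?memvf //.
  by rewrite memv_ker is_ six linear0 eqxx.
have sii : inj (grhom_comp s i) by exact: surj_inj.
have [v [vs sv]] := ginv sii sis.
exists e, I, i, (grhom_comp i (grhom_comp (grhom_comp s i) (grhom_id I))).
exists (grhom_comp v s), s; split=> //.
- by rewrite /gdim dimI.
- by apply: (etrans (esym (grhom_compA v s i))).
- by apply: hom_ext => x; rewrite homE is_.
- apply: hom_ext => x; rewrite !homE hom1E is_; congr (i _).
  by rewrite -[LHS]hom1E -sv !homE.
Qed.

Lemma proj_coverP (X : GMod A) : is_proj_cover X (proj_cover X).
Proof.
apply: pick_obP; apply: (proj_cover_exists gmod_fitting).
have [P [p [Pp ps]]] := enough_proj (X : grMod A).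
by exists P, p; split=> //; exact/gepiP.
Qed.

Lemma inj_hullP (X : GMod A) : is_inj_hull X (inj_hull X).
Proof.
apply: pick_obP.
have [|I hI] := @proj_cover_exists _ _ (fitting_op gmod_fitting) X.
  have [I [i [Ii ij]]] := enough_inj (X : grMod A); exists I, i; split.
    by move=> Y Z m f; exact: Ii.
  exact/gmonoP.
by exists I; exact/op_proj_cover.
Qed.

End GradedCovers.

(** * Simple modules and finite length *)

Section Simples.
Variables (K : fieldType) (A : grAlg K).
Implicit Types M N X Y S : grMod A.

Definition gzero M : Prop := forall x : M, x = 0.

Definition gsimple X : Prop :=
  ~ gzero X /\ forall U : {vspace X}, gsub U -> U = 0%VS \/ U = fullv.

Lemma gsimpleP (X : GMod A) : is_simple X <-> gsimple X.
Proof.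
split=> [[nz h] | [nz h]]; split.
- by move=> z; apply: nz; apply/gzeroP.
- move=> U hU; have [S [i [ii iU]]] := sub_mod hU.
  have [/gzeroP S0|/gisoP [_ is_]] := h S i ((gmonoP i).2 ii); [left | right].
    apply/eqP; rewrite -subv0; apply/subvP => x /iU [s ->].
    by rewrite (S0 s) linear0 mem0v.
  by apply/vspaceP => x; rewrite memvf; apply/iU; apply: is_.
- by move/gzeroP.
- move=> Y m /gmonoP mi; have [e|e] := h _ (gsub_img (m : grhom Y X)).
    left; apply/gzeroP => y; apply: mi; apply/eqP.
    by rewrite -memv0 -e memv_img ?memvf.
  by right; apply/gisoP; split=> //; exact/surj_limg.
Qed.

Lemma simple_inj X Y (f : grhom X Y) : gsimple X -> (exists x, f x <> 0) -> inj f.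
Proof.
move=> [_ h] [x fx]; have [/eqP /inj_lker // | e] := h _ (gsub_ker f).
by case: fx; apply/eqP; rewrite -memv_ker e memvf.
Qed.

Lemma simple_surj X Y (f : grhom X Y) : gsimple Y -> (exists x, f x <> 0) -> surj f.
Proof.
move=> [_ h] [x fx]; have [e | /surj_limg //] := h _ (gsub_img f).
by case: fx; apply/eqP; rewrite -memv0 -e memv_img ?memvf.
Qed.

Lemma gsimple_isom X Y (f : grhom X Y) : inj f -> surj f -> gsimple X -> gsimple Y.
Proof.
move=> fi fs sX; apply/gsimpleP.
have [g [gf fg]] := ginv fi fs.
have gE y : f (g y) = y by rewrite -homE fg hom1E.
split=> [/gzeroP Y0|Z m /gmonoP mi].
  by case: sX => + _; apply=> x; apply: fi; exact: Y0.
have gi : inj (grhom_comp g m).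
  by move=> z; rewrite homE => gm; apply: mi; rewrite -(gE ((m : grhom Z Y) z)) gm linear0.
have /gsimpleP [_ /(_ Z (grhom_comp g m) ((gmonoP _).2 gi))] := sX.
case=> [z|/gisoP [_ ps]]; [by left | right; apply/gisoP; split=> // y].
by have [z zE] := ps (g y); exists z; rewrite -[LHS]gE zE homE gE.
Qed.

(** Divide by a proper graded submodule containing U of maximal dimension. *)
Lemma simple_quotient X (U : {vspace X}) : gsub U -> U <> fullv ->
  exists (S : grMod A) (p : grhom X S),
    [/\ gsimple S, surj p & forall x, x \in U -> p x = 0].
Proof.
move=> hU Uf.
pose R (d : nat) := `[< exists V : {vspace X}, [/\ gsub V, (U <= V)%VS,
  V <> fullv & \dim V = d] >].
have exR : exists d, R d by exists (\dim U); apply/asboolP; exists U.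
have bR d : R d -> (d <= \dim {:X})%N.
  by move=> /asboolP [V [_ _ _ <-]]; exact/dimvS/subvf.
case: (ex_maxnP exR bR) => d /asboolP [V [hV UV Vf dV]] dmax.
have [S [p [ps pV]]] := quot_mod hV; exists S, p; split=> //; last first.
  by move=> x xU; apply/pV; exact: (subvP UV).
split=> [S0|W hW].
  by apply: Vf; apply/vspaceP => x; rewrite memvf; apply/pV.
pose V' := ((p : 'Hom(X, S)) @^-1: W)%VS.
have V'P x : (x \in V') = (p x \in W) by rewrite memv_preim.
have hV' : gsub V'.
  split=> [a x|i x]; rewrite !V'P; first by rewrite hom_act; exact: hW.1.
  by rewrite -pr_hom; exact: hW.2.
have VV' : (V <= V')%VS.
  by apply/subvP => x /pV px; rewrite V'P px mem0v.
have [e|ne] := pselect (V' = fullv).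
  right; apply/vspaceP => y; have [x ->] := ps y.
  by rewrite memvf -V'P e memvf.
left; apply/eqP; rewrite -subv0; apply/subvP => y; have [x ->] := ps y => px.
have: (\dim V' <= \dim V)%N.
  rewrite dV; apply: dmax; apply/asboolP; exists V'; split=> //.
  exact: subv_trans UV VV'.
have := dimv_leqif_eq VV'; rewrite /leqif => -[_ e] d'; have: (V == V').
  by rewrite -e eqn_leq d' dimvS.
by move=> /eqP eV; rewrite memv0; apply/eqP/pV; rewrite eV V'P.
Qed.

Lemma gsub0 X : gsub (0%VS : {vspace X}).
Proof. by split=> [a u | i u]; rewrite !memv0 => /eqP ->; rewrite linear0. Qed.

Lemma gzero_full X : (0%VS : {vspace X}) = fullv -> gzero X.
Proof. by move=> e x; apply/eqP; rewrite -memv0 e memvf. Qed.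

Lemma simple_quotient_nz X : ~ gzero X ->
  exists (S : grMod A) (p : grhom X S), gsimple S /\ surj p.
Proof.
move=> nz; have [|S [p [sS ps _]]] := simple_quotient (gsub0 X).
  by move/gzero_full.
by exists S, p.
Qed.

Lemma gmod_finite_length (X : GMod A) : finite_length X.
Proof.
have [d] := ubnP (gdim X); elim: d X => // d IH X dX.
have [/gzeroP|nz] := pselect (gzero (X : grMod A)); first exact: FinLenZero.
have [S [p [sS ps]]] := simple_quotient_nz nz.
have [N [i [ii iP]]] := ker_mod p.
have ex : gexact i p by split.
apply: (@FinLenExt (GMod A) N X S i p); [apply: IH | exact/gsimpleP | exact/gsesP].
move: dX; rewrite ltnS; apply: leq_trans; rewrite /gdim.
have /inj_lker/eqP ik := ii.
rewrite -(limg_dim_eq (f := i) (U := fullv)) ?ik ?capv0 //.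
have -> : limg i = lker p.
  apply/vspaceP => x; rewrite memv_ker; apply/memv_imgP/eqP.
    by move=> [s _ ->]; apply/iP; exists s.
  by move=> /iP [s ->]; exists s; rewrite ?memvf.
rewrite -(limg_ker_dim p fullv) capfv -addn1 leq_add2l lt0n.
have /surj_limg -> := ps; rewrite dimv_eq0; apply/eqP => S0.
by case: sS.1; apply: gzero_full; rewrite S0.
Qed.

End Simples.

(** * The triangular decomposition as two free extensions *)

Section Tensors.
Import VectorInternalTheory.
Variables (K : fieldType) (U V W : vectType K).

(** The tensor product consists of matrices, and the matrix units are pure. *)
Lemma tens_span (f : 'Hom(tens U V, W)) (S : {vspace W}) :
  (forall u v, f (pure u v) \in S) -> forall z, f z \in S.
Proof.
move=> h z.
have -> : z = \sum_i \sum_j z i j *: pure (r2v (delta_mx 0 i)) (r2v (delta_mx 0 j)).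
  rewrite [LHS]matrix_sum_delta; apply: eq_bigr => i _; apply: eq_bigr => j _.
  by rewrite /pure !r2vK trmx_delta mul_delta_mx.
rewrite linear_sum; apply: memv_suml => i _; rewrite linear_sum.
by apply: memv_suml => j _; rewrite linearZ /= memvZ.
Qed.

Lemma pure_linl (v : V) : linear (fun u : U => pure u v : tens U V).
Proof.
move=> k x y; rewrite /pure !linearP /= mulmxDl.
by rewrite scalemxAl.
Qed.

End Tensors.

Section GradedProducts.
Variables (K : fieldType) (A : grAlg K).

Lemma ga_pr_mulr i (a t : A) : t \in ga_gr A 0 -> ga_pr A i (a * t) = ga_pr A i a * t.
Proof.
move=> t0; have [f fE] : exists f : 'End(A), forall x, f x = x * t.
  by apply: linfun_ex => k x y; rewrite mulrDl scalerAl.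
rewrite -!fE -{1}[i]add0r; apply: gr_shift => k v vk; rewrite fE addrC.
exact: ga_grM.
Qed.

Lemma ga_pr_conv i (a b : A) (S : {vspace A}) :
  (forall j, ga_pr A j a * ga_pr A (i - j) b \in S) -> ga_pr A i (a * b) \in S.
Proof.
move=> h; have [s us es] := gr_projE (ga_grP A).
rewrite (es a) mulr_suml linear_sum; apply: memv_suml => j _ /=.
rewrite -{1}(subrK j i) [i - j + j]addrC ga_pr_mull ?memv_gr_proj //.
Qed.

(** Taking degree 0 components is multiplicative on B^+ and on B^-, where the
    mixed terms vanish for sign reasons. *)
Lemma ga_pr0_mul (a b : A) :
  (forall j, j != 0 -> ga_pr A j a * ga_pr A (- j) b = 0) ->
  ga_pr A 0 (a * b) = ga_pr A 0 a * ga_pr A 0 b.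
Proof.
move=> h; have [s us es] := gr_projE (ga_grP A).
rewrite [in LHS](es a) [in RHS](es a) mulr_suml !linear_sum mulr_suml.
apply: eq_bigr => j _ /=; rewrite gr_proj_proj.
rewrite -{1}(subrr j) ga_pr_mull ?memv_gr_proj //.
by have [<-|j0] := eqVneq 0 j; rewrite ?oppr0 // h ?mul0r // eq_sym.
Qed.

Lemma graded_prodv (U V : {vspace A}) :
  (forall i u, u \in U -> ga_pr A i u \in U) ->
  (forall i v, v \in V -> ga_pr A i v \in V) ->
  forall i w, w \in (U * V)%VS -> ga_pr A i w \in (U * V)%VS.
Proof.
move=> Ug Vg i; suff /subvP h : (U * V <= ga_pr A i @^-1: (U * V))%VS.
  by move=> w /h; rewrite memv_preim.
apply/prodvP => u v uU vV; rewrite -memv_preim; apply: ga_pr_conv => j.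
by rewrite memv_mul ?Ug ?Vg.
Qed.

Lemma op_prodv (U V : {vspace A}) :
  @prodv K (opAlg A) U V = (V * U)%VS :> {vspace A}.
Proof.
apply/eqP; rewrite eqEsubv; apply/andP; split.
  apply/(@prodvP K (opAlg A)) => u v uU vV; exact: (@memv_mul K A V U v u).
apply/prodvP => v u vV uU; exact: (@memv_mul K (opAlg A) U V u v).
Qed.

End GradedProducts.

Section Triangular.
Variables (K : fieldType) (A : grAlg K) (td : tri_decomp A).
Notation N := (tdN td : {vspace A}).
Notation T := (tdT td : {vspace A}).
Notation P := (tdP td : {vspace A}).

Lemma td_span : (N * (T * P))%VS = fullv.
Proof.
have [mu [muE [mu' mu'K muK]]] := td_mult td.
apply/eqP; rewrite eqEsubv subvf; apply/subvP => a _; rewrite -(muK a).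
apply: tens_span => z y.
have [f fE] := linfun_ex (pure_linl (U := tens (subvs_of (tdN td)) (subvs_of (tdT td))) y).
have := @tens_span _ _ _ _ (mu \o f)%VF (N * (T * P))%VS.
move=> /(_ _ z); rewrite comp_lfunE fE; apply=> x t.
by rewrite comp_lfunE fE muE -mulrA !memv_mul ?subvsP.
Qed.

Lemma td_dim : (\dim N * (\dim T * \dim P))%N = \dim {:A}.
Proof.
have [mu [muE [mu' mu'K muK]]] := td_mult td.
have mi : inj mu by move=> x e; rewrite -[x]mu'K e -(linear0 mu) mu'K.
have ms : surj mu by move=> x; exists (mu' x); rewrite muK.
apply/eqP; rewrite mulnA eqn_leq.
have -> : (\dim N * \dim T * \dim P)%N =
    \dim {: tens (tens (subvs_of (tdN td)) (subvs_of (tdT td))) (subvs_of (tdP td))}.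
  by rewrite dimvf.
by rewrite (inj_dim mi) (surj_dim ms).
Qed.

Lemma td_T0 t : t \in T -> t \in ga_gr A 0.
Proof. exact: (subvP (tdT_deg td)). Qed.

Lemma td_1 : [/\ 1 \in N, 1 \in T & 1 \in P].
Proof. by split; [case: (tdN_gr td) | case: (tdT_gr td) | case: (tdP_gr td)]. Qed.

Lemma td_BP : BP td = (T * P)%VS.
Proof. exact: tdPT. Qed.

Lemma halfT_vanish (U : {aspace A}) i : gr_subalg U -> (U :&: ga_gr A i = 0)%VS ->
  forall b, b \in (U * T)%VS -> ga_pr A i b = 0.
Proof.
move=> [_ Ug] U0; suff /subvP h : (U * T <= lker (ga_pr A i))%VS.
  by move=> b /h; rewrite memv_ker => /eqP.
apply/prodvP => u t uU tT; rewrite memv_ker ga_pr_mulr ?td_T0 //.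
have : ga_pr A i u \in (U :&: ga_gr A i)%VS by rewrite memv_cap Ug // memv_gr_proj.
by rewrite U0 memv0 => /eqP ->; rewrite mul0r.
Qed.

Lemma halfT_0 (U : {aspace A}) : gr_subalg U -> (U :&: ga_gr A 0 = 1)%VS ->
  forall b, b \in (U * T)%VS -> ga_pr A 0 b \in T.
Proof.
move=> [_ Ug] U1; suff /subvP h : (U * T <= ga_pr A 0 @^-1: T)%VS.
  by move=> b /h; rewrite memv_preim.
apply/prodvP => u t uU tT; rewrite -memv_preim ga_pr_mulr ?td_T0 //.
have : ga_pr A 0 u \in (U :&: ga_gr A 0)%VS by rewrite memv_cap Ug // memv_gr_proj.
by rewrite U1 => /vlineP [k ->]; rewrite -scalerAl mul1r memvZ.
Qed.

Lemma BP_vanish i b : b \in BP td -> i < 0 -> ga_pr A i b = 0.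
Proof. by move=> bB i0; exact: halfT_vanish (tdP_gr td) (tdP_deg td i0) _ bB. Qed.

Lemma BN_vanish i b : b \in BN td -> 0 < i -> ga_pr A i b = 0.
Proof. by move=> bB i0; exact: halfT_vanish (tdN_gr td) (tdN_deg td i0) _ bB. Qed.

Lemma BP_0 b : b \in BP td -> ga_pr A 0 b \in T.
Proof. exact: halfT_0 (tdP_gr td) (tdP_0 td) b. Qed.

Lemma BN_0 b : b \in BN td -> ga_pr A 0 b \in T.
Proof. exact: halfT_0 (tdN_gr td) (tdN_0 td) b. Qed.

Lemma halfT_graded (U : {aspace A}) : gr_subalg U ->
  forall i b, b \in (U * T)%VS -> ga_pr A i b \in (U * T)%VS.
Proof. by move=> [_ Ug]; apply: graded_prodv => // i v; case: (tdT_gr td) => _; exact. Qed.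

Lemma halfT_1 (U : {aspace A}) : gr_subalg U -> 1 \in (U * T)%VS.
Proof. by move=> [U1 _]; rewrite -[1]mulr1 memv_mul //; case: td_1. Qed.

Lemma halfT_M (U : {aspace A}) : (U * T = T * U)%VS ->
  forall x y, x \in (U * T)%VS -> y \in (U * T)%VS -> x * y \in (U * T)%VS.
Proof.
move=> UT x y xU yU; have := memv_mul xU yU.
by rewrite {2}UT prodvA -[(U * T * T)%VS]prodvA prodv_id UT -prodvA prodv_id.
Qed.

Lemma toT_lin : linear (@toT K A td).
Proof. by move=> k x y; rewrite /toT !linearP. Qed.

Lemma toTE x : ga_pr A 0 x \in T -> vsval (toT td x) = ga_pr A 0 x.
Proof. by move=> xT; rewrite /toT vsprojK. Qed.

Lemma algT_1 : vsval (1 : algT td) = 1.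
Proof. by apply/eqP; rewrite /= algid_eq1; case: td_1. Qed.

Lemma toT_1 : toT td 1 = 1.
Proof.
apply: val_inj; rewrite /= toTE gr_proj_id ?ga_gr1 //; last by case: td_1.
exact/esym/algT_1.
Qed.

Lemma toT_id (t : algT td) : toT td (vsval t) = t.
Proof.
by apply: val_inj; rewrite /= toTE gr_proj_id ?subvsP // td_T0 // subvsP.
Qed.

Lemma toT_mul x y : ga_pr A 0 x \in T -> ga_pr A 0 y \in T ->
  (forall j, j != 0 -> ga_pr A j x * ga_pr A (- j) y = 0) ->
  toT td (x * y) = toT td x * toT td y.
Proof.
move=> xT yT h; apply: val_inj; rewrite /= !toTE //; last first.
  by rewrite ga_pr0_mul // memvM.
exact: ga_pr0_mul.
Qed.

Lemma toT_gr i x : ga_pr A 0 x \in T -> x \in ga_gr A i -> toT td x \in ga_gr (algT td) i.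
Proof.
move=> xT xi; rewrite /= mem_sub_gr toTE //.
have [e|i0] := eqVneq i 0; first by rewrite gr_proj_id -?e.
by rewrite (gr_proj_0 _ i0 xi) mem0v.
Qed.

Lemma toT_mulP x y : x \in BP td -> y \in BP td ->
  toT td (x * y) = toT td x * toT td y.
Proof.
move=> xB yB; apply: toT_mul; [exact: BP_0 | exact: BP_0 | move=> j].
rewrite neq_lt => /orP [j0|j0]; first by rewrite (BP_vanish xB j0) mul0r.
by rewrite (BP_vanish yB) ?mulr0 // oppr_lt0.
Qed.

Lemma toT_mulN x y : x \in BN td -> y \in BN td ->
  toT td (x * y) = toT td x * toT td y.
Proof.
move=> xB yB; apply: toT_mul; [exact: BN_0 | exact: BN_0 | move=> j].
rewrite neq_lt => /orP [j0|j0]; last by rewrite (BN_vanish xB j0) mul0r.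
by rewrite (BN_vanish yB) ?mulr0 // oppr_gt0.
Qed.

(** A = N B^+, and dim B^+ is at most dim T dim P because B^+ = TP. *)
Lemma BP_free_exists : exists D : free_ext (T := algT td) (BP td) (toT td),
  forall i : 'I_(fr_r D), fr_n i \in N.
Proof.
have [N1 T1 P1] := td_1.
apply: free_ext_dim => //.
- by move=> i u; case: (tdN_gr td) => _; exact.
- exact: halfT_graded (tdP_gr td).
- exact: halfT_1 (tdP_gr td).
- exact: halfT_M (tdPT td).
- by rewrite td_BP td_span.
- by rewrite td_BP -td_dim leq_mul2l dim_prodv orbT.
- exact: toT_lin.
- exact: toT_1.
- exact: toT_mulP.
- by move=> i x /BP_0; exact: toT_gr.
Qed.

Lemma op_ga_pr i x : gr_proj (ga_grP (opAlg A)) i x = ga_pr A (- i) x.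
Proof.
have [s us es] := gr_projE (ga_grP A).
have [s' us' es'] := gr_projE (ga_grP (opAlg A)).
rewrite [in LHS](es x) [in RHS](es x) !linear_sum; apply: eq_bigr => j _ /=.
rewrite gr_proj_proj; have xj := memv_gr_proj (ga_grP A) j x.
have [<-|ji] := eqVneq (- i) j.
  by apply: gr_proj_id; exact: memv_gr_proj.
apply: (@gr_proj_0 _ _ _ (ga_grP (opAlg A)) i (- j)).
  by apply: contraNneq ji => <-; rewrite opprK.
by rewrite /= opprK.
Qed.

(** In A^op the roles of N and P are exchanged: A = B^- P, and the basis of P has
    degrees at most 0. *)
Lemma BN_free_exists : exists D : @free_ext K (opAlg A) (opAlg (algT td)) (BN td) (toT td),
  forall i : 'I_(fr_r D), (fr_n i : A) \in P.
Proof.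
have [N1 T1 P1] := td_1.
apply: (@free_ext_dim K (opAlg A) (opAlg (algT td)) P (BN td) (toT td)) => //.
- by move=> i u uP; rewrite op_ga_pr; case: (tdP_gr td) => _; exact.
- by move=> i u uB; rewrite op_ga_pr; exact: halfT_graded (tdN_gr td) _ _ uB.
- exact: halfT_1 (tdN_gr td).
- by move=> x y xB yB; exact: halfT_M (tdNT td) _ _ yB xB.
- by apply: etrans (op_prodv P (BN td)) _; rewrite -prodvA td_span.
- rewrite mulnC -td_dim mulnA leq_mul2r; apply/orP; right; exact: dim_prodv.
- exact: toT_lin.
- exact: toT_1.
- by move=> x y xB yB; exact: toT_mulN.
- by move=> i x /BN_0; exact: toT_gr.
Qed.

Definition BP_free : free_ext (T := algT td) (BP td) (toT td) := sval (cid BP_free_exists).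
Definition BN_free : @free_ext K (opAlg A) (opAlg (algT td)) (BN td) (toT td) :=
  sval (cid BN_free_exists).

Lemma BP_free_N (i : 'I_(fr_r BP_free)) : fr_n i \in N.
Proof. exact: (svalP (cid BP_free_exists)). Qed.

Lemma BN_free_P (i : 'I_(fr_r BN_free)) : (fr_n i : A) \in P.
Proof. exact: (svalP (cid BN_free_exists)). Qed.

Lemma fr_n_neq0 (A' T' : grAlg K) B q (D : @free_ext K A' T' B q)
  (i : 'I_(fr_r D)) : fr_n i != 0.
Proof.
apply/eqP => n0; have /eqP := fr_bnn i i; rewrite n0 linear0 eqxx eq_sym.
by rewrite oner_eq0.
Qed.

Lemma BP_free_deg (i : 'I_(fr_r BP_free)) : fr_e i <= 0.
Proof.
rewrite leNgt; apply/negP => e0.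
have : fr_n i \in (N :&: ga_gr A (fr_e i))%VS by rewrite memv_cap BP_free_N fr_ndeg.
by rewrite (tdN_deg td e0) memv0 (negPf (fr_n_neq0 i)).
Qed.

Lemma BN_free_deg (i : 'I_(fr_r BN_free)) : fr_e i <= 0.
Proof.
rewrite leNgt; apply/negP => e0.
have nd : (fr_n i : A) \in ga_gr A (- fr_e i) by exact: (fr_ndeg i).
have : (fr_n i : A) \in (P :&: ga_gr A (- fr_e i))%VS by rewrite memv_cap BN_free_P nd.
rewrite tdP_deg ?oppr_lt0 // memv0 => h.
by move: (fr_n_neq0 i); rewrite /= h.
Qed.

Lemma BP_free_deg0 (i : 'I_(fr_r BP_free)) : fr_e i = 0 -> exists k, fr_n i = k *: 1.
Proof.
move=> e0; have : fr_n i \in (N :&: ga_gr A 0)%VS by rewrite memv_cap BP_free_N -e0 fr_ndeg.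
by rewrite (tdN_0 td) => /vlineP.
Qed.

End Triangular.

(** * Highest degree components *)

Definition le_deg (K : fieldType) (A : grAlg K) (d : int) (X : grMod A) : Prop :=
  forall i, d < i -> gm_gr X i = 0%VS.

Definition at_deg (K : fieldType) (A : grAlg K) (d : int) (X : grMod A) : Prop :=
  gm_gr X d = fullv.

Section Degrees.
Variables (K : fieldType) (A : grAlg K).
Implicit Types M N X Y : grMod A.

Lemma gr_zero X i x : gm_gr X i = 0%VS -> x \in gm_gr X i -> x = 0.
Proof. by move=> -> ; rewrite memv0 => /eqP. Qed.

Lemma gr_zero_inj X Y (f : grhom X Y) i : inj f -> gm_gr Y i = 0%VS -> gm_gr X i = 0%VS.
Proof.
move=> fi Y0; apply/eqP; rewrite -subv0; apply/subvP => x /(hom_gr f).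
by move=> /(gr_zero Y0) /fi ->; rewrite mem0v.
Qed.

Lemma gr_surj X Y (f : grhom X Y) i y : surj f -> y \in gm_gr Y i ->
  exists2 x, x \in gm_gr X i & y = f x.
Proof.
move=> fs /(gr_memP (gm_grP Y)) yi; have [x xE] := fs y.
by exists (pr X i x); [exact: memv_gr_proj | rewrite -pr_hom -xE yi].
Qed.

Lemma gr_zero_surj X Y (f : grhom X Y) i : surj f -> gm_gr X i = 0%VS -> gm_gr Y i = 0%VS.
Proof.
move=> fs X0; apply/eqP; rewrite -subv0; apply/subvP => y /(gr_surj fs) [x xi ->].
by rewrite (gr_zero X0 xi) linear0 mem0v.
Qed.

Lemma le_deg_inj X Y (f : grhom X Y) d : inj f -> le_deg d Y -> le_deg d X.
Proof. move=> fi h i /h; exact: (gr_zero_inj fi). Qed.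

Lemma le_deg_surj X Y (f : grhom X Y) d : surj f -> le_deg d X -> le_deg d Y.
Proof. move=> fs h i /h; exact: (gr_zero_surj fs). Qed.

Lemma le_deg_trans d d' X : d <= d' -> le_deg d X -> le_deg d' X.
Proof. by move=> dd h i /(le_lt_trans dd) /h. Qed.

Lemma at_mem d M (m : M) : at_deg d M -> m \in gm_gr M d.
Proof. by move=> ->; exact: memvf. Qed.

Lemma at_pr d M (m : M) : at_deg d M -> pr M d m = m.
Proof. by move=> hM; apply/gr_memP/at_mem. Qed.

Lemma at_0 d M i (m : M) : at_deg d M -> i != d -> m \in gm_gr M i -> m = 0.
Proof. by move=> hM id_ mi; rewrite -(at_pr m hM) (gr_proj_0 _ id_ mi). Qed.

Lemma at_le d M : at_deg d M -> le_deg d M.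
Proof.
move=> hM i di; apply/eqP; rewrite -subv0; apply/subvP => m /(at_0 hM) -> //.
  exact: mem0v.
by rewrite gt_eqF.
Qed.

Lemma at_deg_surj d M N (f : grhom M N) : surj f -> at_deg d M -> at_deg d N.
Proof.
move=> fs hM; apply/vspaceP => y; rewrite memvf; have [x ->] := fs y.
exact/hom_gr/at_mem.
Qed.

Lemma at_deg_inj d M N (f : grhom M N) : inj f -> at_deg d N -> at_deg d M.
Proof.
move=> fi hN; apply/vspaceP => x; rewrite memvf; apply/(gr_memP (gm_grP M)).
by apply: (injP fi); rewrite -pr_hom at_pr.
Qed.

Lemma at_deg_uniq d d' M : at_deg d M -> gm_gr M d' <> 0%VS -> d' = d.
Proof.
move=> hM h; apply/eqP; apply/negP => /negP dd; apply: h; apply/eqP.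
by rewrite -subv0; apply/subvP => x /(at_0 hM dd) ->; rewrite mem0v.
Qed.

Lemma sub_absz (n j : int) : j <= n -> n - (absz (n - j))%:Z = j.
Proof. by move=> jn; rewrite gez0_abs ?subr_ge0 // opprB addrC subrK. Qed.

Lemma top_degree X : ~ gzero X -> exists d, gm_gr X d <> 0%VS /\ le_deg d X.
Proof.
move=> nz; have [n hn] := gr_bound (gm_grP X).
have [i Xi] : exists i, gm_gr X i <> 0%VS.
  apply/not_existsP => h; apply: nz => x; apply: (@gr_eq0 _ _ _ (gm_grP X)) => i.
  have /contrapT Xi := h i; exact: gr_zero Xi (memv_gr_proj _ _ _).
have ni : i <= n by rewrite leNgt; apply/negP => /hn.
have exk : exists k : nat, gm_gr X (n - k%:Z) != 0%VS.
  by exists (absz (n - i)); rewrite sub_absz //; apply/eqP.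
case: (ex_minnP exk) => k /eqP Xk kmin; exists (n - k%:Z); split=> // j kj.
have [nj|jn] := ltP n j; first exact: hn.
apply/eqP/negPn/negP => Xj.
have := kmin (absz (n - j)); rewrite sub_absz // Xj => /(_ isT).
apply/negP; rewrite -ltnNge -ltz_nat gez0_abs ?subr_ge0 //.
by rewrite ltrBlDr addrC -ltrBlDr.
Qed.

(** This is the largest graded submodule without component of degree d; for a
    module generated by a simple component of highest degree d it is the
    radical. *)
Lemma rad_exists d X : exists U : {vspace X}, gsub U /\
  forall x, x \in U <-> forall a, pr X d (a ** x) = 0.
Proof.
have /choice [f fE] := @actl_ex K A X.
have fl : linear (fun x => (pr X d \o f x)%VF).
  move=> k x y; apply/lfunP => a.
  by rewrite add_lfunE scale_lfunE !comp_lfunE !fE !linearP.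
have [g gE] := linfun_ex fl.
have UE x : x \in lker g <-> forall a, pr X d (a ** x) = 0.
  rewrite memv_ker gE; split=> [/eqP e a | h].
    by rewrite -fE -comp_lfunE e zero_lfunE.
  by apply/eqP/lfunP => a; rewrite comp_lfunE fE h zero_lfunE.
exists (lker g); split=> //; split=> [a x /UE h | i x /UE h]; apply/UE.
  by move=> c; rewrite -actM.
apply: (gr_span (ga_grP A)).
- by rewrite act0l linear0.
- by move=> a b ha hb; rewrite actDl linearD /= ha hb addr0.
- move=> j a aj; rewrite -(subrK j d) [d - j + j]addrC (pr_act _ _ aj).
  rewrite gr_proj_proj; case: eqP => [e|_]; last by rewrite actr0.
  by rewrite e -(pr_act _ _ aj) -e addrC subrK h.
Qed.

End Degrees.

(** Induction over a basis of degrees at most 0, the only elements of degree 0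
    being scalars, creates no new element in the highest degree. *)
Section InducedDegrees.
Variables (K : fieldType) (A T : grAlg K) (B : {vspace A}) (q : A -> T).
Variables (D : free_ext B q) (M : grMod T) (X : grMod A) (u : 'Hom(M, X)).
Hypotheses (hu : ind_prop D u) (D_le0 : forall i : 'I_(fr_r D), fr_e i <= 0).

Lemma ind_le d : le_deg d M -> le_deg d X.
Proof.
move=> hM i di; apply/eqP; rewrite -subv0; apply/subvP => x xi; rewrite memv0.
have [c xE] := ip_gen hu x; rewrite xE in xi *; rewrite big1 // => j _.
rewrite (gr_zero (hM _ _) (ip_homog hu xi j)) ?linear0 ?actr0 //.
by apply: (lt_le_trans di); rewrite lerDl oppr_ge0.
Qed.

Lemma ind_top d x : (forall i : 'I_(fr_r D), fr_e i = 0 -> exists k, fr_n i = k *: 1) ->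
  le_deg d M -> x \in gm_gr X d -> exists m, x = u m.
Proof.
move=> D0 hM xd; have [c xE] := ip_gen hu x.
rewrite xE in xd; have cd := ip_homog hu xd.
have /choice [k kE] : forall j, exists k : K, fr_n j ** u (c j) = u (k *: c j).
  move=> j; have [e0|e0] := eqVneq (fr_e j) 0.
    by have [k ->] := D0 j e0; exists k; rewrite actZl act1 linearZ.
  exists 0; rewrite scale0r linear0.
  rewrite (gr_zero (hM _ _) (cd j)) ?linear0 ?actr0 // ltrDl oppr_gt0.
  by rewrite lt_neqAle e0 D_le0.
exists (\sum_j k j *: c j); rewrite xE linear_sum; apply: eq_bigr => j _.
exact: kE.
Qed.

End InducedDegrees.

(** * Modules over the triangular decomposition *)

Section TopComponent.
Variables (K : fieldType) (A : grAlg K) (td : tri_decomp A).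
Notation T := (algT td).
Implicit Types (X Y : grMod A) (M N : grMod T).

Lemma T_deg0 (t : T) : t \in ga_gr T 0.
Proof. by rewrite mem_sub_gr; exact: (td_T0 (subvsP t)). Qed.

(** As T sits in degree 0, every T-module can be placed in degree d. *)
Section AtDegree.
Variables (d : int) (V : vectType K) (act : T -> V -> V).
Hypothesis actP : is_action act.

Definition at_gr (i : int) : {vspace V} := if i == d then fullv else 0%VS.

Lemma at_grP : is_grading at_gr.
Proof.
apply: (@is_grading_proj _ _ _ (fun i => if i == d then \1%VF else 0) [:: d]) => //.
- move=> i v; rewrite /at_gr; case: eqP => _; first exact: memvf.
  by rewrite zero_lfunE mem0v.
- move=> i v; rewrite /at_gr; case: eqP => _; first by rewrite id_lfunE.
  by rewrite memv0 => /eqP ->; rewrite linear0.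
- move=> i j v; have [->|_] := eqVneq i d; last by rewrite zero_lfunE.
  by rewrite /at_gr => /negPf ->; rewrite memv0 => /eqP ->; rewrite linear0.
- by move=> v; rewrite big_seq1 eqxx id_lfunE.
Qed.

Lemma at_grM i j t v : t \in ga_gr T i -> v \in at_gr j -> act t v \in at_gr (i + j).
Proof.
move=> ti; have [[lr ll] _ _] := actP.
have [f fE] := linfun_ex (lr t); have [g gE] := linfun_ex (ll v).
have [->|i0] := eqVneq i 0.
  rewrite add0r /at_gr; case: eqP => _; first by rewrite !memvf.
  by rewrite memv0 => /eqP ->; rewrite -fE linear0 mem0v.
have -> : t = 0.
  by rewrite -(gr_proj_id (ga_grP T) (T_deg0 t)) (gr_proj_0 _ i0 ti).
by rewrite -gE linear0 mem0v.
Qed.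

Definition at_mod : grMod T := GrMod actP at_grP at_grM.

Lemma at_modP : at_deg d at_mod.
Proof. by rewrite /at_deg /= /at_gr eqxx. Qed.

End AtDegree.

End TopComponent.

Section Top.
Variables (K : fieldType) (A : grAlg K) (td : tri_decomp A).
Notation T := (algT td).
Implicit Types (X Y : grMod A) (M N : grMod T).

Lemma mk_hom_at d M N (f : 'Hom(M, N)) : at_deg d M -> at_deg d N ->
  (forall t m, f (t ** m) = t ** f m) ->
  exists g : grhom M N, forall x, g x = f x.
Proof.
move=> hM hN fT; apply: mk_hom => // i m mi.
have [->|id_] := eqVneq i d; first exact: at_mem.
by rewrite (at_0 hM id_ mi) linear0 mem0v.
Qed.

Lemma gsub_at d M (U : {vspace M}) : at_deg d M ->
  (forall t u, u \in U -> t ** u \in U) -> gsub U.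
Proof.
move=> hM UT; split=> // i u uU.
have [->|id_] := eqVneq i d; first by rewrite at_pr.
by rewrite (gr_proj_0 _ _ (at_mem u hM)) ?mem0v // eq_sym.
Qed.

Lemma top_exists d X : exists (M : grMod T) (i : 'Hom(M, X)) (p : 'Hom(X, M)),
  [/\ at_deg d M, inj i, forall x, i (p x) = pr X d x,
      forall m, p (i m) = m & forall t m, i (t ** m) = vsval t ** i m].
Proof.
have [S [i [ii iP]]] := sub_space (gm_gr X d).
have id_ s : i s \in gm_gr X d by apply/iP; exists s.
have iT (z : T * S) : exists s, vsval z.1 ** i z.2 = i s.
  apply/iP; rewrite -[d]add0r; apply: gm_grM => //.
  by have := T_deg0 z.1; rewrite mem_sub_gr.
have /choice [act actE] := iT.
have eq := injP ii.
have actP : is_action (fun (t : T) s => act (t, s)).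
  split; first split.
  - by move=> a k s t /=; apply: eq; rewrite linearP /= -!actE /= linearP /= linearP.
  - move=> s k a b /=; apply: eq; rewrite linearP /= -!actE /=.
    by rewrite actDl actZl.
  - by move=> s /=; apply: eq; rewrite -actE (@algT_1 _ _ td) act1.
  - by move=> a b s /=; apply: eq; rewrite -!actE /= actM.
have [p pE] := @lift_inj _ _ _ _ i (pr X d) ii
  (fun x => (iP _).1 (memv_gr_proj (gm_grP X) d x)).
exists (at_mod d actP), i, p; split=> //.
- exact: at_modP.
- by move=> m; apply: eq; rewrite pE gr_proj_id.
- by move=> t m; rewrite -actE.
Qed.

(** The component X_d as a graded T-module, its inclusion and its projection. *)
Definition top d X : grMod T := sval (cid (top_exists d X)).
Definition topi d X : 'Hom(top d X, X) := sval (cid (svalP (cid (top_exists d X)))).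
Definition topp d X : 'Hom(X, top d X) :=
  sval (cid (svalP (cid (svalP (cid (top_exists d X)))))).

Lemma topP d X : [/\ at_deg d (top d X), inj (topi d X),
  forall x, topi d X (topp d X x) = pr X d x,
  forall m, topp d X (topi d X m) = m
  & forall t m, topi d X (t ** m) = vsval t ** topi d X m].
Proof. exact: (svalP (cid (svalP (cid (svalP (cid (top_exists d X))))))). Qed.

Lemma top_at d X : at_deg d (top d X). Proof. by case: (topP d X). Qed.
Lemma topi_inj d X : injective (topi d X).
Proof. by case: (topP d X) => _ /injP. Qed.
Lemma topiK d X x : topi d X (topp d X x) = pr X d x.
Proof. by case: (topP d X). Qed.
Lemma toppK d X m : topp d X (topi d X m) = m.
Proof. by case: (topP d X). Qed.
Lemma topi_act d X (t : T) m : topi d X (t ** m) = vsval t ** topi d X m.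
Proof. by case: (topP d X). Qed.

Lemma topi_mem d X m : topi d X m \in gm_gr X d.
Proof. by rewrite -[m]toppK topiK memv_gr_proj. Qed.

Lemma topiK_mem d X x : x \in gm_gr X d -> topi d X (topp d X x) = x.
Proof. by move=> xd; rewrite topiK gr_proj_id. Qed.

Lemma topp_0 d X i x : i != d -> x \in gm_gr X i -> topp d X x = 0.
Proof. by move=> id_ xi; apply: topi_inj; rewrite topiK linear0 (gr_proj_0 _ id_ xi). Qed.

Lemma topf_exists d X Y (f : grhom X Y) :
  exists g : grhom (top d X) (top d Y), forall m, topi d Y (g m) = f (topi d X m).
Proof.
have E m : topi d Y ((topp d Y \o f \o topi d X)%VF m) = f (topi d X m).
  by rewrite !comp_lfunE topiK_mem // hom_gr // topi_mem.
have [||t m|g gE] := @mk_hom_at d _ _ (topp d Y \o f \o topi d X)%VF.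
- exact: top_at.
- exact: top_at.
- by apply: topi_inj; rewrite topi_act !E topi_act hom_act.
by exists g => m; rewrite gE E.
Qed.

Definition topf d X Y (f : grhom X Y) : grhom (top d X) (top d Y) :=
  sval (cid (topf_exists d f)).

Lemma topfE d X Y (f : grhom X Y) m : topi d Y (topf d f m) = f (topi d X m).
Proof. exact: (svalP (cid (topf_exists d f))). Qed.

Lemma topf1 d X : topf d (grhom_id X) = grhom_id (top d X).
Proof. by apply: hom_ext => m; apply: topi_inj; rewrite topfE !hom1E. Qed.

Lemma topfM d X Y Z (g : grhom Y Z) (f : grhom X Y) :
  topf d (grhom_comp g f) = grhom_comp (topf d g) (topf d f).
Proof. by apply: hom_ext => m; apply: topi_inj; rewrite topfE !homE !topfE. Qed.

(** If X has degrees at most d, the positive part of B^+ kills X_d, and the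
    negative part of B^- maps X to degrees below d. So X_d -> X is B^+ -linear and
    X -> X_d is B^- -linear, B^+ and B^- acting on X_d through T. *)
Lemma BP_top d X b m : le_deg d X -> b \in BP td ->
  b ** topi d X m = topi d X (toT td b ** m).
Proof.
move=> hX bB; rewrite topi_act toTE; last exact: BP_0.
have [s us es] := gr_projE (ga_grP A).
have x : ga_pr A 0 b = \sum_(i <- s) ga_pr A 0 (ga_pr A i b).
  by rewrite {1}(es b) linear_sum.
rewrite {1}(es b) x !actl_sum; apply: eq_bigr => i _; rewrite gr_proj_proj.
have [<-//|i0] := eqVneq 0 i; rewrite act0l.
have [ip|im] := ltP 0 i; last first.
  by rewrite (BP_vanish bB) ?act0l // lt_neqAle eq_sym i0.
apply: (gr_zero (hX (i + d) _)); first by rewrite ltrDr.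
by rewrite gm_grM ?memv_gr_proj ?topi_mem.
Qed.

Lemma BN_top d X b x : le_deg d X -> b \in BN td ->
  topp d X (b ** x) = toT td b ** topp d X x.
Proof.
move=> hX bB; apply: topi_inj; rewrite topi_act toTE; last exact: BN_0.
rewrite !topiK.
have [s us es] := gr_projE (ga_grP A).
have z : ga_pr A 0 b = \sum_(i <- s) ga_pr A 0 (ga_pr A i b).
  by rewrite {1}(es b) linear_sum.
rewrite {1}(es b) z !actl_sum linear_sum; apply: eq_bigr => i _ /=.
rewrite gr_proj_proj.
have bi := memv_gr_proj (ga_grP A) i b.
have := pr_act (d - i) x bi; rewrite addrC subrK => ->.
have [<-|i0] := eqVneq 0 i; first by rewrite subr0.
rewrite act0l.
have [ip|im] := ltP 0 i; first by rewrite (BN_vanish bB) ?act0l.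
have -> : pr X (d - i) x = 0; last by rewrite actr0.
apply: (gr_zero (hX (d - i) _) (memv_gr_proj _ _ _)).
by rewrite ltrDl oppr_gt0 lt_neqAle eq_sym i0.
Qed.

(** ** Standard modules *)

Definition Delta_unit M : 'Hom(M, (Delta_bar td M : grMod A)) := ind_unit (BP_free td) M.
Lemma Delta_unitP M : ind_prop (BP_free td) (Delta_unit M). Proof. exact: ind_unitP. Qed.

Lemma Delta_univ d M X (h : grhom M (top d X)) : at_deg d M -> le_deg d X ->
  exists g : grhom (Delta_bar td M) X, forall m, g (Delta_unit M m) = topi d X (h m).
Proof.
move=> hM hX; have [x m xB|i m mi|g gE] :=
    @ip_lift _ _ _ _ _ (BP_free td) M (Delta_bar td M) (Delta_unit M) (Delta_unitP M) X (topi d X \o h)%VF.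
- by rewrite !comp_lfunE BP_top // hom_act.
- rewrite comp_lfunE; have [->|id_] := eqVneq i d; first exact: topi_mem.
  by rewrite (at_0 hM id_ mi) !linear0 mem0v.
by exists g => m; rewrite gE comp_lfunE.
Qed.

Lemma Delta_ext M X (g h : grhom (Delta_bar td M) X) :
  (forall m, g (Delta_unit M m) = h (Delta_unit M m)) -> g = h.
Proof. move=> e; exact (ip_ext (Delta_unitP M) e). Qed.

Lemma Delta_le d M : at_deg d M -> le_deg d (Delta_bar td M : grMod A).
Proof. by move=> /at_le; apply: ind_le (Delta_unitP M) _ _; exact: BP_free_deg. Qed.

Lemma Delta_top d M x : at_deg d M -> x \in gm_gr (Delta_bar td M : grMod A) d ->
  exists m, x = Delta_unit M m.
Proof.
move=> /at_le; apply: (ind_top (Delta_unitP M)); [exact: BP_free_deg | exact: BP_free_deg0].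
Qed.

(** Only the scalars in N have degree 0, hence Delta-bar(M)_d = M. *)
Lemma Delta_topu d M : at_deg d M ->
  exists g : grhom M (top d (Delta_bar td M)),
    [/\ inj g, surj g & forall m, topi d _ (g m) = Delta_unit M m].
Proof.
move=> hM; have um m : Delta_unit M m \in gm_gr (Delta_bar td M : grMod A) d.
  exact: (ip_gr (Delta_unitP M)) (at_mem m hM).
have E m : topi d _ ((topp d _ \o Delta_unit M)%VF m) = Delta_unit M m.
  by rewrite comp_lfunE topiK_mem.
have [|t m|g gE] := @mk_hom_at d _ _ (topp d _ \o Delta_unit M)%VF hM.
- exact: top_at.
- apply: topi_inj; rewrite E topi_act E.
  have tB : vsval t \in BP td.
    rewrite td_BP -[vsval t]mulr1 memv_mul ?subvsP //; by case: (td_1 td).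
  by rewrite (ip_B (Delta_unitP M)) // toT_id.
have gE' m : topi d _ (g m) = Delta_unit M m by rewrite gE E.
exists g; split=> // [m gm | y].
  by apply: (ip_inj (Delta_unitP M)); rewrite -gE' gm linear0.
have [m mE] := Delta_top hM (topi_mem y).
by exists m; apply: topi_inj; rewrite gE'.
Qed.

Lemma Delta_map_exists M N (f : grhom M N) :
  exists g : grhom (Delta_bar td M) (Delta_bar td N), forall m, g (Delta_unit M m) = Delta_unit N (f m).
Proof. exact (ip_map (Delta_unitP M) (Delta_unitP N) f). Qed.

Definition Delta_map M N (f : grhom M N) : grhom (Delta_bar td M) (Delta_bar td N) :=
  sval (cid (Delta_map_exists f)).

Lemma Delta_mapE M N (f : grhom M N) m : Delta_map f (Delta_unit M m) = Delta_unit N (f m).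
Proof. exact: (svalP (cid (Delta_map_exists f))). Qed.

Lemma Delta_map1 M : Delta_map (grhom_id M) = grhom_id _.
Proof. by apply: Delta_ext => m; rewrite Delta_mapE !hom1E. Qed.

Lemma Delta_mapM M N P (g : grhom N P) (f : grhom M N) :
  Delta_map (grhom_comp g f) = grhom_comp (Delta_map g) (Delta_map f).
Proof. by apply: Delta_ext => m; rewrite homE !Delta_mapE homE. Qed.

Lemma Delta_map_exact M N P (f : grhom M N) (g : grhom N P) :
  gexact f g -> gexact (Delta_map f) (Delta_map g).
Proof.
exact (ip_map_exact (Delta_unitP M) (Delta_unitP N) (Delta_unitP P) (Delta_mapE f) (Delta_mapE g)).
Qed.

Lemma Delta_map_surj M N (f : grhom M N) : surj f -> surj (Delta_map f).
Proof. move=> fs; exact (ip_map_surj (Delta_unitP N) (Delta_mapE f) fs). Qed.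

Lemma Delta_map_inj M N (f : grhom M N) : inj f -> inj (Delta_map f).
Proof. move=> fi; exact (ip_map_inj (Delta_unitP M) (Delta_unitP N) (Delta_mapE f) fi). Qed.

Lemma Delta_counit d X : le_deg d X ->
  exists c : grhom (Delta_bar td (top d X)) X, forall m, c (Delta_unit _ m) = topi d X m.
Proof.
move=> hX; have [g gE] := Delta_univ (grhom_id _) (top_at d X) hX.
by exists g => m; rewrite gE hom1E.
Qed.

(** ** Costandard modules *)

Definition nabla_counit M : 'Hom((nabla_bar td M : grMod A), M) := coind_counit (BN_free td) M.
Lemma nabla_counitP M : coind_prop (BN_free td) (nabla_counit M). Proof. exact: coind_counitP. Qed.

Lemma nabla_univ d M X (h : grhom (top d X) M) : at_deg d M -> le_deg d X ->
  exists g : grhom X (nabla_bar td M), forall x, nabla_counit M (g x) = h (topp d X x).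
Proof.
move=> hM hX; have [x m xB|i m mi|g gE] :=
    @cp_lift _ _ _ _ _ (BN_free td) M (nabla_bar td M) (nabla_counit M) (nabla_counitP M) X (h \o topp d X)%VF.
- by rewrite !comp_lfunE /coact BN_top // hom_act.
- rewrite comp_lfunE; have [->|id_] := eqVneq i d; first exact: at_mem.
  by rewrite (topp_0 id_ mi) !linear0 mem0v.
by exists g => m; rewrite gE comp_lfunE.
Qed.

Lemma nabla_ext d M X (g h : grhom X (nabla_bar td M)) : at_deg d M ->
  (forall m, nabla_counit M (g (topi d X m)) = nabla_counit M (h (topi d X m))) -> g = h.
Proof.
move=> hM gh; apply: (cp_ext (nabla_counitP M)) => x.
rewrite -(at_pr (nabla_counit M (g x)) hM) -(at_pr (nabla_counit M (h x)) hM) !(cp_pr (nabla_counitP M)).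
by rewrite !pr_hom -topiK.
Qed.

Lemma nabla_le d M : at_deg d M -> le_deg d (nabla_bar td M : grMod A).
Proof.
move=> hM i di; apply/eqP; rewrite -subv0; apply/subvP => y yi.
rewrite memv0; apply/eqP/(cp_sep (nabla_counitP M)) => j.
have nd : (fr_n j : A) \in ga_gr A (- fr_e j) by exact: (fr_ndeg j).
have := cp_gr (nabla_counitP M) (gm_grM nd yi); apply: (at_0 hM).
by rewrite gt_eqF // (lt_le_trans di) // lerDr oppr_ge0; exact: BN_free_deg.
Qed.

Lemma nabla_map_exists M N (f : grhom M N) :
  exists g : grhom (nabla_bar td M) (nabla_bar td N), forall x, nabla_counit N (g x) = f (nabla_counit M x).
Proof. exact (cp_map (nabla_counitP M) (nabla_counitP N) f). Qed.

Definition nabla_map M N (f : grhom M N) : grhom (nabla_bar td M) (nabla_bar td N) :=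
  sval (cid (nabla_map_exists f)).

Lemma nabla_mapE M N (f : grhom M N) x : nabla_counit N (nabla_map f x) = f (nabla_counit M x).
Proof. exact: (svalP (cid (nabla_map_exists f))). Qed.

Lemma nabla_cp_ext M X (g h : grhom X (nabla_bar td M)) :
  (forall x, nabla_counit M (g x) = nabla_counit M (h x)) -> g = h.
Proof. move=> e; exact (cp_ext (nabla_counitP M) e). Qed.

Lemma nabla_map1 M : nabla_map (grhom_id M) = grhom_id _.
Proof. by apply: nabla_cp_ext => m; rewrite nabla_mapE !hom1E. Qed.

Lemma nabla_mapM M N P (g : grhom N P) (f : grhom M N) :
  nabla_map (grhom_comp g f) = grhom_comp (nabla_map g) (nabla_map f).
Proof. by apply: nabla_cp_ext => m; rewrite homE !nabla_mapE homE. Qed.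

Lemma nabla_map_exact M N P (f : grhom M N) (g : grhom N P) :
  gexact f g -> gexact (nabla_map f) (nabla_map g).
Proof.
exact (cp_map_exact (nabla_counitP M) (nabla_counitP N) (nabla_counitP P) (nabla_mapE f) (nabla_mapE g)).
Qed.

Lemma nabla_map_surj M N (f : grhom M N) : surj f -> surj (nabla_map f).
Proof. move=> fs; exact (cp_map_surj (nabla_counitP M) (nabla_counitP N) (nabla_mapE f) fs). Qed.

(** Together with [nabla_univ] this is the adjunction between X |-> X_d and
    nabla-bar on modules of degrees at most d. *)
Lemma nabla_transpose d M X (f : grhom X (nabla_bar td M)) : at_deg d M ->
  exists h : grhom (top d X) M, forall m, h m = nabla_counit M (f (topi d X m)).
Proof.
move=> hM; pose h0 := (nabla_counit M \o (f : 'Hom(_, _)) \o topi d X)%VF.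
have h0E m : h0 m = nabla_counit M (f (topi d X m)) by rewrite !comp_lfunE.
have [|t m|h hE] := @mk_hom_at d _ _ h0 _ hM; first exact: top_at.
  rewrite !h0E topi_act hom_act.
  have tB : vsval t \in BN td.
    by rewrite -[vsval t]mul1r memv_mul ?subvsP //; case: (td_1 td).
  by have := cp_B (nabla_counitP M) (f (topi d X m)) tB; rewrite toT_id.
by exists h => m; rewrite hE h0E.
Qed.

End Top.

(** * Simple modules *)

Section HighestWeight.
Variables (K : fieldType) (A : grAlg K) (td : tri_decomp A).
Notation T := (algT td).
Implicit Types (X Y H : grMod A) (M N : grMod T).

(** Highest weight modules. Both Delta-bar(l) and the simple modules are of this
    kind, which is what makes them correspond. *)
Record hw (d : int) (X : grMod A) : Prop := Hw {
  hw_le : le_deg d X;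
  hw_top : gsimple (top td d X);
  hw_gen : forall U : {vspace X}, gsub U ->
    (forall m, topi td d X m \in U) -> U = fullv }.

(** A submodule containing a nonzero element of degree d contains all of X_d, as
    X_d is simple over T, and is then everything. *)
Lemma hw_proper d X (U : {vspace X}) : hw d X -> gsub U -> U <> fullv ->
  forall x, x \in U -> forall a, pr X d (a ** x) = 0.
Proof.
move=> [hX [_ hT] hg] hU Uf x xU a.
pose V := (topi td d X @^-1: U)%VS.
have VE m : (m \in V) = (topi td d X m \in U) by rewrite memv_preim.
have [|V0|Vf] := hT V.
- apply: (gsub_at (top_at td d X)) => t u; rewrite !VE topi_act; exact: hU.1.
- have : topp td d X (a ** x) \in V by rewrite VE topiK; apply/hU.2/hU.1.
  by rewrite V0 memv0 => /eqP e; rewrite -(topiK td) e linear0.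
- by case: Uf; apply: (hg U hU) => m; rewrite -VE Vf memvf.
Qed.

Lemma hw_rad_proper d X (U : {vspace X}) : hw d X ->
  (forall x, x \in U <-> forall a, pr X d (a ** x) = 0) -> U <> fullv.
Proof.
move=> [_ [nz _] _] UE Uf; apply: nz => m; apply: topi_inj; rewrite linear0.
have /UE /(_ 1) : topi td d X m \in U by rewrite Uf memvf.
by rewrite act1 gr_proj_id ?topi_mem.
Qed.

(** By [hw_proper] every proper submodule lies in the radical. *)
Lemma hw_maximal d X (U : {vspace X}) (N : GMod A) (m : grhom N X) : hw d X ->
  gsub U -> (forall x, x \in U <-> forall a, pr X d (a ** x) = 0) ->
  (@maximal_sub (GMod A) N X m <-> inj m /\ forall x, x \in U <-> exists y, x = m y).
Proof.
move=> hX hU UE; have Uf := hw_rad_proper hX UE.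
have [R [r [ri rP]]] := sub_mod hU.
have sub (N' : grMod A) (n : grhom N' X) : ~ surj n -> forall y, n y \in U.
  move=> nsurj y; apply/UE; apply: (hw_proper hX (gsub_img n)).
    by move/surj_limg.
  by rewrite memv_img ?memvf.
split=> [[/gmonoP mi niso mx]|[mi mE]].
  split=> // x.
  have mU y : m y \in U.
    by apply: sub => ms; apply: niso; apply/gisoP.
  have [w|h hE] := @glift_inj K A R X N r m ri; first by apply/rP.
  have [|/gisoP [_ hs]|/gisoP [_ rs]] := mx R r h ((gmonoP r).2 ri).
  - by apply: hom_ext => y; rewrite homE hE.
  - split=> [/rP [s ->]|[y ->] //]; have [y ->] := hs s; exists y; exact: hE.
  - case: Uf; apply/vspaceP => y; rewrite memvf; apply/rP; exact: rs.
split; first exact/gmonoP.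
  move=> /gisoP [_ ms]; apply: Uf; apply/vspaceP => y; rewrite memvf.
  by apply/mE; have [z ->] := ms y; exists z.
move=> N' n h /gmonoP ni nh.
have nhE y : (n : grhom N' X) ((h : grhom N N') y) = m y by exact: (gcompE nh y).
have [ns|ns] := pselect (surj (n : grhom N' X)); [right | left]; apply/gisoP; split=> //.
  by move=> y hy; apply: mi; rewrite -nhE hy linear0.
move=> y; have /mE [z zE] := sub _ _ ns y; exists z; apply: (injP ni).
by rewrite nhE.
Qed.

Lemma hw_head_exists d X : hw d X -> exists H : GMod A, @is_head (GMod A) X H.
Proof.
move=> hX; have [U [hU UE]] := rad_exists d X.
have [H [q [qs qU]]] := quot_mod hU; exists H, q; split; first exact/gepiP.
move=> W g; split=> [/gzero_morP gq N m /(hw_maximal _ hX hU UE) [mi mE] | h].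
  have [w|k kE] := @glift_inj _ _ _ _ _ (m : grhom N X) (g : grhom W X) mi.
    by apply/mE/qU; rewrite -homE gq.
  by exists k; apply: hom_ext => w; rewrite homE kE.
apply/gzero_morP => w; rewrite homE; apply/qU.
have [R [r [ri rP]]] := sub_mod hU.
have [k kE] := h R r ((hw_maximal r hX hU UE).2 (conj ri rP)).
by apply/rP; exists ((k : grhom W R) w); rewrite (gcompE kE).
Qed.

(** Heads are given only up to isomorphism, so the kernel of X -> H has to be
    recovered from the property of H, tested on two inclusions: that of the
    kernel and that of the radical. *)
Lemma hw_headP d X (H : GMod A) : hw d X -> @is_head (GMod A) X H ->
  exists q : grhom X H, surj q /\
    forall x, q x = 0 <-> forall a, pr X d (a ** x) = 0.
Proof.
move=> hX [q [/gepiP qs qP]]; have [U [hU UE]] := rad_exists d X.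
exists q; split=> // x; rewrite -UE.
have [R [r [ri rP]]] := sub_mod hU.
split=> [qx|/rP [s ->]].
  have [S [k [ki kP]]] := ker_mod (q : grhom X H).
  have [|l lE] := (qP S k).1 _ R r ((hw_maximal r hX hU UE).2 (conj ri rP)).
    by apply/gzero_morP => s; rewrite homE; apply/kP; exists s.
  by have /kP [s ->] := qx; apply/rP; exists ((l : grhom S R) s); rewrite (gcompE lE).
have /gzero_morP : @zero_mor (GMod A) _ _ (@comp (GMod A) _ _ _ q r).
  apply/qP => N m /(hw_maximal _ hX hU UE) [mi mE].
  have [w|h hE] := @glift_inj _ _ _ _ _ (m : grhom N X) r mi.
    by apply/mE/rP; exists w.
  by exists h; apply: hom_ext => w; rewrite homE hE.
by move=> /(_ s); rewrite homE.
Qed.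

Lemma hw_quot_simple d X H (q : grhom X H) : hw d X -> surj q ->
  (forall x, q x = 0 <-> forall a, pr X d (a ** x) = 0) -> gsimple H.
Proof.
move=> hX qs qP; have [U [hU UE]] := rad_exists d X; split.
  move=> H0; apply: (hw_rad_proper hX UE); apply/vspaceP => x.
  by rewrite memvf; apply/UE/qP; exact: H0.
move=> W hW; pose V := ((q : 'Hom(X, H)) @^-1: W)%VS.
have VE x : (x \in V) = (q x \in W) by rewrite memv_preim.
have hV : gsub V.
  split=> [a x|i x]; rewrite !VE; first by rewrite hom_act; exact: hW.1.
  by rewrite -pr_hom; exact: hW.2.
have [Vf|Vf] := pselect (V = fullv); [right | left].
  by apply/vspaceP => y; have [x ->] := qs y; rewrite memvf -VE Vf memvf.
apply/eqP; rewrite -subv0; apply/subvP => y; have [x ->] := qs y.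
by rewrite -VE => /(hw_proper hX hV Vf) /qP ->; rewrite mem0v.
Qed.

Lemma hw_quot_inj d X H (q : grhom X H) :
  (forall x, q x = 0 <-> forall a, pr X d (a ** x) = 0) ->
  forall m, q (topi td d X m) = 0 -> m = 0.
Proof.
move=> qP m /qP /(_ 1); rewrite act1 gr_proj_id ?topi_mem // => e.
by apply: topi_inj; rewrite e linear0.
Qed.

(** A T-submodule S of X_d generates the image of Delta-bar(S) -> X, whose
    component of degree d is S again; so S is zero or X_d. *)
Lemma hw_simple d X : gsimple X -> gm_gr X d <> 0%VS -> le_deg d X -> hw d X.
Proof.
move=> sX Xd hX; split=> //.
  split=> [t0|V hV].
    apply: Xd; apply/eqP; rewrite -subv0; apply/subvP => x /(topiK_mem td) <-.
    by rewrite (t0 (topp td d X x)) linear0 mem0v.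
  have [S [i [ii iP]]] := sub_mod hV.
  have hS : at_deg d S by exact: at_deg_inj ii (top_at td d X).
  have [g gE] := Delta_univ i hS hX.
  have [S0|nz] := pselect (gzero S); [left|right].
    apply/eqP; rewrite -subv0; apply/subvP => m /iP [s ->].
    by rewrite (S0 s) linear0 mem0v.
  have gs : surj g.
    apply: (simple_surj sX); apply/not_existsP => g0; apply: nz => s.
    apply: ii; apply: topi_inj; rewrite linear0 -gE; apply/eqP/negP => /negP/eqP.
    exact: g0.
  apply/vspaceP => m; rewrite memvf; apply/iP.
  have [y yd mE] := gr_surj gs (topi_mem m).
  have [s sE] := Delta_top hS yd.
  by exists s; apply: topi_inj; rewrite mE sE gE.
move=> U hU tU; have [U0|//] := sX.2 U hU; case: Xd.
apply/eqP; rewrite -subv0; apply/subvP => x /(topiK_mem td) <-.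
by rewrite -U0.
Qed.

Lemma simple_hw X : gsimple X -> exists d, hw d X.
Proof.
move=> sX; have [d [Xd hX]] := top_degree sX.1; exists d; exact: hw_simple.
Qed.

Lemma Delta_hw d M : at_deg d M -> gsimple M -> hw d (Delta_bar td M : grMod A).
Proof.
move=> hM sM; have [g [gi gs gE]] := Delta_topu hM; split.
- exact: Delta_le.
- exact: gsimple_isom gi gs sM.
- move=> U hU tU; apply/vspaceP => x; rewrite memvf.
  have [c ->] := ip_gen (Delta_unitP M) x; apply: memv_suml => i _; apply: hU.1.
  by rewrite -gE.
Qed.

(** ** The simple module L(l) *)

Lemma irr_simple (l : IrrT td) : gsimple (irr_rep l : GMod T).
Proof. by apply/gsimpleP; rewrite /irr_rep; case: (cid _) => X []. Qed.

Lemma irr_class (l : IrrT td) : sval l = @isom (GMod T) (irr_rep l).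
Proof. by rewrite /irr_rep; case: (cid _) => X []. Qed.

Lemma irr_eq (l m : IrrT td) : @isom (GMod T) (irr_rep l) (irr_rep m) -> l = m.
Proof.
move=> h; suff: sval l = sval m by case: l m {h} => [c cP] [c' cP'] /=; exact: eq_exist.
rewrite !irr_class; apply/funext => X; apply/propext.
by split=> k; [apply: isom_trans (isom_sym h) k | apply: isom_trans h k].
Qed.

Lemma irr_of M : gsimple M -> exists l : IrrT td, @isom (GMod T) (irr_rep l) M.
Proof.
move=> sM; have h : exists X : GMod T, is_simple X /\ @isom (GMod T) M = isom X.
  by exists M; split=> //; exact/gsimpleP.
pose l : IrrT td := exist _ (@isom (GMod T) M) h; exists l.
suff : sval l M by rewrite irr_class.
exact: isom_refl.
Qed.

Lemma T_component_gsub M i : gsub (gm_gr M i).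
Proof.
split=> [t u ui | j u ui].
  by rewrite -[i]add0r; apply: gm_grM ui; exact: T_deg0.
have [->|ji] := eqVneq j i; first by rewrite gr_proj_id.
by rewrite (gr_proj_0 _ _ ui) ?mem0v // eq_sym.
Qed.

Lemma T_simple_at M : gsimple M -> exists d, at_deg d M.
Proof.
move=> [nz h]; have [d [Md _]] := top_degree nz; exists d.
by have [] := h _ (T_component_gsub M d).
Qed.

Lemma degT_at (l : IrrT td) : at_deg (degT td l) (irr_rep l : GMod T).
Proof.
have sl := irr_simple l; have [d hd] := T_simple_at sl.
have P0 : exists i, [set i | gm_gr (irr_rep l : GMod T) i != 0%VS]%classic i.
  exists d; apply/eqP; rewrite hd => /esym /gzero_full; exact: sl.1.
by have /eqP /(at_deg_uniq hd) := xgetPex 0 P0; rewrite /degT => ->.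
Qed.

Lemma degT_eq (l : IrrT td) d : at_deg d (irr_rep l : GMod T) -> degT td l = d.
Proof.
move=> hd; apply: (at_deg_uniq hd); rewrite (degT_at l) => /esym /gzero_full.
exact: (irr_simple l).1.
Qed.

Definition DeltaL (l : IrrT td) : grMod A := Delta_bar td (irr_rep l).

Lemma DeltaL_hw l : hw (degT td l) (DeltaL l).
Proof. exact: Delta_hw (degT_at l) (irr_simple l). Qed.

Lemma simple_L_head l : @is_head (GMod A) (DeltaL l) (simple_L td l).
Proof. exact: (@pick_obP (GMod A)) (hw_head_exists (DeltaL_hw l)). Qed.

Lemma simple_LP l : exists q : grhom (DeltaL l) (simple_L td l), surj q /\
  forall x, q x = 0 <-> forall a, pr (DeltaL l) (degT td l) (a ** x) = 0.
Proof. exact: hw_headP (DeltaL_hw l) (simple_L_head l). Qed.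

Lemma simple_L_simple l : gsimple (simple_L td l : grMod A).
Proof. by have [q [qs qP]] := simple_LP l; exact: hw_quot_simple (DeltaL_hw l) qs qP. Qed.

Lemma simple_L_le l : le_deg (degT td l) (simple_L td l : grMod A).
Proof. by have [q [qs _]] := simple_LP l; exact: le_deg_surj qs (hw_le (DeltaL_hw l)). Qed.

(** The radical of Delta-bar(l) misses the highest component, which therefore
    survives in the head. *)
Lemma simple_L_top l : exists f : grhom (irr_rep l : GMod T) (top td (degT td l) (simple_L td l)),
  inj f /\ surj f.
Proof.
have [q [qs qP]] := simple_LP l; have [g [gi gs gE]] := Delta_topu (degT_at l).
have fi : inj (grhom_comp (topf td (degT td l) q) g).
  move=> m; rewrite homE => e; apply: gi; apply: (hw_quot_inj qP).
  by rewrite -topfE e linear0.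
exists (grhom_comp (topf td (degT td l) q) g); split=> // y.
have [x xd yE] := gr_surj qs (topi_mem y).
have [m mE] := gs (topp td (degT td l) _ x); exists m.
by apply: topi_inj; rewrite homE topfE -mE topiK_mem.
Qed.

Lemma simple_L_nz l : gm_gr (simple_L td l : grMod A) (degT td l) <> 0%VS.
Proof.
move=> e; have [f [fi _]] := simple_L_top l; apply: (irr_simple l).1 => x.
by apply: fi; apply: topi_inj; rewrite linear0; apply: (gr_zero e); exact: topi_mem.
Qed.

Lemma topf_iso d X Y (f : grhom X Y) : inj f -> surj f ->
  inj (topf td d f) /\ surj (topf td d f).
Proof.
move=> fi fs; split=> [m e | y].
  by apply: topi_inj; rewrite linear0; apply: fi; rewrite -topfE e linear0.
have [x xd yE] := gr_surj fs (topi_mem y).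
by exists (topp td d X x); apply: topi_inj; rewrite topfE topiK_mem.
Qed.

Lemma simple_L_inj l m : @isom (GMod A) (simple_L td l) (simple_L td m) -> l = m.
Proof.
move=> /gisomP [f [fi fs]].
have e : degT td l = degT td m.
  apply/eqP; rewrite eq_le; apply/andP; split; rewrite leNgt; apply/negP => h.
    by apply: (@simple_L_nz l); exact: gr_zero_inj fi (simple_L_le h).
  by apply: (@simple_L_nz m); exact: gr_zero_surj fs (simple_L_le h).
have [tfi tfs] := topf_iso (degT td l) fi fs.
have [g [gi gs]] := simple_L_top l; have [h [hi hs]] := simple_L_top m.
apply: irr_eq; apply: isom_trans (_ : isom _ (top td (degT td l) (simple_L td m) : GMod T)) _.
  apply: isom_trans (_ : isom _ (top td (degT td l) (simple_L td l) : GMod T)) _.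
    by apply/gisomP; exists g.
  by apply/gisomP; exists (topf td (degT td l) f).
by apply: isom_sym; rewrite e; apply/gisomP; exists h.
Qed.

(** If l is the highest component of X, the map Delta-bar(l) -> X is onto with
    kernel the radical, as is Delta-bar(l) -> L(l). *)
Lemma simple_classify X : gsimple X ->
  exists l, @isom (GMod A) X (simple_L td l) /\ hw (degT td l) X.
Proof.
move=> sX; have [d hX] := simple_hw sX.
have [l lE] := irr_of (hw_top hX).
have /gisomP [f [fi fs]] := lE.
have hl : at_deg d (irr_rep l : GMod T) by exact: at_deg_inj fi (top_at td d X).
have ed := degT_eq hl; exists l; rewrite ed; split=> //.
have [g gE] := Delta_univ f hl (hw_le hX).
have gs : surj g.
  apply: (simple_surj sX); apply/not_existsP => g0; apply: (irr_simple l).1 => m.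
  apply: fi; apply: topi_inj; rewrite linear0 -gE; apply: contrapT; exact: g0.
have [q [qs qP]] := simple_LP l; rewrite ed in qP.
have gq x : g x = 0 <-> q x = 0.
  rewrite qP; split=> [gx a|h].
    apply: (hw_proper _ (gsub_ker g)); last by rewrite memv_ker gx.
      by rewrite -ed; exact: DeltaL_hw.
    move=> kf; apply: sX.1 => y; have [z ->] := gs y.
    by apply/eqP; rewrite -memv_ker kf memvf.
  have [U [hU UE]] := rad_exists d X.
  have [U0|Uf] := sX.2 U hU; last by case: (hw_rad_proper hX UE).
  apply/eqP; rewrite -memv0 -U0; apply/UE => a.
  by rewrite -hom_act pr_hom h linear0.
have [x|h hE] := gfact_surj (p := g) (f := q) gs; first by move/gq.
apply/gisomP; exists h; split=> [y | y].
  by have [x ->] := gs y; rewrite hE => /gq.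
by have [x ->] := qs y; exists (g x); rewrite hE.
Qed.

(** The highest component is simple over the split algebra T, so f is a scalar c
    there; then f - c is not injective, hence zero. *)
Lemma abs_simple : simples_absolutely_simple (GMod A).
Proof.
move=> X /gsimpleP sX f; have [d hX] := simple_hw sX.
have sT := hw_top hX.
have [||c cE] := tdT_split (gm_actP (top td d (X : grMod A))) _ (f := topf td d f).
- split; first by apply/eqP => /esym /gzero_full; exact: sT.1.
  move=> U hU; apply: sT.2; exact: (gsub_at (top_at td d X)).
- by move=> a v; exact: hom_act.
exists c; apply/eqP; rewrite -subr_eq0; apply/eqP.
pose g : grhom (X : grMod A) X := (f : grhom X X) - c *: grhom_id X.
have gE x : g x = (f : grhom X X) x - c *: x.
  by rewrite /g /= add_lfunE opp_lfunE scale_lfunE id_lfunE.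
have cm m : topf td d (f : grhom X X) m = c *: m.
  by have /lfunP /(_ m) := cE; rewrite scale_lfunE id_lfunE.
have gt m : g (topi td d X m) = 0 by rewrite gE -topfE cm linearZ /= subrr.
have [[x gx]|h] := pselect (exists x, g x <> 0); last first.
  by apply: hom_ext => x; rewrite hom0E; apply: contrapT => gx; apply: h; exists x.
have gi : inj g by apply: (simple_inj sX); exists x.
by case: sT.1 => m; apply: topi_inj; rewrite linear0; exact/gi/gt.
Qed.

(** ** Finitely many simple T-modules in each degree *)

(** The simple quotients of Y are among its composition factors. *)
Lemma finite_quotients (Y : GMod T) : finite_length Y ->
  exists (n : nat) (f : 'I_n -> IrrT td), forall l,
    (exists p : grhom Y (irr_rep l : GMod T), surj p) -> exists i, l = f i.
Proof.
elim=> [X /gzeroP X0 | X Y' S f g _ [n [F FP]] sS /gsesP [fi gs fg]].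
  have F : 'I_0 -> IrrT td by case.
  exists 0, F.
  move=> l [p ps]; case: (irr_simple l).1 => y; have [x ->] := ps y.
  by rewrite (X0 x) linear0.
have [s sE] := irr_of ((gsimpleP S).1 sS).
exists n.+1, (fun i => oapp F s (unlift ord0 i)) => l [p ps].
have [e|ne] := pselect (exists x, (grhom_comp p (f : grhom X Y')) x <> 0).
  have [i ->] : exists i, l = F i.
    by apply: FP; exists (grhom_comp p f); exact: simple_surj (irr_simple l) e.
  by exists (lift ord0 i); rewrite liftK.
exists ord0; rewrite unlift_none /=; apply: irr_eq.
have [x|h hE] := gfact_surj (p := (g : grhom Y' S)) (f := p) gs.
  move=> /fg [y ->]; apply: contrapT => h; apply: ne; exists y; by rewrite homE.
have hs : surj h by move=> y; have [x ->] := ps y; exists ((g : grhom Y' S) x); rewrite hE.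
have hi : inj h.
  apply: (simple_inj ((gsimpleP S).1 sS)); apply/not_existsP => h0.
  apply: (irr_simple l).1 => y; have [x ->] := hs y; apply: contrapT; exact: h0.
by apply: isom_trans (_ : isom _ S) (isom_sym sE); apply/isom_sym/gisomP; exists h.
Qed.

(** A simple T-module in degree d is a quotient of T placed in degree d. *)
Lemma finite_fibres d : exists (n : nat) (f : 'I_n -> IrrT td),
  forall l, degT td l = d -> exists i, l = f i.
Proof.
pose R : GMod T := at_mod d (regular_actP T).
have [n [f fP]] := finite_quotients (gmod_finite_length R).
exists n, f => l ld; apply: fP.
have sl := irr_simple l; have hl := degT_at l; rewrite ld in hl.
have [v v0] : exists v : (irr_rep l : GMod T), v <> 0.
  by apply: contrapT => h; apply: sl.1 => v; apply: contrapT => v0; apply: h; exists v.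
have [g gE] := actl_ex v.
have [||t m|h hE] := @mk_hom_at _ _ td d (R : grMod T) (irr_rep l) g.
- exact: at_modP.
- exact: hl.
- by rewrite !gE -actM.
exists h; apply: (simple_surj sl); exists (1 : T); rewrite hE gE; by rewrite act1.
Qed.

End HighestWeight.

Section RepleteCovers.
Variables (K : fieldType) (A : grAlg K) (C : cat) (U : functor C (GMod A)).
Hypothesis hU : replete U.

Lemma rep_proj_cover (X P : C) : @is_proj_cover (GMod A) (U X) (U P) -> is_proj_cover X P.
Proof.
move=> [Pp [p [pe pu]]]; split.
  move=> Y Z e f /(is_epiP hU)/gepiP ee.
  have [g gE] := Pp _ _ (fu U e) (fu U f) ee.
  have [g' g'E] := rep_full hU g; exists g'; apply: (rep_faith hU).
  by rewrite -gE -g'E /fu fmapM.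
have [p' p'E] := rep_full hU p; exists p'; split.
  by apply/(is_epiP hU)/gepiP; rewrite p'E.
move=> Y g /(is_epiP hU)/gepiP; rewrite {1}/fu fmapM -/(fu U p') p'E => /pu ge.
exact/(is_epiP hU)/gepiP.
Qed.

Lemma rep_inj_hull (X I : C) : @is_inj_hull (GMod A) (U X) (U I) -> is_inj_hull X I.
Proof.
move=> [Pp [p [pe pu]]]; split.
  move=> Y Z e f /(is_monoP hU)/gmonoP ee.
  have [g gE] := Pp _ _ (fu U e) (fu U f) ee.
  have [g' g'E] := rep_full hU g; exists g'; apply: (rep_faith hU).
  by rewrite -gE -g'E /fu fmapM.
have [p' p'E] := rep_full hU p; exists p'; split.
  by apply/(is_monoP hU)/gmonoP; rewrite p'E.
move=> Y g /(is_monoP hU)/gmonoP; rewrite {1}/fu fmapM -/(fu U p') p'E => /pu ge.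
exact/(is_monoP hU)/gmonoP.
Qed.

End RepleteCovers.

(** * The strata *)

Section Strata.
Variables (K : fieldType) (A : grAlg K) (td : tri_decomp A).
Notation T := (algT td).
Notation L := (simple_L td).
Notation dg := (degT td).
Implicit Types (M N : grMod T).

Lemma serre_degrees (Q : int -> Prop) :
  @is_serre (GMod A) (fun X => forall i, Q i -> gm_gr (X : grMod A) i = 0%VS).
Proof.
split=> [X /gzeroP X0 i _|X Y Z f g /gsesP [fi gs fg]].
  by apply/eqP; rewrite -subv0; apply/subvP => x _; rewrite (X0 x) mem0v.
split=> [Y0|[X0 Z0] i Qi].
  split=> i Qi; first exact: gr_zero_inj fi (Y0 i Qi).
  exact: gr_zero_surj gs (Y0 i Qi).
apply/eqP; rewrite -subv0; apply/subvP => y yi; rewrite memv0.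
have /fg [x yE] := gr_zero (Z0 i Qi) (hom_gr (g : grhom Y Z) yi).
rewrite -(gr_proj_id (gm_grP (Y : grMod A)) yi) yE (pr_hom (f : grhom X Y)).
by rewrite (gr_zero (X0 i Qi) (memv_gr_proj _ _ _)) linear0.
Qed.

Lemma gserre_isom (S : GMod A -> Prop) (X Y : GMod A) :
  is_serre S -> isom X Y -> S X -> S Y.
Proof.
move=> [S0 Se] /gisomP [f [fi fs]] SX.
have [Q [q [qs qP]]] := coker_mod f.
have Q0 : is_zero (Q : GMod A).
  by apply/gzeroP => z; have [y ->] := qs z; apply/qP; exact: fs.
by apply/(Se X Y Q f q ((gsesP _ _).2 (And3 fi qs qP))); split=> //; exact: S0.
Qed.

(** The modules vanishing in given degrees form a Serre class. Conversely a
    composition factor L(l) of such a module is nonzero in degree deg l. *)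
Lemma strat_degrees (R : int -> Prop) (X : GMod A) :
  (forall i j, i <= j -> R j -> R i) ->
  @serre_gen (GMod A) (fun Y => exists2 l, R (dg l) & Y = L l) X <->
  forall i, ~ R i -> gm_gr (X : grMod A) i = 0%VS.
Proof.
move=> Rd; split=> [h|].
  apply: (h _ (serre_degrees (fun i => ~ R i))) => Y [l Rl ->] i Ri.
  apply: simple_L_le; rewrite ltNge; apply/negP => il; apply: Ri; exact: Rd il Rl.
move=> hX S Ss SL; elim: (gmod_finite_length X) hX => [{}X X0 _|{}X Y Z f g _ IH sZ e hY].
  exact: Ss.1.
have [hX hZ] := ((serre_degrees (fun i => ~ R i)).2 X Y Z f g e).1 hY.
apply/(Ss.2 X Y Z f g e); split; first exact: IH.
have [l [lE hl]] := simple_classify td ((gsimpleP Z).1 sZ).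
apply: (gserre_isom Ss (isom_sym lE)); apply: SL; exists l => //.
apply: contrapT => Rl; apply: (hw_top hl).1 => m; apply: topi_inj.
by rewrite linear0; apply: (gr_zero (hZ _ Rl)); exact: topi_mem.
Qed.

Lemma strat_leP xi (X : GMod A) : strat_le L dg xi X <-> le_deg xi (X : grMod A).
Proof.
have := @strat_degrees (fun i => i <= xi) X; rewrite /strat_le => ->.
  split=> h i ix; apply: h; first by apply/negP; rewrite -ltNge.
  by rewrite ltNge; apply/negP.
by move=> i j; exact: le_trans.
Qed.

Lemma strat_ltP xi (X : GMod A) :
  strat_lt L dg xi X <-> forall i, xi <= i -> gm_gr (X : grMod A) i = 0%VS.
Proof.
have := @strat_degrees (fun i => i < xi) X; rewrite /strat_lt => ->.
  split=> h i ix; apply: h; first by apply/negP; rewrite -leNgt.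
  by rewrite leNgt; apply/negP.
by move=> i j; exact: le_lt_trans.
Qed.

Notation Cle xi := (cat_le L dg xi).
Notation Cat xi := (cat_at L dg xi).

Lemma cat_le_replete xi : replete (incl_functor (strat_le L dg xi)).
Proof.
apply: incl_replete => [M N i ii /strat_leP h | M N p ps /strat_leP h];
  apply/strat_leP; [exact: le_deg_inj ii h | exact: le_deg_surj ps h].
Qed.

Section Stratum.
Variable xi : int.
Notation topx := (top td xi).
Notation W := (serre_weq (@cat_lt_in _ _ _ _ _ L dg xi)).
Implicit Types X Y Z : Cle xi.

Definition und X : grMod A := sval X.
Definition uh X Y (f : hom X Y) : grhom (und X) (und Y) := f.

Lemma und_le X : le_deg xi (und X).
Proof. exact: (strat_leP xi (sval X)).1 (svalP X). Qed.

(** All degrees being at most xi, the kernel and cokernel of s belong to the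
    lower strata as soon as they vanish in degree xi. *)
Lemma weqP X Y (s : hom X Y) : W s <-> inj (topf td xi (uh s)) /\ surj (topf td xi (uh s)).
Proof.
have hU := cat_le_replete xi; split.
  move=> [[N [k [/(is_kerP hU) [ki kP] /strat_ltP N0]]]
          [Q [q [/(is_cokerP hU) [qs qP] /strat_ltP Q0]]]].
  split=> [m e|y].
    have /kP [w wE] : uh s (topi td xi (und X) m) = 0 by rewrite -topfE e linear0.
    apply: topi_inj; rewrite linear0.
    rewrite -(gr_proj_id (gm_grP (und X)) (topi_mem m)) wE (pr_hom (uh k)).
    by rewrite (gr_zero (N0 xi _) (memv_gr_proj _ _ _)) ?linear0.
  have yd := topi_mem y.
  have /qP [x xE] := gr_zero (Q0 xi (lexx _)) (hom_gr (uh q) yd).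
  exists (topp td xi (und X) x); apply: topi_inj; rewrite topfE topiK -pr_hom.
  by rewrite -[LHS](gr_proj_id (gm_grP (und Y)) yd) [in LHS]xE.
move=> [si ss]; split.
  have [N [k [ki kP]]] := fu_ker hU s; exists N, k; split; first exact/(is_kerP hU).
  apply/strat_ltP => i; rewrite le_eqVlt => /orP [/eqP <-|]; last exact: und_le.
  apply/eqP; rewrite -subv0; apply/subvP => w wd; rewrite memv0; apply/eqP/ki.
  have kd := hom_gr (uh k) wd.
  apply: etrans (esym (topiK_mem td kd)) _.
  rewrite (si (topp td xi (und X) (uh k w))) ?linear0 //.
  by apply: topi_inj; rewrite topfE topiK_mem // linear0; apply/kP; exists w.
have [Q [q [qs qP]]] := fu_coker hU s; exists Q, q; split; first exact/(is_cokerP hU).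
apply/strat_ltP => i; rewrite le_eqVlt => /orP [/eqP <-|]; last exact: und_le.
apply/eqP; rewrite -subv0; apply/subvP => z zd; rewrite memv0; apply/eqP.
have [y yd ->] := @gr_surj _ _ _ _ (uh q) _ _ qs zd.
have [m mE] := ss (topp td xi (und Y) y); apply/qP; exists (topi td xi (und X) m).
by apply: etrans (topfE (uh s) m); rewrite -mE topiK_mem.
Qed.

(** The inverse of f if there is one, so that words can be evaluated without
    carrying proofs of invertibility. *)
Definition ginvm M N (f : grhom M N) : grhom N M :=
  if pselect (exists g : grhom N M, grhom_comp g f = grhom_id M /\
                grhom_comp f g = grhom_id N) is left h then sval (cid h) else 0.

Lemma ginvmP M N (f : grhom M N) : inj f -> surj f ->
  grhom_comp (ginvm f) f = grhom_id M /\ grhom_comp f (ginvm f) = grhom_id N.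
Proof.
move=> fi fs; rewrite /ginvm; case: pselect => [h|]; last by case; exact: ginv.
by case: (cid h).
Qed.

(** The degree xi component of a morphism of the quotient category, computed
    on words. *)
Fixpoint leval X Y (t : lterm W X Y) : grhom (topx (und X)) (topx (und Y)) :=
  match t with
  | Lmor _ _ f => topf td xi (uh f)
  | Linv _ _ s _ => ginvm (topf td xi (uh s))
  | Lcomp _ _ _ t u => grhom_comp (leval t) (leval u)
  end.

Lemma leval_eqv X Y (t u : lterm W X Y) : leqv t u -> leval t = leval u.
Proof.
elim=> {X Y t u} //=.
- by move=> X Y t u v _ -> _ ->.
- by move=> X Y Z t t' u u' _ -> _ ->.
- by move=> X Y t; rewrite topf1 grhom_comp1m.
- by move=> X Y t; rewrite topf1 grhom_compm1.
- by move=> X Y Z V t u v; rewrite grhom_compA.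
- by move=> X Y Z g f; exact: topfM.
- by move=> X Y s w; have [si ss] := (weqP s).1 w;
    rewrite (ginvmP si ss).1 topf1.
- by move=> X Y s w; have [si ss] := (weqP s).1 w;
    rewrite (ginvmP si ss).2 topf1.
Qed.

Definition lev (X Y : Cat xi) (f : hom X Y) : grhom (topx (und X)) (topx (und Y)) :=
  leval (lrep f).

Lemma lev_class X Y (t : lterm W X Y) : lev (lclass t : @hom (Cat xi) X Y) = leval t.
Proof. by apply: leval_eqv; apply/lclassP; rewrite lrepK. Qed.

Lemma lev1 (X : Cat xi) : lev (idm X) = grhom_id _.
Proof. by rewrite [LHS]lev_class /= topf1. Qed.

Lemma levM (X Y Z : Cat xi) (g : hom Y Z) (f : hom X Y) :
  lev (g \oc f) = grhom_comp (lev g) (lev f).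
Proof. by rewrite [LHS]lev_class. Qed.

Definition topF : functor (Cat xi) (GMod T) :=
  @Functor (Cat xi) (GMod T) (fun X => topx (und X)) lev lev1 levM.

Notation pi := (pi_at L dg xi).

Lemma lev_pi X Y (f : hom X Y) : lev (fmap pi f) = topf td xi (uh f).
Proof. by rewrite [LHS]lev_class. Qed.

Definition Dob M (hM : at_deg xi M) : Cle xi :=
  exist _ (Delta_bar td M) ((strat_leP xi (Delta_bar td M)).2 (Delta_le hM)).

Definition Dtop X : Cle xi := Dob (top_at td xi (und X)).

Definition counit_ex X := Delta_counit td (und_le X).
Definition counit X : hom (Dtop X) X := sval (cid (counit_ex X)).

Lemma counitE X m : uh (counit X) (Delta_unit (topx (und X)) m) = topi td xi (und X) m.
Proof. exact: (svalP (cid (counit_ex X))). Qed.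

Definition Dhom X Y (f : grhom (topx (und X)) (topx (und Y))) : hom (Dtop X) (Dtop Y) :=
  Delta_map f.

Lemma counit_nat X Y (f : hom X Y) : f \oc counit X = counit Y \oc Dhom (topf td xi (uh f)).
Proof.
apply: (@Delta_ext _ _ td) => m; rewrite [LHS]homE [RHS]homE.
have := counitE m => /= ->; rewrite /Dhom Delta_mapE.
by have := counitE (topf td xi (uh f) m) => /= ->; rewrite topfE.
Qed.

Lemma counit_top X m m' : topi td xi _ m' = Delta_unit (topx (und X)) m ->
  topf td xi (uh (counit X)) m' = m.
Proof. by move=> e; apply: topi_inj; rewrite topfE e; exact: counitE. Qed.

Lemma counit_weq X : W (counit X).
Proof.
apply/weqP; have [g [gi gs gE]] := Delta_topu (top_at td xi (und X)).
split=> [m'|m]; last by exists (g m); rewrite (counit_top (gE m)).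
by have [m ->] := gs m'; rewrite (counit_top (gE m)) => ->; rewrite linear0.
Qed.

Lemma Dhom_comp X Y Z (g : grhom (topx (und Y)) (topx (und Z)))
    (f : grhom (topx (und X)) (topx (und Y))) :
  Dhom (grhom_comp g f) = Dhom g \oc Dhom f.
Proof. exact: Delta_mapM. Qed.

(** For a morphism this is naturality of the counit, and it passes to inverses and
    composites. As the counit is invertible in the localization, a word is
    determined by its degree xi component. *)
Lemma lclass_counit X Y (t : lterm W X Y) :
  (lclass t : @hom (Cat xi) X Y) \oc fmap pi (counit X) =
  fmap pi (counit Y) \oc fmap pi (Dhom (leval t)).
Proof.
elim: t => {X Y} [X Y f | X Y s w | X Y Z t IHt u IHu].
- by have := congr1 (fmap pi) (counit_nat f); rewrite [fmap pi (f \oc _)]fmapM fmapM.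
- have [si ss] := (weqP s).1 w; have [v1 v2] := ginvmP si ss.
  have e : fmap pi (counit Y) = fmap pi s \oc fmap pi (counit X) \oc
      fmap pi (Dhom (ginvm (topf td xi (uh s)))).
    rewrite -fmapM counit_nat -fmapM -compA -Dhom_comp v2.
    have -> : @Dhom Y Y (grhom_id _) = idm (Dtop Y) by exact: Delta_map1.
    by rewrite compm1.
  have V : (lclass (Linv w) : @hom (Cat xi) Y X) \oc fmap pi s = idm (X : Cat xi).
    by rewrite /= lcompE; apply/lclassP; exact: Leqv_Vm.
  by rewrite {1}e !compA V comp1m.
- have -> : (lclass (Lcomp t u) : @hom (Cat xi) X Z) =
      (lclass t : @hom (Cat xi) Y Z) \oc (lclass u : @hom (Cat xi) X Y).
    by rewrite /= lcompE.
  by rewrite -compA IHu compA IHt -compA -fmapM -Dhom_comp.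
Qed.

Lemma pi_weq X Y (s : hom X Y) : W s -> exists g : @hom (Cat xi) Y X,
  g \oc fmap pi s = idm _ /\ fmap pi s \oc g = idm _.
Proof.
move=> w; exists (lclass (Linv w)).
by split; rewrite /= lcompE; apply/lclassP; [exact: Leqv_Vm | exact: Leqv_mV].
Qed.

Lemma topF_replete : replete topF.
Proof.
split=> [X Y f | X Y f g | X S i ii | X Q p ps].
- have [v [v1 v2]] := pi_weq (counit_weq X).
  exists (fmap pi (counit Y) \oc fmap pi (Dhom f) \oc v).
  have [g [gi gs gE]] := Delta_topu (top_at td xi (und X)).
  have e : grhom_comp (lev (fmap pi (counit Y) \oc fmap pi (Dhom f))) g = f.
    apply: hom_ext => m; rewrite homE levM !lev_pi homE; apply: counit_top.
    by rewrite topfE gE; exact: Delta_mapE.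
  have e' : grhom_comp (lev (fmap pi (counit X))) g = grhom_id _.
    by apply: hom_ext => m; rewrite homE lev_pi hom1E; exact: counit_top (gE m).
  have e2 : grhom_comp (lev v) (lev (fmap pi (counit X))) = grhom_id _.
    by rewrite -levM v1 lev1.
  have e3 : lev v = g.
    by rewrite -[LHS]grhom_compm1 -e' grhom_compA e2 grhom_comp1m.
  by rewrite [LHS]levM e3.
- have [v [v1 v2]] := pi_weq (counit_weq X).
  rewrite /fu /= /lev => e.
  rewrite -[f]lrepK -[g]lrepK -[LHS](@compm1 (Cat xi)) -[RHS](@compm1 (Cat xi)).
  by rewrite -v2 !compA !lclass_counit e.
- have hS : at_deg xi S by exact: at_deg_inj ii (top_at td xi (und X)).
  have [g [gi gs gE]] := Delta_topu hS; exists (Dob hS).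
  have [h [h1 h2]] := ginv gi gs; exists h.
  split=> [x hx|y]; last by exists (g y); rewrite -homE h1 hom1E.
  by rewrite -[x]hom1E -h2 homE hx linear0.
- have hQ : at_deg xi Q by exact: at_deg_surj ps (top_at td xi (und X)).
  have [g [gi gs gE]] := Delta_topu hQ.
  by exists (Dob hQ), g.
Qed.

(** ** The adjoints of the quotient functors *)

Lemma Delta_functor1 (X : Cat xi) : Dhom (lev (idm X)) = idm (Dtop X).
Proof. by rewrite lev1; exact: Delta_map1. Qed.

Lemma Delta_functorM (X Y Z : Cat xi) (g : hom Y Z) (f : hom X Y) :
  Dhom (lev (g \oc f)) = Dhom (lev g) \oc Dhom (lev f).
Proof. by rewrite levM Dhom_comp. Qed.

Definition Delta_functor : functor (Cat xi) (Cle xi) :=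
  @Functor (Cat xi) (Cle xi) Dtop (fun X Y f => Dhom (lev f)) Delta_functor1 Delta_functorM.

Lemma Delta_functor_exact : exact Delta_functor.
Proof.
move=> X Y Z f g /(sesP topF_replete) h; apply/(sesP (cat_le_replete xi)).
exact: Delta_map_exact h.
Qed.

Lemma Delta_functor_unit (X : Cat xi) : exists e : @hom (Cat xi) X (pi (Delta_functor X)),
  forall m, topi td xi _ (lev e m) = Delta_unit (topx (und X)) m.
Proof.
have [g [gi gs gE]] := Delta_topu (top_at td xi (und X)).
by have [e eE] := rep_full topF_replete (g : grhom (topF X) (topF (pi (Delta_functor X))));
  exists e => m; rewrite -gE -eE.
Qed.

Lemma Delta_functor_adjoint : adjoint Delta_functor pi.
Proof.
exists (fun X => sval (cid (Delta_functor_unit X))).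
have etaE X m := svalP (cid (Delta_functor_unit X)) m.
split=> [X Y f | X Y f].
  apply: (rep_faith topF_replete); apply: hom_ext => m; apply: topi_inj.
  rewrite /fu /= !levM !homE etaE lev_pi topfE etaE.
  by apply: esym; exact: Delta_mapE.
have [g gE] := Delta_univ (lev f) (top_at td xi (und X)) (und_le Y).
exists (g : hom (Delta_functor X) Y); split.
  apply: (rep_faith topF_replete); apply: hom_ext => m; apply: topi_inj.
  by rewrite /fu /= levM homE lev_pi topfE etaE; exact: gE.
move=> g' e; apply: (@Delta_ext _ _ td) => m; rewrite gE -e.
by rewrite levM homE lev_pi topfE etaE.
Qed.

Definition Nob M (hM : at_deg xi M) : Cle xi :=
  exist _ (nabla_bar td M) ((strat_leP xi (nabla_bar td M)).2 (nabla_le hM)).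

Definition Ntop X : Cle xi := Nob (top_at td xi (und X)).
Definition Nhom X Y (f : grhom (topx (und X)) (topx (und Y))) : hom (Ntop X) (Ntop Y) :=
  nabla_map f.

Lemma nabla_functor1 (X : Cat xi) : Nhom (lev (idm X)) = idm (Ntop X).
Proof. by rewrite lev1; exact: nabla_map1. Qed.

Lemma nabla_functorM (X Y Z : Cat xi) (g : hom Y Z) (f : hom X Y) :
  Nhom (lev (g \oc f)) = Nhom (lev g) \oc Nhom (lev f).
Proof. by rewrite levM; exact: nabla_mapM. Qed.

Definition nabla_functor : functor (Cat xi) (Cle xi) :=
  @Functor (Cat xi) (Cle xi) Ntop (fun X Y f => Nhom (lev f)) nabla_functor1 nabla_functorM.

Lemma nabla_functor_exact : exact nabla_functor.
Proof.
move=> X Y Z f g /(sesP topF_replete) h; apply/(sesP (cat_le_replete xi)).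
exact: nabla_map_exact h.
Qed.

Lemma nabla_functor_unit X : exists e : grhom (und X) (nabla_bar td (topx (und X))),
  forall x, nabla_counit _ (e x) = topp td xi (und X) x.
Proof.
have [g gE] := nabla_univ (grhom_id _) (top_at td xi (und X)) (und_le X).
by exists g => x; rewrite gE hom1E.
Qed.

Lemma nabla_functor_adjoint : adjoint pi nabla_functor.
Proof.
exists (fun X => (sval (cid (nabla_functor_unit X)) : hom X (nabla_functor (pi X)))).
have etaE X x := svalP (cid (nabla_functor_unit X)) x.
have tf X Y (f : hom X Y) x :
    topp td xi (und Y) (uh f x) = topf td xi (uh f) (topp td xi (und X) x).
  by apply: topi_inj; rewrite topiK topfE topiK pr_hom.
split=> [X Y f | X Y f].
  apply: (@nabla_cp_ext _ _ td) => x; rewrite homE etaE homE.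
  have -> : fmap nabla_functor (fmap pi f) = Nhom (topf td xi (uh f)) by rewrite /= lev_pi.
  by rewrite nabla_mapE etaE tf.
have [h hE] := nabla_transpose (f : grhom (und X) (nabla_bar td (topx (und Y))))
  (top_at td xi (und Y)).
have [g gE] := rep_full topF_replete (h : grhom (topF (pi X)) (topF Y)).
have NE (g' : hom (pi X) Y) x :
    nabla_counit _ ((grhom_comp (Nhom (lev g')) (sval (cid (nabla_functor_unit X)))) x) =
    lev g' (topp td xi (und X) x).
  by rewrite homE nabla_mapE etaE.
exists g; split.
  apply: (nabla_ext (top_at td xi (und Y)) (X := und X)) => m.
  rewrite [LHS]NE toppK; have -> : lev g = h by exact: gE.
  by rewrite hE.
move=> g' e; apply: (rep_faith topF_replete); rewrite gE; apply: hom_ext => m.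
rewrite hE -e; apply: esym.
by have := NE g' (topi td xi (und X) m); rewrite toppK.
Qed.

End Stratum.

End Strata.

(** * Standard and costandard objects *)

Section StandardObjects.
Variables (K : fieldType) (A : grAlg K) (td : tri_decomp A).
Notation T := (algT td).
Notation L := (simple_L td).
Notation dg := (degT td).
Implicit Types (M N P : grMod T).

(** P_d already maps onto M, so that P_d -> P is onto because P is a cover. *)
Lemma cover_at d M P : at_deg d M -> @is_proj_cover (GMod T) M P -> at_deg d P.
Proof.
move=> hM [_ [p [/gepiP ps pu]]].
have [S [i [ii iP]]] := sub_mod (T_component_gsub P d).
have /gepiP is_ : @is_epi (GMod T) _ _ i.
  apply: pu; apply/gepiP => y.
  have [x xd ->] := gr_surj ps (at_mem y hM).
  have /iP [s ->] := xd; exists s; by rewrite homE.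
by apply/vspaceP => x; rewrite memvf; apply/iP.
Qed.

(** The projection P -> P_d is injective on M, hence injective. *)
Lemma hull_at d M P : at_deg d M -> @is_inj_hull (GMod T) M P -> at_deg d P.
Proof.
move=> hM [_ [i [/gmonoP ii iu]]].
have prT t (u : P) : pr P d (t ** u) = t ** pr P d u.
  by rewrite -{1}[d]add0r; apply: pr_act; exact: T_deg0.
have hU : gsub (lker (pr P d)).
  split=> [t u | j u]; rewrite !memv_ker => /eqP e.
    by rewrite prT e actr0.
  by rewrite gr_proj_proj; have [_|_] := eqVneq d j; rewrite ?e eqxx.
have [Q [q [qs qP]]] := quot_mod hU.
have /gmonoP qi : @is_mono (GMod T) _ _ q.
  apply: iu; apply/gmonoP => m; rewrite homE => /qP; rewrite memv_ker => /eqP.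
  by rewrite (pr_hom (i : grhom M P)) (at_pr m hM) => /ii.
apply/vspaceP => x; rewrite memvf; apply/(gr_memP (gm_grP P))/subr0_eq/qi/qP.
by rewrite memv_ker linearB /= gr_proj_proj eqxx subrr.
Qed.

Definition projT (l : IrrT td) : grMod T := @proj_cover (GMod T) (irr_rep l).
Definition injT (l : IrrT td) : grMod T := @inj_hull (GMod T) (irr_rep l).

Lemma projT_cover l : @is_proj_cover (GMod T) (irr_rep l) (projT l).
Proof. exact: proj_coverP. Qed.
Lemma projT_at l : at_deg (dg l) (projT l).
Proof. exact: cover_at (degT_at l) (projT_cover l). Qed.
Lemma injT_hull l : @is_inj_hull (GMod T) (irr_rep l) (injT l).
Proof. exact: inj_hullP. Qed.
Lemma injT_at l : at_deg (dg l) (injT l).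
Proof. exact: hull_at (degT_at l) (injT_hull l). Qed.

Lemma top_Delta_isom d M : at_deg d M ->
  @isom (GMod T) M (top td d (Delta_bar td M)).
Proof.
by move=> hM; have [g [gi gs _]] := Delta_topu hM; apply/gisomP; exists g.
Qed.

Lemma irr_top_isom l : @isom (GMod T) (irr_rep l) (top td (dg l) (L l)).
Proof. by apply/gisomP; exact: simple_L_top. Qed.

Lemma Delta_standard l : is_standard (Delta_functor td) l (Delta td l).
Proof.
exists (Dob (projT_at l)); split.
  apply: (rep_proj_cover (topF_replete td (dg l))).
  apply: proj_cover_isom (irr_top_isom l) _ (projT_cover l).
  exact: top_Delta_isom (projT_at l).
have [g [gi gs _]] := Delta_topu (projT_at l).
apply/gisomP; exists (Delta_map g); split; first exact: Delta_map_inj.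
exact: Delta_map_surj.
Qed.

Lemma nabla_costandard l : is_costandard (nabla_functor td) l (nabla td l).
Proof.
exists (Dob (injT_at l)); split.
  apply: (rep_inj_hull (topF_replete td (dg l))).
  apply: inj_hull_isom (irr_top_isom l) _ (injT_hull l).
  exact: top_Delta_isom (injT_at l).
have [g [gi gs _]] := Delta_topu (injT_at l).
apply/gisomP; exists (nabla_map g); split; last exact: nabla_map_surj.
move=> x gx; apply: (cp_sep (nabla_counitP (injT l))) => i; apply: gi.
by have := nabla_mapE g (coact (fr_n i) x); rewrite /coact hom_act gx actr0 linear0.
Qed.

End StandardObjects.

(** * Standard filtrations *)

Section Filtered.
Variables (K : fieldType) (A : grAlg K).
Implicit Types (X Y Z : grMod A) (F : GMod A -> Prop).

Lemma filtered_isom F X Y (f : grhom X Y) : inj f -> surj f ->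
  @filtered (GMod A) F X -> @filtered (GMod A) F Y.
Proof.
move=> fi fs; have [g [gf fg]] := ginv fi fs.
have gfE x : g (f x) = x by rewrite -homE gf hom1E.
have fgE x : f (g x) = x by rewrite -homE fg hom1E.
move=> hX; case: hX f g fi fs gf fg gfE fgE => [{}X /gzeroP X0|X0 {}X S a b hX0 hS /gsesP [ai bs ab]] f g fi fs gf fg gfE fgE.
  by apply: FiltZero; apply/gzeroP => y; rewrite -(fgE y) (X0 (g y)) linear0.
apply: (@FiltExt (GMod A) F X0 Y S (grhom_comp f a) (grhom_comp b g)) => //.
apply/gsesP; split.
- by move=> x; rewrite homE => /fi /ai.
- by move=> s; have [x ->] := bs s; exists (f x); rewrite homE gfE.
- move=> y; rewrite homE; split=> [/ab [x e]|[x ->]].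
    by exists x; rewrite homE -e fgE.
  by rewrite homE gfE; apply/ab; exists x.
Qed.

(** Pull the filtration of Z back to Y, starting above X. *)
Lemma filtered_ext F X Y Z (f : grhom X Y) (g : grhom Y Z) : gexact f g ->
  @filtered (GMod A) F X -> @filtered (GMod A) F Z -> @filtered (GMod A) F Y.
Proof.
move=> fg hX hZ; move: (hZ : @filtered (GMod A) F Z) Y f g fg.
elim=> [{hZ}Z' /gzeroP Z0|Z0 Z' S a b _ IH hS /gsesP [ai bs ab]] Y f g [fi gs fg].
  apply: (filtered_isom fi) hX => y; apply/fg; exact: Z0.
have [Y' [i [ii iP]]] := ker_mod (grhom_comp (b : grhom Z' S) g).
have [x|f' f'E] := glift_inj (f := f) ii.
  by apply/iP; rewrite homE (_ : g (f x) = 0) ?linear0 //; apply/fg; exists x.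
have [w|g' g'E] := @glift_inj K A Z0 Z' Y' a (grhom_comp g i) ai.
  by rewrite homE; apply/ab; rewrite -homE; apply/iP; exists w.
apply: (@FiltExt (GMod A) F Y' Y S i (grhom_comp (b : grhom Z' S) g)) => //.
  apply: (IH Y' f' g'); split.
  - by move=> x e; apply: fi; rewrite -f'E e linear0.
  - move=> z; have [y yE] := gs ((a : grhom Z0 Z') z).
    have /iP [w wE] : (grhom_comp (b : grhom Z' S) g) y = 0.
      by rewrite homE -yE; apply/ab; exists z.
    by exists w; apply: (injP ai); rewrite g'E homE -wE yE.
  - move=> w; split=> [e|[x ->]].
      have /fg [x xE] : g (i w) = 0 by rewrite -homE -g'E e linear0.
      by exists x; apply: (injP ii); rewrite f'E.
    by apply: ai; rewrite g'E homE f'E; apply/fg; exists x.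
apply/gsesP; split=> // s; have [z ->] := bs s; have [y ->] := gs z.
by exists y; rewrite homE.
Qed.

Lemma filtered_impl F F' X : (forall Y : GMod A, F Y -> F' Y) ->
  @filtered (GMod A) F X -> @filtered (GMod A) F' X.
Proof.
move=> FF'; elim=> [Y|Y Z S f g _ hY hS e]; first exact: FiltZero.
exact: (@FiltExt (GMod A) F' Y Z S f g hY (FF' _ hS) e).
Qed.

End Filtered.

Section StandardFiltrations.
Variables (K : fieldType) (A : grAlg K) (td : tri_decomp A).
Notation T := (algT td).
Notation L := (simple_L td).
Notation dg := (degT td).
Implicit Types (X Y Z : grMod A) (M N P : grMod T).

Lemma gproj_lift (A' : grAlg K) (Q X Y : grMod A') (e : grhom X Y) (f : grhom Q Y) :
  @is_projective (GMod A') Q -> surj e ->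
  exists g : grhom Q X, forall x, e (g x) = f x.
Proof.
move=> Qp es; have [g gE] := Qp X Y e f ((gepiP (e : @hom (GMod A') X Y)).2 es).
by exists g; exact: gcompE gE.
Qed.

Lemma Delta_zero M : gzero M -> gzero (Delta_bar td M : grMod A).
Proof.
move=> M0 x; have [c ->] := ip_gen (Delta_unitP M) x; apply: big1 => i _.
by rewrite (M0 (c i)) linear0 actr0.
Qed.

(** The cover of a simple quotient of M is a direct summand of M, with a smaller
    projective complement; induction is exact. *)
Lemma Delta_filtered d M : at_deg d M -> @is_projective (GMod T) M ->
  @filtered (GMod A) (fun X : GMod A => exists2 m, dg m = d & isom X (Delta td m))
    (Delta_bar td M).
Proof.
have [n] := ubnP (\dim {:M}); elim: n M => // n IH M Mn hM pM.
have [M0|nz] := pselect (gzero M).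
  by apply: FiltZero; apply/gzeroP; exact: Delta_zero.
have [S [p [sS ps]]] := simple_quotient_nz nz.
have [l /gisomP [a [ai as_]]] := irr_of sS.
have hl : dg l = d.
  by apply: degT_eq; apply: (at_deg_inj ai); exact: at_deg_surj ps hM.
have [Pp [c [/gepiP cs cu]]] := projT_cover l.
pose c' : grhom (projT l) S := grhom_comp a (c : grhom (projT l) (irr_rep l)).
have c's : surj c'.
  by move=> y; have [z ->] := as_ y; have [x ->] := cs z; exists x; rewrite homE.
have [h hE] := gproj_lift p pM c's.
have /gepiP hs : @is_epi (GMod T) _ _ h.
  apply: cu; apply/gepiP => y; have [x xE] := ps (a y); exists x.
  by apply: (injP ai); rewrite xE -hE !homE.
have [s sE] := gproj_lift (grhom_id (projT l)) Pp hs.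
have [N [i [ii iP]]] := ker_mod h.
have [x|r rE] := @glift_inj K _ N M M i (grhom_id M - grhom_comp s h) ii.
  apply/iP; rewrite /grhom_hom /= add_lfunE opp_lfunE linearB /= id_lfunE comp_lfunE.
  by have := sE (h x); rewrite hom1E => ->; rewrite subrr.
have rE' x : i (r x) = x - s (h x).
  by rewrite rE /grhom_hom /= add_lfunE opp_lfunE id_lfunE comp_lfunE.
have hi x : h (i x) = 0 by apply/iP; exists x.
have pN : @is_projective (GMod T) N.
  apply: (@retract_proj (GMod T) M N i r) => //.
  by apply: hom_ext => x; apply: (injP ii); rewrite homE hom1E rE' hi linear0 subr0.
have ex : gexact i h by [].
have dN : (\dim {:N} < n)%N.
  move: Mn; rewrite ltnS; apply: leq_trans; rewrite ltn_neqAle (inj_dim ii) andbT.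
  apply/eqP => e; have is_ : surj i by apply: inj_surj => //; rewrite e.
  have [z z0] : exists z : (irr_rep l : GMod T), z <> 0.
    by apply: contrapT => k; apply: (irr_simple l).1 => z; apply: contrapT => z0; apply: k; exists z.
  apply: z0; have [y ->] := cs z; have [x ->] := hs y; have [w ->] := is_ x.
  by rewrite hi linear0.
have hN : at_deg d N by exact: at_deg_inj ii hM.
have [e1 e2 e3] := Delta_map_exact ex.
apply: (@FiltExt (GMod A) _ (Delta_bar td N) (Delta_bar td M) (Delta_bar td (projT l))
  (Delta_map i) (Delta_map h)).
- exact: IH.
- by exists l => //; exact: isom_refl.
- by apply/gsesP; split.
Qed.

(** Projectivity relative to the modules of degrees at most d; unlike
    projectivity it survives truncation to lower degrees. *)
Definition proj_le (d : int) X : Prop := le_deg d X /\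
  forall Y Z (e : grhom Y Z) (f : grhom X Z), le_deg d Y -> le_deg d Z -> surj e ->
    exists g : grhom X Y, forall x, e (g x) = f x.

(** Maps X_d -> M correspond to maps X -> nabla-bar(M), and nabla-bar preserves
    surjections. The components of M outside degree d are discarded first, so
    that nabla-bar(M) has degrees at most d. *)
Lemma proj_le_top d X : proj_le d X -> @is_projective (GMod T) (top td d X).
Proof.
move=> [hX pX] M M' e f /gepiP es.
have [S [i [ii iP]]] := sub_mod (T_component_gsub (M : grMod T) d).
have [S' [i' [i'i i'P]]] := sub_mod (T_component_gsub (M' : grMod T) d).
have at_S (Q Q' : grMod T) (j : grhom Q Q') : inj j ->
    (forall x, x \in gm_gr Q' d <-> exists s, x = j s) -> at_deg d Q.
  move=> ji jP; apply/vspaceP => s; rewrite memvf; apply/(gr_memP (gm_grP Q)).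
  by apply: (injP ji); rewrite -pr_hom gr_proj_id //; apply/jP; exists s.
have hS := at_S _ _ _ ii iP; have hS' := at_S _ _ _ i'i i'P.
have [w|eS eSE] := @glift_inj K T S' M' S i' (grhom_comp (e : grhom M M') i) i'i.
  by apply/i'P; rewrite homE; apply/hom_gr/iP; exists w.
have eSs : surj eS.
  move=> y; have yd : i' y \in gm_gr (M' : grMod T) d by apply/i'P; exists y.
  have [x /iP [s ->] yE] := gr_surj es yd.
  by exists s; apply: (injP i'i); rewrite eSE homE.
have [m|f' f'E] := @glift_inj K T S' M' _ i' (f : grhom (top td d X) M') i'i.
  by apply/i'P; apply: hom_gr; exact: at_mem (top_at td d X).
have [phi phiE] := nabla_univ f' hS' hX.
have [psi psiE] := pX _ _ (nabla_map eS) phi (nabla_le hS) (nabla_le hS')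
  (nabla_map_surj eSs).
have [h hE] := nabla_transpose psi hS.
exists (grhom_comp i h); apply: hom_ext => m; rewrite !homE -homE -eSE hE.
by rewrite -nabla_mapE psiE phiE toppK f'E.
Qed.

End StandardFiltrations.

(** ** Induction from B^+ *)

Section BorelInduction.
Variables (K : fieldType) (A : grAlg K) (td : tri_decomp A).
Implicit Types X Y Z : grMod A.

Lemma BP_aspace_subproof : is_aspace (BP td).
Proof.
rewrite /is_aspace has_algid1 /=; last exact: halfT_1 (tdP_gr td).
apply/prodvP => x y xB yB; exact: halfT_M (tdPT td) _ _ xB yB.
Qed.

Definition BP_aspace : {aspace A} := ASpace BP_aspace_subproof.

Lemma BP_gr_subalg : gr_subalg BP_aspace.
Proof. split; [exact: halfT_1 (tdP_gr td) | exact: halfT_graded (tdP_gr td)]. Qed.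

Definition BPalg : grAlg K := subAlg BP_gr_subalg.
Implicit Types W : grMod BPalg.

Definition toBP (x : A) : BPalg := vsproj BP_aspace x.

Lemma mem_BPalg_gr i (b : BPalg) : (b \in ga_gr BPalg i) = (vsval b \in ga_gr A i).
Proof. exact: mem_sub_gr. Qed.

Lemma toBPE x : x \in BP td -> vsval (toBP x) = x.
Proof. by move=> xB; rewrite /toBP vsprojK. Qed.

Lemma BPalg1 : vsval (1 : BPalg) = 1.
Proof.
have e : algid BP_aspace = 1 by apply/eqP; rewrite algid_eq1 BP_gr_subalg.1.
exact: e.
Qed.

Lemma toBP_lin : linear toBP. Proof. by move=> k x y; rewrite /toBP linearP. Qed.

Lemma toBP_1 : toBP 1 = 1.
Proof. by apply: val_inj; rewrite /= toBPE ?(fr_1B (BP_free td)) //; exact/esym/BPalg1. Qed.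

Lemma toBP_M x y : x \in BP td -> y \in BP td -> toBP (x * y) = toBP x * toBP y.
Proof.
move=> xB yB; apply: val_inj; rewrite /= !toBPE //; exact: (fr_BM (BP_free td)).
Qed.

Lemma toBP_gr i x : x \in BP td -> x \in ga_gr A i -> toBP x \in ga_gr BPalg i.
Proof. by move=> xB xi; rewrite mem_BPalg_gr toBPE. Qed.

(** Induction from B^+ -modules, for the same basis of A over B^+ as in the
    induction of T-modules, so that coordinates can be compared. *)
Definition BP_free_self : free_ext (BP td) toBP :=
  FreeExt (@fr_bB _ _ _ _ _ (BP_free td)) (@fr_sum _ _ _ _ _ (BP_free td))
    (@fr_bn _ _ _ _ _ (BP_free td)) (@fr_ndeg _ _ _ _ _ (BP_free td))
    (@fr_bdeg _ _ _ _ _ (BP_free td)) (fr_1B (BP_free td)) (@fr_BM _ _ _ _ _ (BP_free td))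
    toBP_lin toBP_1 toBP_M toBP_gr (fr_1 (BP_free td)).

Lemma BPalg_neg i (b : BPalg) : i < 0 -> b \in ga_gr BPalg i -> b = 0.
Proof.
move=> i0; rewrite mem_BPalg_gr => bi; apply: val_inj => /=.
rewrite -(gr_proj_id (ga_grP A) bi); apply: BP_vanish i0; exact: subvsP.
Qed.

Lemma res_exists X : exists (V : grMod BPalg) (j : 'Hom(V, X)),
  [/\ inj j, surj j, forall (b : BPalg) v, j (b ** v) = vsval b ** j v
    & forall i v, v \in gm_gr V i <-> j v \in gm_gr X i].
Proof.
pose act (b : BPalg) (x : X) : X := vsval b ** x.
have actP : is_action act.
  split; first split.
  - by move=> b k x y; rewrite /act linearP.
  - by move=> x k b c; rewrite /act actDl actZl.
  - by move=> x; rewrite /act BPalg1 act1.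
  - by move=> b c x; rewrite /act -actM.
have actG i j b x : b \in ga_gr BPalg i -> x \in gm_gr X j -> act b x \in gm_gr X (i + j).
  by rewrite mem_BPalg_gr; exact: gm_grM.
exists (GrMod actP (gm_grP X) actG), \1%VF; split.
- by move=> x; rewrite id_lfunE.
- by move=> x; exists x; rewrite id_lfunE.
- by move=> b v; rewrite !id_lfunE.
- by move=> i v; rewrite id_lfunE.
Qed.

(** As B^+ has degrees at least 0, the components of degree larger than d form a
    submodule, which is divided out. *)
Lemma truncate d (F : grMod BPalg) : exists (W : grMod BPalg) (p : grhom F W),
  [/\ surj p, le_deg d W & forall x, p x = 0 <-> forall i, i <= d -> pr F i x = 0].
Proof.
have [s us es] := gr_projE (gm_grP F).
pose f := (\sum_(i <- s | (i <= d)%R) pr F i)%R : 'End(F).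
have fE x : x \in lker f <-> forall i, i <= d -> pr F i x = 0.
  rewrite memv_ker sum_lfunE; split=> [/eqP e i id_|h]; last first.
    by rewrite big1 // => i id_; exact: h.
  have := congr1 (pr F i) e; rewrite linear0 linear_sum => <-.
  rewrite {1}(es x) linear_sum [RHS]big_mkcond /=; apply: eq_bigr => j _.
  by rewrite gr_proj_proj; case: eqVneq => [<-|_]; rewrite ?id_ //; case: ifP.
have hU : gsub (lker f).
  split=> [b x /fE h|i x /fE h]; apply/fE => j jd.
    elim/(@gr_span K _ _ (ga_grP BPalg)): b => [|b c hb hc|i b bi].
    - by rewrite act0l linear0.
    - by rewrite actDl linearD /= hb hc addr0.
    - have [i0|i0] := ltP i 0; first by rewrite (BPalg_neg i0 bi) act0l linear0.
      rewrite -(subrK i j) [j - i + i]addrC (pr_act _ _ bi) h ?actr0 //.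
      by apply: le_trans jd; rewrite gerDl oppr_le0.
  by rewrite gr_proj_proj; case: eqVneq => // _; exact: h.
have [W [p [ps pU]]] := quot_mod hU; exists W, p; split=> //; last first.
  by move=> x; rewrite pU fE.
move=> i di; apply/eqP; rewrite -subv0; apply/subvP => w /(gr_surj ps) [x xi ->].
rewrite memv0; apply/eqP/pU/fE => j jd; apply: (gr_proj_0 _ _ xi).
by rewrite gt_eqF //; exact: le_lt_trans di.
Qed.

(** W is the free B^+ -module on the graded space X, truncated to degrees at
    most d; the truncation does not affect the map to X. *)
Lemma borel_cover d X : le_deg d X ->
  exists (W : grMod BPalg) (E : grMod A) (u : 'Hom(W, E)) (g : grhom E X),
    [/\ le_deg d W, ind_prop BP_free_self u & surj g].
Proof.
move=> hX; have [V [j [ji js jB jG]]] := res_exists X.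
have [D _] := free_ext_scalars BPalg.
have hv := ind_unitP D V; set v := ind_unit D V in hv.
have [x m x1|i m mi|g0 g0E] := @ip_lift _ _ _ _ _ D V _ v hv V \1%VF.
- by rewrite !id_lfunE.
- by rewrite id_lfunE.
have [W [p [ps hW pP]]] := truncate d (induced 1%VS id V : grMod BPalg).
have [x|g1 g1E] := gfact_surj (p := p) (f := g0) ps.
  move=> /pP h; apply: (@gr_eq0 _ _ _ (gm_grP V)) => i; rewrite pr_hom.
  have [id_|di] := leP i d; first by rewrite h // linear0.
  rewrite -pr_hom; apply: ji.
  exact: gr_zero (hX i di) ((jG _ _).1 (memv_gr_proj _ _ _)).
have hu := ind_unitP BP_free_self W; set u := ind_unit BP_free_self W in hu.
have [x m xB|i m mi|g gE] := @ip_lift _ _ _ _ _ BP_free_self W _ u hu X (j \o g1)%VF.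
- by rewrite !comp_lfunE hom_act jB toBPE.
- by rewrite comp_lfunE; apply/jG/hom_gr.
exists W, (induced (BP td) toBP W : grMod A), u, g; split=> // x.
have [y ->] := js x; exists (u (p (v y))).
by rewrite gE comp_lfunE g1E g0E id_lfunE.
Qed.

(** An element of E of degree d lies in W, since N has degrees at most 0 and W
    has degrees at most d; and E is free along the basis of N. *)
Lemma borel_free d W (E : grMod A) (u : 'Hom(W, E)) : le_deg d W -> ind_prop BP_free_self u ->
  forall c : 'I_(fr_r (BP_free td)) -> E, (forall i, c i \in gm_gr E d) ->
    \sum_i fr_n i ** c i = 0 -> forall i, c i = 0.
Proof.
move=> hW hu c cd.
have top x : x \in gm_gr E d -> exists w, x = u w.
  by apply: (ind_top hu) hW => i; [exact: BP_free_deg | exact: BP_free_deg0].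
have /choice [w wE] i := top _ (cd i).
have -> : c = (fun i => u (w i)) by apply/funext => k; rewrite wE.
by move=> h i; rewrite (ip_free hu h) linear0.
Qed.

(** X splits off a module E as above, so the basis of N acts freely on X_d as
    well; this is injectivity of Delta-bar(X_d) -> X in coordinates. *)
Lemma proj_le_counit d X (c : grhom (Delta_bar td (top td d X)) X) :
  proj_le d X -> (forall m, c (Delta_unit (top td d X) m) = topi td d X m) -> inj c.
Proof.
move=> [hX pX] cE.
have [W [E [u [g [hW hu gs]]]]] := borel_cover hX.
have hE : le_deg d E by apply: ind_le hu _ _ hW => i; exact: BP_free_deg.
have [s sE] := pX _ _ g (grhom_id X) hE hX gs.
have si : inj s by move=> x sx; rewrite -[x]hom1E -sE sx linear0.
move=> z; have [b ->] := ip_gen (Delta_unitP _) z => e.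
apply: big1 => i _; suff -> : b i = 0 by rewrite linear0 actr0.
apply: topi_inj; rewrite linear0; apply: si.
apply: (borel_free hW hu (c := fun i => s (topi td d X (b i)))).
  by move=> j; apply: hom_gr; exact: topi_mem.
have := congr1 s e; rewrite linear0; apply: etrans.
rewrite !linear_sum; apply: eq_bigr => j _ /=.
by rewrite !hom_act cE.
Qed.

(** * Descending through the degrees *)

Notation G d := (fun Y : GMod A => exists2 m : IrrT td, d < degT td m & isom Y (Delta td m)).

(** Divide out the image Delta-bar(X_k) of the highest component, k = d + n, and
    continue with the quotient. Maps to modules of degrees below k kill X_k, which
    gives both relative projectivity of the quotient and the factorization that
    is used to compare X' with L(l). *)
Lemma descend (n : nat) d X : proj_le (d + n%:Z) X ->
  exists (X' : grMod A) (p : grhom X X') (Q : grMod A) (f : grhom Q X),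
  [/\ gexact f p, proj_le d X', @filtered (GMod A) (G d) Q
    & forall Y (g : grhom X Y), le_deg d Y -> exists h : grhom X' Y,
        forall x, h (p x) = g x].
Proof.
elim: n X => [|n IH] X pX.
  rewrite addr0 in pX; have [Z [z [zi zP]]] := sub_mod (gsub0 X).
  have Z0 : gzero Z.
    by move=> w; apply: zi; apply/eqP; rewrite -memv0; apply/zP; exists w.
  exists X, (grhom_id X), Z, z; split=> //.
  - split=> // [x | y]; first by exists x; rewrite hom1E.
    by rewrite hom1E -zP memv0; split=> [->|/eqP].
  - by apply: FiltZero; apply/gzeroP.
  - by move=> Y g _; exists g => x; rewrite hom1E.
set k := d + n.+1%:Z in pX.
have kE : k = (d + n%:Z) + 1 by rewrite /k -addrA -PoszD addn1.
have [c cE] := Delta_counit td pX.1.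
have ci := proj_le_counit pX cE.
have [Q1 [q [qs qP]]] := coker_mod c.
have Q1le : le_deg (d + n%:Z) Q1.
  move=> i; rewrite -lezD1 -kE le_eqVlt => /orP [/eqP <-|ik].
    apply/eqP; rewrite -subv0; apply/subvP => y /(gr_surj qs) [x xk ->].
    rewrite memv0; apply/eqP/qP; exists (Delta_unit _ (topp td k X x)).
    by rewrite cE topiK_mem.
  exact: gr_zero_surj qs (pX.1 i ik).
have fact Y (g : grhom X Y) : le_deg (d + n%:Z) Y ->
    exists h : grhom Q1 Y, forall x, h (q x) = g x.
  move=> hY; apply: gfact_surj qs _ => x /qP [y ->].
  have [b ->] := ip_gen (Delta_unitP _) y; rewrite !linear_sum big1 // => i _ /=.
  rewrite !hom_act cE (gr_zero (hY k _) (hom_gr g (topi_mem _))) ?actr0 //.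
  by rewrite kE ltzD1.
have pQ1 : proj_le (d + n%:Z) Q1.
  split=> // Y Z e f hY hZ es.
  have dk : d + n%:Z <= k by rewrite kE lerDl.
  have [g gE] := pX.2 _ _ e (grhom_comp f q) (le_deg_trans dk hY) (le_deg_trans dk hZ) es.
  have [h hE] := fact _ g hY; exists h => y; have [x ->] := qs y.
  by rewrite hE gE homE.
have [X' [p' [Q [f [[fi p's fp] pX' fQ univ]]]]] := IH _ pQ1.
have [N [j [ji jP]]] := ker_mod (grhom_comp p' q).
have [x|c' c'E] := glift_inj (f := c) ji.
  apply/jP; rewrite homE (_ : q (c x) = 0) ?linear0 //; apply/qP; by exists x.
have [w|q' q'E] := @glift_inj _ _ Q Q1 N f (grhom_comp q j) fi.
  by rewrite homE; apply/fp; rewrite -homE; apply/jP; exists w.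
exists X', (grhom_comp p' q), N, j; split=> //.
- by split=> // z; have [y ->] := p's z; have [x ->] := qs y; exists x; rewrite homE.
- apply: (@filtered_ext _ _ (G d) (Delta_bar td (top td k X)) N Q c' q') => //.
    split.
    + by move=> x e; apply: ci; rewrite -c'E e linear0.
    + move=> z; have [y yE] := qs (f z).
      have /jP [w wE] : (grhom_comp p' q) y = 0.
        by rewrite homE -yE; apply/fp; exists z.
      by exists w; apply: (injP fi); rewrite q'E homE -wE yE.
    + move=> w; split=> [e|[x ->]].
        have /qP [x xE] : q (j w) = 0 by rewrite -homE -q'E e linear0.
        by exists x; apply: (injP ji); rewrite c'E.
      by apply: fi; rewrite q'E homE c'E; apply/qP; exists x.
  apply: filtered_impl (Delta_filtered (top_at td k X) (proj_le_top pX)).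
  by move=> Y [m mk iso]; exists m => //; rewrite mk /k ltrDl.
- move=> Y g hY.
  have [|h hE] := fact _ g; first by apply: (le_deg_trans _ hY); rewrite lerDl.
  have [h' h'E] := univ _ h hY; exists h' => x; by rewrite homE h'E hE.
Qed.

(** ** The projective cover of L(l) *)

(** Maps out of Delta(l) are maps of T-modules out of the projective P_T(l). *)
Lemma Delta_proj_le l : proj_le (degT td l) (Delta td l : grMod A).
Proof.
split; first exact: Delta_le (projT_at l).
move=> Y Z e f hY hZ es; pose d := degT td l.
have [g [gi gs gE]] := Delta_topu (projT_at l).
have tes : surj (topf td d e).
  move=> z; have [y yd zE] := gr_surj es (topi_mem z).
  by exists (topp td d Y y); apply: topi_inj; rewrite topfE topiK_mem.
have [h hE] := gproj_lift (grhom_comp (topf td d f) g) (projT_cover l).1 tes.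
have [k kE] := Delta_univ h (projT_at l) hY; exists k.
move=> x; rewrite -homE; congr (grhom_hom _ x); apply: Delta_ext => m.
by rewrite homE kE -topfE hE homE topfE gE.
Qed.

(** In degree d such an endomorphism is an endomorphism of P_T(l) over l, hence
    onto because P_T(l) is a cover; and degree d generates Delta(l). *)
Lemma Delta_essential l : exists p : grhom (Delta td l) (simple_L td l), surj p /\
  forall h : grhom (Delta td l) (Delta td l), (forall x, p (h x) = p x) -> surj h.
Proof.
have [q [qs qP]] := simple_LP l.
have [Pp [c [/gepiP cs cu]]] := projT_cover l; pose c' : grhom (projT l) (irr_rep l) := c.
have [g [gi gs gE]] := Delta_topu (projT_at l).
exists (grhom_comp q (Delta_map c')); split=> [y | h hp].
  have [x ->] := qs y; have [z ->] := Delta_map_surj cs x.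
  by exists z; rewrite homE.
have [v [v1 v2]] := ginv gi gs; have gv y : g (v y) = y by rewrite -homE v2 hom1E.
pose eta : grhom (projT l) (projT l) := grhom_comp v (grhom_comp (topf td (degT td l) h) g).
have etaE m : h (Delta_unit (projT l) m) = Delta_unit (projT l) (eta m).
  by rewrite -gE -gE -topfE /eta !homE gv.
have /gepiP es : @is_epi (GMod (algT td)) _ _ eta.
  suff e m : c' (eta m) = c' m.
    by apply: cu; apply/gepiP => y; have [x ->] := cs y; exists x; rewrite homE e.
  apply/subr0_eq.
  have [g' [g'i _ g'E]] := Delta_topu (degT_at l); apply: g'i.
  apply: (hw_quot_inj qP); rewrite g'E linearB linearB /= -!Delta_mapE -etaE.
  by have := hp (Delta_unit (projT l) m); rewrite !homE => ->; rewrite subrr.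
move=> x; have [b ->] := ip_gen (Delta_unitP (projT l)) x.
have /choice [b' b'E] i := es (b i).
exists (\sum_i fr_n i ** Delta_unit (projT l) (b' i)); rewrite linear_sum.
by apply: eq_bigr => i _ /=; rewrite hom_act etaE b'E.
Qed.

(** Let X be what remains of P(l) in degrees at most deg l. Lifting gives maps
    f : Delta(l) -> X and g : X -> Delta(l) over L(l); g o f is onto by
    [Delta_essential], and f o g is onto because it lifts to an endomorphism of
    the cover P(l) over L(l). So g is an isomorphism. *)
Lemma cover_filtration l : exists (P Q : GMod A) (p : hom P (Delta td l)) (k : hom Q P),
  [/\ is_proj_cover (simple_L td l) P, is_epi p, is_ker p k & filtered (G (degT td l)) Q].
Proof.
pose P : GMod A := proj_cover (simple_L td l); set d := degT td l.
have hP : is_proj_cover (simple_L td l) P by exact: proj_coverP.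
have [Pp [r [/gepiP rs ru]]] := hP; pose r' : grhom P (simple_L td l) := r.
have [n Pn] : exists n : nat, proj_le (d + n%:Z) P.
  have [b hb] := gr_bound (gm_grP (P : grMod A)).
  exists (absz (b - d)); split=> [i di|Y Z e f _ _ es]; last exact: gproj_lift Pp es.
  apply: hb; apply: le_lt_trans di; rewrite -lerBlDl; exact: ler_norm.
have [X [p [Q [k [[ki ps kp] pX fQ univ]]]]] := descend Pn.
have [a aE] := univ _ r' (@simple_L_le _ _ _ l).
have as_ : surj a by move=> y; have [x ->] := rs y; exists (p x); rewrite aE.
have [b [bs bess]] := Delta_essential l.
have hL := @simple_L_le _ _ _ l.
have pD := Delta_proj_le l.
have [f fE] := pD.2 _ _ a b pX.1 hL as_.
have [g gE] := pX.2 _ _ b a pD.1 hL bs.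
have gfs : surj (grhom_comp g f) by apply: bess => x; rewrite homE gE fE.
have gs : surj g by move=> y; have [x ->] := gfs y; exists (f x); rewrite homE.
have fs : surj f.
  have [t tE] := gproj_lift (grhom_comp (grhom_comp f g) p) Pp ps.
  have /gepiP ts : @is_epi (GMod A) P P t.
    apply: ru; apply/gepiP => y; have [x ->] := rs y; exists x.
    by rewrite homE -[RHS]aE tE !homE fE gE aE.
  move=> y; have [x ->] := ps y; have [z ->] := ts x.
  by exists (g (p z)); rewrite tE !homE.
have gi : inj g by apply: (surj_inj gs); exact: surj_dim fs.
exists P, Q, (grhom_comp g p), k; split=> //.
  by apply/gepiP => y; have [x ->] := gs y; have [z ->] := ps x; exists z; rewrite homE.
apply/gkerP; split=> // x; rewrite homE; split=> [/gi /kp //|/kp ->].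
by rewrite linear0.
Qed.

End BorelInduction.

Theorem theorem4p11 (K : fieldType) (A : grAlg K) (td : tri_decomp A) :
  standardly_stratified (simple_L td) (degT td) (Delta td) /\
  costandard_objects (simple_L td) (degT td) (nabla td).
Proof.
split; last first.
  exists (nabla_functor td); split; last exact: nabla_costandard.
  by move=> xi; split; [exact: nabla_functor_exact | exact: nabla_functor_adjoint].
split; first split.
- exact: gmod_abelian.
- exact: gmod_finite_length.
- move=> X; have [P [p [Pp ps]]] := enough_proj (X : grMod A).
  by exists P, p; split=> //; exact/gepiP.
- exact: abs_simple td.
split; first split.
- by move=> l; apply/gsimpleP; exact: simple_L_simple.
- exact: simple_L_inj.
- by move=> X /gsimpleP sX; have [l [h _]] := simple_classify td sX; exists l.
split; first split.
- move=> x y; exists [seq x + i%:Z | i <- iota 0 (absz (y - x)).+1] => z /andP [xz zy].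
  apply/mapP; exists (absz (z - x)); last by rewrite gez0_abs ?subr_ge0 // addrCA subrr addr0.
  rewrite mem_iota add0n /= ltnS -lez_nat !gez0_abs ?subr_ge0 ?(le_trans xz) //.
  by rewrite lerD2r.
- exact: finite_fibres.
split; last exact: cover_filtration.
exists (Delta_functor td); split; last exact: Delta_standard.
by move=> xi; split; [exact: Delta_functor_exact | exact: Delta_functor_adjoint].
Qed.
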